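(* Let $x\in\mathbb{C}\setminus\{0\}$ and $t\in\mathbb{C}$. The following identities hold, each whenever all the terms occurring in it are defined (that is, $t\ne W_k(x)$ for all $k$ in the identities containing $1/(W_k(x)-t)$ or its square, and $x\ne -1/e$ in the identities containing $1/(W_k(x)+1)$, one of its powers, or $W_k'(x)$): $$\sum_{k\in\mathbb{Z}}\frac{1}{W_k(x)-t}=\frac12+\frac{1+t}{xe^{-t}-t}\;,\qquad \sum_{k\in\mathbb{Z}}\frac{1}{W_k(x)+1}=\frac12\;,$$ $$\sum_{k\in\mathbb{Z}}\frac{1}{W_k(x)}=\frac12+\frac1x\;,\qquad \sum_{k\in\mathbb{Z}}\frac{1}{W_k(x)^2}=\frac{2x+1}{x^2}\;,\qquad \sum_{k\in\mathbb{Z}}\frac{1}{W_k(x)^3}=\frac{3x^2+6x+2}{2x^3}\;,$$ $$\prod_{k\in\mathbb{Z}}\left(1-\frac{t}{W_k(x)}\right)=e^{-t/2}-\frac{t}{x}e^{t/2}\;,\qquad \sum_{k\in\mathbb{Z}}\frac{1}{(W_k(x)+1)(W_k(x)-t)}=\frac{1}{xe^{-t}-t}\;,$$ $$\sum_{k\in\mathbb{Z}}\frac{1}{(W_k(x)-t)^2}=\frac{xe^{-t}(2+t)+1}{(xe^{-t}-t)^2}\;,\qquad \sum_{k\in\mathbb{Z}}\frac{1}{(W_k(x)+1)^2}=\frac{1}{xe+1}\;,$$ $$\sum_{k\in\mathbb{Z}}\frac{1}{(W_k(x)+1)(W_k(x)-t)^2}=\frac{xe^{-t}+1}{(xe^{-t}-t)^2}\;,\qquad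 \sum_{k\in\mathbb{Z}}\frac{1}{(W_k(x)+1)^3}=\frac{1}{xe+1}\;,$$ $$\sum_{k\in\mathbb{Z}}\frac{W_k'(x)}{W_k(x)-t}=\frac1x\left(\frac12+\frac{t}{xe^{-t}-t}\right)\;,\qquad \sum_{k\in\mathbb{Z}}\frac{W_k'(x)}{W_k(x)}=\frac{1}{2x}\;.$$
   Context: Lambert branches: $\log$ is the principal determination of the logarithm (imaginary part in $]-\pi,\pi]$), $e=\exp(1)$. For $z\in\mathbb{C}\setminus\{0\}$ and $k\in\mathbb{Z}$, if $z\notin[-1/e,0[$ or $k\notin\{0,-1\}$, then $W_k(z)$ is the unique complex solution $w$ of $w+\log(w)=\log(z)+2k\pi i$; if $z\in[-1/e,0[$, then $W_{-1}(z)$ and $W_0(z)$ are the real solutions of $we^w=z$ characterized by $W_{-1}(z)\le -1\le W_0(z)$ (equal when $z=-1/e$). A sum or product over $k\in\mathbb{Z}$ is understood as the limit as $K\to\infty$ of the sum or product over $-K\le k\le K$. $W_k'(x)$ denotes the derivative of $W_k$ with respect to $x$, equal to $\frac{1}{x}\frac{W_k(x)}{W_k(x)+1}$; for $x$ a negative real (on the branch cut) this formula is taken as the meaning of $W_k'(x)$. *)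

(* Defs.v *)
From Stdlib Require Import Reals ZArith Lra.
From Coquelicot Require Import Coquelicot.

Open Scope R_scope.

Definition Cexp (z : C) : C :=
  (exp (Re z) * cos (Im z), exp (Re z) * sin (Im z)).

Definition Carg (z : C) : R :=
  if Rle_dec 0 (Im z) then acos (Re z / Cmod z) else - acos (Re z / Cmod z).

(** [Clog_exp] and [Cexp_log] below show that this is the principal logarithm,
    with imaginary part in ]-PI, PI]. Its value at 0 is meaningless. *)
Definition Clog (z : C) : C := (ln (Cmod z), Carg z).

Lemma Cmod_Cexp (w : C) : Cmod (Cexp w) = exp (Re w).
Proof.
  unfold Cmod, Cexp; simpl fst; simpl snd.
  replace ((exp (Re w) * cos (Im w)) ^ 2 + (exp (Re w) * sin (Im w)) ^ 2)
    with (exp (Re w) ^ 2 * ((Rsqr (sin (Im w))) + (Rsqr (cos (Im w)))))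
    by (unfold Rsqr; ring).
  rewrite sin2_cos2, Rmult_1_r.
  apply sqrt_pow2, Rlt_le, exp_pos.
Qed.

Lemma Clog_exp (w : C) : - PI < Im w <= PI -> Clog (Cexp w) = w.
Proof.
  intros [H1 H2].
  assert (He := exp_pos (Re w)).
  unfold Clog, Carg; rewrite Cmod_Cexp, ln_exp.
  replace (Re (Cexp w) / exp (Re w)) with (cos (Im w))
    by (unfold Cexp; simpl; field; lra).
  destruct w as [a b]; simpl in *; f_equal.
  destruct (Rle_dec 0 (exp a * sin b)) as [Hs|Hs].
  - destruct (Rle_dec 0 b) as [Hb|Hb].
    + apply acos_cos; lra.
    + assert (0 < sin (- b)) by (apply sin_gt_0; lra).
      rewrite sin_neg in H. exfalso. nra.
  - destruct (Rle_dec 0 b) as [Hb|Hb].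
    + assert (0 <= sin b) by (apply sin_ge_0; lra).
      exfalso; apply Hs; nra.
    + rewrite <- (cos_neg b), acos_cos; lra.
Qed.

Lemma Cexp_log (z : C) :
  z <> 0%C -> Cexp (Clog z) = z /\ - PI < Im (Clog z) <= PI.
Proof.
  intros Hz.
  assert (Hm : 0 < Cmod z) by (apply Cmod_gt_0; exact Hz).
  assert (Hsq : Re z ^ 2 + Im z ^ 2 = Cmod z ^ 2) by (symmetry; apply Cmod2_alt).
  set (c := Re z / Cmod z).
  assert (Hc : Re z = c * Cmod z) by (unfold c; field; lra).
  assert (Hc2 : c ^ 2 <= 1).
  { apply Rmult_le_reg_r with (Cmod z ^ 2); [nra|].
    rewrite Rmult_1_l, <- Rpow_mult_distr, <- Hc, <- Hsq. nra. }
  assert (Hc1 : -1 <= c <= 1) by (split; nra).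
  assert (Hsin : Cmod z * sin (acos c) = Rabs (Im z)).
  { rewrite sin_acos by exact Hc1.
    rewrite <- (sqrt_pow2 (Cmod z)) at 1 by lra.
    rewrite <- sqrt_mult; [|nra|unfold Rsqr; nra].
    rewrite <- sqrt_Rsqr_abs; f_equal. unfold Rsqr. nra. }
  assert (Hb := acos_bound c).
  assert (HP := PI_RGT_0).
  unfold Clog, Carg; fold c; split.
  - unfold Cexp; simpl Re; simpl Im; rewrite exp_ln by exact Hm.
    destruct (Rle_dec 0 (Im z)) as [Hi|Hi].
    + rewrite cos_acos by exact Hc1. rewrite Hsin, Rabs_pos_eq by exact Hi.
      rewrite Rmult_comm, <- Hc. symmetry; apply surjective_pairing.
    + rewrite cos_neg, sin_neg, cos_acos by exact Hc1.
      rewrite <- Ropp_mult_distr_r, Hsin, Rabs_left by lra.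
      rewrite Ropp_involutive, Rmult_comm, <- Hc.
      symmetry; apply surjective_pairing.
  - simpl. destruct (Rle_dec 0 (Im z)) as [Hi|Hi]; [lra|].
    split; [|lra].
    destruct (Req_dec (acos c) PI) as [E|E]; [|lra].
    rewrite E, sin_PI, Rmult_0_r, Rabs_left in Hsin by lra. lra.
Qed.

(** z is a real number in [-1/e, 0[. *)
Definition in_segment (z : C) : Prop :=
  Im z = 0 /\ - / exp 1 <= Re z < 0.

(** w = W_k(z). In the generic case the clause [w <> 0] is the requirement that
    log(w) be defined. *)
Definition is_lambertW (k : Z) (z w : C) : Prop :=
  (~ (in_segment z /\ (k = 0%Z \/ k = (-1)%Z)) ->
     w <> 0%C /\ (w + Clog w = Clog z + 2 * IZR k * PI * Ci)%C) /\
  (in_segment z -> k = 0%Z ->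
     (w * Cexp w)%C = z /\ Im w = 0 /\ -1 <= Re w) /\
  (in_segment z -> k = (-1)%Z ->
     (w * Cexp w)%C = z /\ Im w = 0 /\ Re w <= -1).

(** [iota] is definite description. *)
Definition lambertW (k : Z) (z : C) : C :=
  @iota C_CompleteNormedModule (is_lambertW k z).

Lemma lambertW_correct (k : Z) (z : C) :
  (exists! w, is_lambertW k z w) -> is_lambertW k z (lambertW k z).
Proof. exact (@iota_correct _ C_CompleteNormedModule (is_lambertW k z)). Qed.

Lemma neg_real_dec (z : C) :
  {Im z = 0 /\ Re z < 0} + {~ (Im z = 0 /\ Re z < 0)}.
Proof.
  destruct (Req_EM_T (Im z) 0); [|right; tauto].
  destruct (Rlt_dec (Re z) 0); [left|right]; tauto.
Defined.

(** W_k'(z): the complex derivative of W_k, except on the branch cut ]-oo, 0[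
    where the closed formula is taken as its meaning. *)
Definition lambertW' (k : Z) (z : C) : C :=
  if neg_real_dec z
  then (/ z * (lambertW k z / (lambertW k z + 1)))%C
  else @iota C_CompleteNormedModule
         (fun l => @is_derive C_AbsRing C_NormedModule (lambertW k) z l).

(** Bilateral sums and products, as limits over -K <= k <= K: the terms of
    index j = 0, ..., 2K are those of index k = j - K. *)
Definition is_sum_Z (a : Z -> C) (s : C) : Prop :=
  filterlim
    (fun K : nat => sum_n (fun j => a (Z.of_nat j - Z.of_nat K)%Z) (2 * K))
    eventually (locally s).

Definition is_prod_Z (a : Z -> C) (p : C) : Prop :=
  filterlim
    (fun K : nat =>
       Iter.iter_nat Cmult (RtoC 1)
         (fun j => a (Z.of_nat j - Z.of_nat K)%Z) 0 (2 * K))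
    eventually (locally p).

(* Main.v *)
Require Import Defs.
From Stdlib Require Import Reals ZArith Lra Lia Psatz List ClassicalEpsilon.
From Coquelicot Require Import Coquelicot.

(** Why the identities hold.  The values [lambertW k x] are exactly the zeros
    of the entire function [lamb x z = x e^{-z} - z] ([lambertW_eq],
    [lambertW_complete]).  They are pairwise distinct and simple, except that
    for [x = -1/e] the branches [0] and [-1] meet at the double zero [-1]
    ([lambertW_inj], [branch_count]).  The function
    [lamb_sum x z = 1/2 + (1 + z) / lamb x z] is [-1/2] minus the logarithmic
    derivative of [lamb x], so its poles are these zeros, with minus the
    multiplicity as residue.  Hence

      [defect x K z = lamb_sum x z - sum_{|k| <= K} 1 / (lambertW k x - z)]

    has only removable singularities in a box that contains no other zeros
    than the [lambertW k x] with [|k| <= K] ([defect_bounded_near],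
    [zero_in_strip]).  The horizontal edges of the box lie at distance of order
    [K], at heights where [x e^{-z}] is imaginary and cannot cancel against
    [z]; the vertical ones are as far as one likes.  There [lamb_sum x] is
    bounded, and the sum is dominated by a harmonic sum ([defect_box]).  A
    function that is [O(sqrt K)] on a boundary at distance [K] is almost
    constant on bounded sets, and its first two derivatives there tend to [0]
    by Cauchy's estimates ([defect_estimates]).  The constant tends to [0] as
    well: for a large real [s] the terms of index [k] at [s] and [-k] at [-s]
    almost cancel, and so do [lamb_sum x s] and [lamb_sum x (-s)]
    ([branch_sum_odd_part], [lamb_sum_odd_part], [defect_tends_to_0]).

    So the sum of the [1 / (lambertW k x - t)] is [lamb_sum x t], and the sums
    of the squares and cubes are read off the second order expansion of
    [lamb_sum x] at [t].  The sums with factors [lambertW k x + 1] follow by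
    partial fractions, or from the powers at [t = -1], and those with
    [lambertW'] because it is [w / (x (w + 1))].  For the product, the ratio of
    the partial product to its expected limit has the defect as its logarithmic
    derivative, so it stays close to its value [1] at [t = 0] along a path that
    avoids the zeros.

    No contour integral occurs.  Holomorphy at a point is expressed by a second
    order expansion at this point ([jet2]); this is enough for the maximum
    principle, from which Cauchy's estimates follow by divided differences. *)

Open Scope C_scope.

(** * Elementary facts on complex numbers *)

Lemma Cmod_sym (u v : C) : Cmod (u - v) = Cmod (v - u).
Proof. rewrite <- Cmod_opp; f_equal; ring. Qed.

Lemma Cmod_triangle_sub (u v : C) : (Cmod u - Cmod v <= Cmod (u - v))%R.
Proof.
  generalize (Cmod_triangle (u - v) v).
  replace (u - v + v) with u by ring; lra.
Qed.

Lemma Cmod_sub_le (u v : C) : (Cmod (u - v) <= Cmod u + Cmod v)%R.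
Proof.
  rewrite <- (Cmod_opp v); apply Cmod_triangle.
Qed.

Lemma im_le_Cmod (c : C) : (Rabs (Im c) <= Cmod c)%R.
Proof. exact (Rle_trans _ _ _ (Rmax_r _ _) (Rmax_Cmod c)). Qed.

Lemma Cmod_le_abs (c : C) : (Cmod c <= Rabs (Re c) + Rabs (Im c))%R.
Proof.
  assert (H := Cmod2_alt c).
  assert (H1 := Rabs_pos (Re c)). assert (H2 := Rabs_pos (Im c)).
  rewrite <- (pow2_abs (Re c)), <- (pow2_abs (Im c)) in H.
  nra.
Qed.

Lemma C_sub_neq_0 (u v : C) : u <> v -> u - v <> 0.
Proof.
  intros H E; apply H. replace u with ((u - v) + v) by ring. rewrite E; ring.
Qed.

Lemma Cmod_sub_pos (u v : C) : u <> v -> (0 < Cmod (u - v))%R.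
Proof. intros H; apply Cmod_gt_0, C_sub_neq_0, H. Qed.

Lemma Ceq_dec (u v : C) : {u = v} + {u <> v}.
Proof.
  destruct u as [a b], v as [c d].
  destruct (Req_EM_T a c) as [->|H]; [|right; congruence].
  destruct (Req_EM_T b d) as [->|H]; [left; reflexivity|right; congruence].
Qed.

Lemma lt_Rmin_l {a b c : R} : (a < Rmin b c -> a < b)%R.
Proof. intros H; exact (Rlt_le_trans _ _ _ H (Rmin_l b c)). Qed.

Lemma lt_Rmin_r {a b c : R} : (a < Rmin b c -> a < c)%R.
Proof. intros H; exact (Rlt_le_trans _ _ _ H (Rmin_r b c)). Qed.

Lemma pos_below_3 (a b c : R) : (0 < a -> 0 < b -> 0 < c ->
  exists d, 0 < d /\ d <= a /\ d <= b /\ d <= c)%R.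
Proof.
  intros Ha Hb Hc. exists (Rmin a (Rmin b c)).
  split; [now repeat apply Rmin_pos|split; [apply Rmin_l|]].
  split; (eapply Rle_trans; [apply Rmin_r|]); [apply Rmin_l|apply Rmin_r].
Qed.

(** * Continuity and second order expansions *)

Definition cont (f : C -> C) (z : C) : Prop :=
  forall eps, (0 < eps)%R -> exists d, (0 < d)%R /\
    forall w, (Cmod (w - z) < d)%R -> (Cmod (f w - f z) < eps)%R.

Lemma cont_const (c z : C) : cont (fun _ => c) z.
Proof.
  intros e He; exists 1%R; split; [lra|intros w _].
  replace (c - c) with (RtoC 0) by ring. rewrite Cmod_0; exact He.
Qed.

Lemma cont_id (z : C) : cont (fun w => w) z.
Proof. intros e He; exists e; auto. Qed.

Lemma cont_ext_loc (f g : C -> C) (z : C) (r : R) :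
  (0 < r)%R -> (forall w, (Cmod (w - z) < r)%R -> f w = g w) ->
  cont f z -> cont g z.
Proof.
  intros Hr Heq Hf e He.
  destruct (Hf e He) as [d [Hd H]].
  exists (Rmin d r); split; [now apply Rmin_pos|intros w Hw].
  assert (Hw1 := lt_Rmin_l Hw).
  assert (Hw2 := lt_Rmin_r Hw).
  rewrite <- (Heq w Hw2), <- (Heq z); [now apply H|].
  replace (z - z) with (RtoC 0) by ring. rewrite Cmod_0; exact Hr.
Qed.

Lemma cont_plus (f g : C -> C) (z : C) :
  cont f z -> cont g z -> cont (fun w => f w + g w) z.
Proof.
  intros Hf Hg e He.
  destruct (Hf (e / 2)%R) as [d1 [Hd1 H1]]; [lra|].
  destruct (Hg (e / 2)%R) as [d2 [Hd2 H2]]; [lra|].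
  exists (Rmin d1 d2); split; [now apply Rmin_pos|intros w Hw].
  specialize (H1 w (lt_Rmin_l Hw)).
  specialize (H2 w (lt_Rmin_r Hw)).
  replace (f w + g w - (f z + g z)) with ((f w - f z) + (g w - g z)) by ring.
  generalize (Cmod_triangle (f w - f z) (g w - g z)); lra.
Qed.

Lemma cont_mult (f g : C -> C) (z : C) :
  cont f z -> cont g z -> cont (fun w => f w * g w) z.
Proof.
  intros Hf Hg e He.
  assert (F0 := Cmod_ge_0 (f z)). assert (G0 := Cmod_ge_0 (g z)).
  set (M := (1 + Cmod (f z) + Cmod (g z))%R).
  set (e' := Rmin 1 (e / (2 * M))).
  assert (HM : (0 < M)%R) by (unfold M; lra).
  assert (He' : (0 < e')%R)
    by (apply Rmin_pos; [lra|apply Rdiv_lt_0_compat; lra]).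
  assert (He1 : (e' <= 1)%R) by apply Rmin_l.
  assert (He2 : (e' * M <= e / 2)%R).
  { apply Rle_trans with (e / (2 * M) * M)%R.
    - apply Rmult_le_compat_r; [lra|apply Rmin_r].
    - right; field; lra. }
  destruct (Hf e' He') as [d1 [Hd1 H1]].
  destruct (Hg e' He') as [d2 [Hd2 H2]].
  exists (Rmin d1 d2); split; [now apply Rmin_pos|intros w Hw].
  specialize (H1 w (lt_Rmin_l Hw)).
  specialize (H2 w (lt_Rmin_r Hw)).
  replace (f w * g w - f z * g z)
    with ((f w - f z) * (g w - g z) + ((f w - f z) * g z + f z * (g w - g z)))
    by ring.
  eapply Rle_lt_trans; [apply Cmod_triangle|].
  eapply Rle_lt_trans; [apply Rplus_le_compat_l, Cmod_triangle|].
  rewrite !Cmod_mult.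
  assert (A := Cmod_ge_0 (f w - f z)). unfold M in He2. nra.
Qed.

Lemma cont_opp (f : C -> C) (z : C) : cont f z -> cont (fun w => - f w) z.
Proof.
  intros Hf. apply cont_ext_loc with (fun w => (-(1)) * f w) 1%R; [lra| |].
  - intros; ring.
  - apply cont_mult; [apply cont_const|exact Hf].
Qed.

Lemma cont_minus (f g : C -> C) (z : C) :
  cont f z -> cont g z -> cont (fun w => f w - g w) z.
Proof. intros Hf Hg; apply cont_plus; [|apply cont_opp]; assumption. Qed.

Lemma cont_neq (f : C -> C) (z c : C) :
  cont f z -> f z <> c ->
  exists d, (0 < d)%R /\ forall w, (Cmod (w - z) < d)%R -> f w <> c.
Proof.
  intros Hf Hc. destruct (Hf (Cmod (c - f z))) as [d [Hd H]].
  { apply Cmod_sub_pos; congruence. }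
  exists d; split; [exact Hd|intros w Hw E].
  specialize (H w Hw). rewrite E in H; lra.
Qed.

Lemma cont_inv (f : C -> C) (z : C) :
  cont f z -> f z <> 0 -> cont (fun w => / f w) z.
Proof.
  intros Hf Hz e He.
  assert (Hp : (0 < Cmod (f z))%R) by now apply Cmod_gt_0.
  set (m := Cmod (f z)) in *.
  destruct (Hf (Rmin (m / 2) (e * m * m / 2))) as [d [Hd H]].
  { apply Rmin_pos; [lra|].
    apply Rdiv_lt_0_compat; [|lra]. repeat apply Rmult_lt_0_compat; lra. }
  exists d; split; [exact Hd|intros w Hw].
  specialize (H w Hw).
  assert (K1 := lt_Rmin_l H).
  assert (K2 := lt_Rmin_r H).
  assert (K3 : (m / 2 <= Cmod (f w))%R).
  { generalize (Cmod_triangle_sub (f z) (f w)).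
    rewrite (Cmod_sym (f z)); fold m; lra. }
  assert (Hw0 : f w <> 0) by (apply Cmod_gt_0; lra).
  replace (/ f w - / f z) with (- ((f w - f z) / (f w * f z)))
    by (field; auto).
  rewrite Cmod_opp, Cmod_div, Cmod_mult; [|now apply Cmult_neq_0].
  fold m. apply Rlt_div_l; [apply Rmult_lt_0_compat; lra|].
  apply Rlt_le_trans with (1 := K2).
  assert (0 <= e * m)%R by nra. nra.
Qed.

Lemma cont_bounded (f : C -> C) (z : C) :
  cont f z -> exists d B, (0 < d)%R /\
    forall w, (Cmod (w - z) < d)%R -> (Cmod (f w) <= B)%R.
Proof.
  intros Hf. destruct (Hf 1%R) as [d [Hd H]]; [lra|].
  exists d, (Cmod (f z) + 1)%R; split; [exact Hd|intros w Hw].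
  generalize (H w Hw) (Cmod_triangle_sub (f w) (f z)); lra.
Qed.

Ltac cont_tac :=
  repeat (assumption || apply cont_const || apply cont_id || apply cont_minus
          || apply cont_opp || apply cont_plus || apply cont_mult
          || apply cont_inv).

(** A Taylor expansion at [z] in the form of Caratheodory: the remainder is
    a factor that is continuous at [z]. Sums, products and inverses then
    only need algebra, and no derivative is ever taken at another point. *)
Definition jet2 (f : C -> C) (z a b : C) : Prop :=
  exists g, cont g z /\ g z = b /\ exists r, (0 < r)%R /\
    forall w, (Cmod (w - z) < r)%R ->
      f w = f z + (w - z) * (a + (w - z) * g w).

Lemma Cmod_self_lt (z : C) (r : R) : (0 < r)%R -> (Cmod (z - z) < r)%R.
Proof.
  intros H. replace (z - z) with (RtoC 0) by ring. now rewrite Cmod_0.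
Qed.

Lemma jet2_ext_loc (f g : C -> C) (z a b : C) (r : R) :
  (0 < r)%R -> (forall w, (Cmod (w - z) < r)%R -> f w = g w) ->
  jet2 f z a b -> jet2 g z a b.
Proof.
  intros Hr Heq (u & Hu & Hb & s & Hs & H).
  exists u; repeat split; auto.
  exists (Rmin s r); split; [now apply Rmin_pos|intros w Hw].
  rewrite <- (Heq w (lt_Rmin_r Hw)).
  rewrite <- (Heq z (Cmod_self_lt _ _ Hr)).
  apply H, (lt_Rmin_l Hw).
Qed.

Lemma jet2_ext (f g : C -> C) (z a b : C) :
  (forall w, f w = g w) -> jet2 f z a b -> jet2 g z a b.
Proof.
  intros H; apply jet2_ext_loc with 1%R; [lra|intros; apply H].
Qed.

Lemma jet2_eq (f : C -> C) (z a b a' b' : C) :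
  jet2 f z a b -> a = a' -> b = b' -> jet2 f z a' b'.
Proof. intros H <- <-; exact H. Qed.

Lemma jet2_cont (f : C -> C) (z a b : C) : jet2 f z a b -> cont f z.
Proof.
  intros (g & Hg & Hb & r & Hr & H).
  apply cont_ext_loc with (fun w => f z + (w - z) * (a + (w - z) * g w)) r;
    [exact Hr|intros w Hw; symmetry; now apply H|].
  cont_tac.
Qed.

Lemma jet2_const (c z : C) : jet2 (fun _ => c) z 0 0.
Proof.
  exists (fun _ => RtoC 0); split; [apply cont_const|split; [reflexivity|]].
  exists 1%R; split; [lra|intros; ring].
Qed.

Lemma jet2_id (z : C) : jet2 (fun w => w) z 1 0.
Proof.
  exists (fun _ => RtoC 0); split; [apply cont_const|split; [reflexivity|]].
  exists 1%R; split; [lra|intros; ring].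
Qed.

Lemma jet2_plus (f g : C -> C) (z a b a' b' : C) :
  jet2 f z a b -> jet2 g z a' b' ->
  jet2 (fun w => f w + g w) z (a + a') (b + b').
Proof.
  intros (u & Hu & Hb & r & Hr & H) (v & Hv & Hb' & s & Hs & H').
  exists (fun w => u w + v w); split; [now apply cont_plus|].
  split; [congruence|].
  exists (Rmin r s); split; [now apply Rmin_pos|intros w Hw].
  rewrite (H w (lt_Rmin_l Hw)).
  rewrite (H' w (lt_Rmin_r Hw)). ring.
Qed.

Lemma jet2_mult (f g : C -> C) (z a b a' b' : C) :
  jet2 f z a b -> jet2 g z a' b' ->
  jet2 (fun w => f w * g w) z (a * g z + f z * a')
    (b * g z + a * a' + f z * b').
Proof.
  intros (u & Hu & Hb & r & Hr & H) (v & Hv & Hb' & s & Hs & H').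
  exists (fun w => u w * g z + f z * v w
                   + (a + (w - z) * u w) * (a' + (w - z) * v w)).
  split; [|split].
  - cont_tac.
  - cbv beta; rewrite Hb, Hb'; ring.
  - exists (Rmin r s); split; [now apply Rmin_pos|intros w Hw].
    rewrite (H w (lt_Rmin_l Hw)).
    rewrite (H' w (lt_Rmin_r Hw)). ring.
Qed.

Lemma jet2_inv (f : C -> C) (z a b : C) :
  jet2 f z a b -> f z <> 0 ->
  jet2 (fun w => / f w) z (- a / (f z * f z))
    (a * a / (f z * f z * f z) - b / (f z * f z)).
Proof.
  intros Hj Hz.
  assert (Hf := jet2_cont _ _ _ _ Hj).
  destruct (cont_neq f z 0 Hf Hz) as [s [Hs Hs0]].
  destruct Hj as (u & Hu & Hb & r & Hr & H).
  exists (fun w => (a * (a + (w - z) * u w) - u w * f z) * / f w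
                   * / (f z * f z)).
  split; [|split].
  - cont_tac.
  - cbv beta; rewrite Hb; field; auto.
  - exists (Rmin r s); split; [now apply Rmin_pos|intros w Hw].
    assert (E := H w (lt_Rmin_l Hw)).
    assert (N := Hs0 w (lt_Rmin_r Hw)).
    rewrite E in N |- *. field; auto.
Qed.

Lemma jet2_scal (c : C) (f : C -> C) (z a b : C) :
  jet2 f z a b -> jet2 (fun w => c * f w) z (c * a) (c * b).
Proof.
  intros H. eapply jet2_eq; [apply (jet2_mult _ _ _ _ _ _ _ (jet2_const c z) H)| |];
    ring.
Qed.

Lemma jet2_minus (f g : C -> C) (z a b a' b' : C) :
  jet2 f z a b -> jet2 g z a' b' ->
  jet2 (fun w => f w - g w) z (a - a') (b - b').
Proof.
  intros H H'.
  apply jet2_ext with (fun w => f w + (-(1)) * g w); [intros; ring|].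
  eapply jet2_eq; [apply (jet2_plus _ _ _ _ _ _ _ H (jet2_scal _ _ _ _ _ H'))| |];
    ring.
Qed.

(** This plays the role of holomorphy of [f] at [z]. *)
Definition has_jet (f : C -> C) (z : C) : Prop := exists a b, jet2 f z a b.

Lemma has_jet_mult (f g : C -> C) (z : C) :
  has_jet f z -> has_jet g z -> has_jet (fun w => f w * g w) z.
Proof.
  intros (a & b & H) (a' & b' & H'). eexists _, _; apply jet2_mult; eauto.
Qed.

Lemma has_jet_pow (f : C -> C) (n : nat) (z : C) :
  has_jet f z -> has_jet (fun w => f w ^ n) z.
Proof.
  intros H; induction n as [|n IH].
  - exists 0, 0; exact (jet2_const 1 z).
  - destruct (has_jet_mult _ _ _ H IH) as (a & b & K).
    exists a, b; exact K.
Qed.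

(** * Continuous functions on a closed box *)

Definition in_box (a b c d : R) (z : C) : Prop :=
  (a <= Re z <= b /\ c <= Im z <= d)%R.

(** Compactness of the box. The bound [B] at [p] is only asked of the points
    of a neighbourhood of [p], which applies to a discontinuous [v]. *)
Lemma box_bounded (a b c d : R) (v : C -> R) :
  (forall p, in_box a b c d p -> exists r B, (0 < r)%R /\
     forall q, in_box a b c d q -> (Cmod (q - p) < r)%R -> (v q <= B)%R) ->
  exists B, (0 < B)%R /\ forall q, in_box a b c d q -> (v q <= B)%R.
Proof.
  intros Hloc.
  assert (HQ : forall x y, exists e : posreal, in_box a b c d (x, y) ->
    forall q, in_box a b c d q -> (Rabs (Re q - x) < e)%R ->
      (Rabs (Im q - y) < e)%R -> (v q <= / e)%R).
  { intros x y.
    destruct (excluded_middle_informative (in_box a b c d (x, y))) as [Hin|Hn];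
      [|exists (mkposreal 1 Rlt_0_1); contradiction].
    destruct (Hloc (x, y) Hin) as (r & B & Hr & HB).
    assert (HBp := Rabs_pos B).
    assert (He : (0 < Rmin (r / 2) (/ (1 + Rabs B)))%R).
    { apply Rmin_pos; [lra|apply Rinv_0_lt_compat; lra]. }
    exists (mkposreal _ He); simpl; intros _ q Hq H1 H2.
    apply Rle_trans with B.
    - apply HB; [exact Hq|].
      assert (K := Rmin_l (r / 2) (/ (1 + Rabs B))).
      generalize (Cmod_le_abs (q - (x, y))); destruct q as [q1 q2]; simpl in *.
      unfold Rminus in H1, H2; lra.
    - apply Rle_trans with (1 + Rabs B)%R;
        [generalize (Rle_abs B); lra|].
      rewrite <- (Rinv_inv (1 + Rabs B)) at 1.
      apply Rinv_le_contravar; [exact He|apply Rmin_r]. }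
  set (delta := fun x y =>
    proj1_sig (constructive_indefinite_description _ (HQ x y))).
  assert (Hd : forall x y, in_box a b c d (x, y) ->
    forall q, in_box a b c d q -> (Rabs (Re q - x) < delta x y)%R ->
      (Rabs (Im q - y) < delta x y)%R -> (v q <= / delta x y)%R).
  { intros x y; unfold delta.
    now destruct (constructive_indefinite_description _ (HQ x y)). }
  destruct (compactness_value_2d a b c d delta) as [m Hm].
  exists (/ m)%R; split; [apply Rinv_0_lt_compat, cond_pos|].
  intros q [Hq1 Hq2].
  apply Rnot_lt_le; intros Hlt.
  apply (Hm (Re q) (Im q) Hq1 Hq2).
  intros (x & y & Hx & Hy & Kx & Ky & Hle).
  assert (K := Hd x y (conj Hx Hy) q (conj Hq1 Hq2) Kx Ky).
  assert (/ delta x y <= / m)%R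
    by (apply Rinv_le_contravar; [apply cond_pos|exact Hle]).
  lra.
Qed.

Lemma box_max (a b c d : R) (v : C -> R) :
  (a <= b)%R -> (c <= d)%R ->
  (forall p, in_box a b c d p -> forall e, (0 < e)%R -> exists r, (0 < r)%R /\
     forall q, in_box a b c d q -> (Cmod (q - p) < r)%R -> (v q < v p + e)%R) ->
  exists p, in_box a b c d p /\ forall q, in_box a b c d q -> (v q <= v p)%R.
Proof.
  intros Hab Hcd Husc.
  destruct (box_bounded a b c d v) as [B [_ HB]].
  { intros p Hp. destruct (Husc p Hp 1%R) as [r [Hr H]]; [lra|].
    exists r, (v p + 1)%R; split; [exact Hr|].
    intros q Hq Hqp; generalize (H q Hq Hqp); lra. }
  destruct (completeness (fun y => exists p, in_box a b c d p /\ y = v p))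
    as [M [HM1 HM2]].
  { exists B; intros y [p [Hp ->]]; auto. }
  { exists (v (a, c)), (a, c); split; [|reflexivity].
    unfold in_box; simpl; lra. }
  destruct (excluded_middle_informative
    (exists p, in_box a b c d p /\ v p = M)) as [[p [Hp E]]|Hno].
  { exists p; split; [exact Hp|intros q Hq]. rewrite E; apply HM1; eauto. }
  exfalso.
  assert (Hlt : forall p, in_box a b c d p -> (v p < M)%R).
  { intros p Hp. destruct (HM1 (v p)) as [H|H]; [eauto|exact H|].
    elim Hno; eauto. }
  (* If the supremum M were not reached, 1/(M - v) would be locally bounded. *)
  destruct (box_bounded a b c d (fun q => / (M - v q))%R) as [D [HD1 HD2]].
  { intros p Hp. assert (K := Hlt p Hp).
    destruct (Husc p Hp ((M - v p) / 2)%R) as [r [Hr H]]; [lra|].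
    exists r, (/ ((M - v p) / 2))%R; split; [exact Hr|intros q Hq Hqp].
    generalize (H q Hq Hqp); intros L.
    apply Rinv_le_contravar; lra. }
  assert (L : (M <= M - / D)%R).
  { apply HM2; intros y [p [Hp ->]].
    assert (K := Hlt p Hp). specialize (HD2 p Hp).
    apply Rinv_le_contravar in HD2; [|apply Rinv_0_lt_compat; lra].
    rewrite Rinv_inv in HD2; lra. }
  assert (0 < / D)%R by now apply Rinv_0_lt_compat. lra.
Qed.

(** * The maximum principle and Cauchy's estimates *)

Lemma Cmod_plus_sqr_ge (p q : C) :
  (Cmod p ^ 2 - 2 * Cmod p * Cmod q <= Cmod (p + q) ^ 2)%R.
Proof.
  assert (H := Cmod_triangle_sub p (- q)).
  replace (p - - q) with (p + q) in H by ring. rewrite Cmod_opp in H.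
  assert (H1 := Cmod_ge_0 p).
  destruct (Rle_dec (Cmod q) (Cmod p)); nra.
Qed.

(** A discrete form of the subharmonicity of [|f|^2]: the linear and the
    quadratic terms of the expansion cancel in the mean over the four
    directions [1, -1, i, -i]. *)
Lemma jet2_four_point (f : C -> C) (z : C) (eps : R) :
  has_jet f z -> (0 < eps)%R ->
  exists r0, (0 < r0)%R /\ forall r, (0 < r < r0)%R ->
    (4 * Cmod (f z) ^ 2 - eps * r ^ 2 <=
     Cmod (f (z + RtoC r)%C) ^ 2 + Cmod (f (z - RtoC r)%C) ^ 2
     + Cmod (f (z + Ci * RtoC r)%C) ^ 2 + Cmod (f (z - Ci * RtoC r)%C) ^ 2)%R.
Proof.
  intros (a & b & g & Hg & Hb & s & Hs & H) He.
  set (C0 := (1 + Cmod (f z) + Cmod a + Cmod b)%R).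
  assert (F0 := Cmod_ge_0 (f z)). assert (A0 := Cmod_ge_0 a).
  assert (B0 := Cmod_ge_0 b).
  assert (HC : (0 < C0)%R) by (unfold C0; lra).
  destruct (Hg (eps / (8 * C0))%R) as [d [Hd Hgd]];
    [apply Rdiv_lt_0_compat; lra|].
  exists (Rmin 1 (Rmin s d)).
  split; [repeat apply Rmin_pos; lra|intros r [Hr0 Hr]].
  assert (Hr1 := lt_Rmin_l Hr).
  assert (Hr2 := lt_Rmin_r Hr).
  assert (Hrs := lt_Rmin_l Hr2).
  assert (Hrd := lt_Rmin_r Hr2).
  set (P := fun h : C => f z + h * (a + h * b)).
  assert (Hh : forall h, Cmod h = r ->
    (Cmod (P h) ^ 2 - eps / 4 * r ^ 2 <= Cmod (f (z + h)%C) ^ 2)%R).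
  { intros h Eh.
    assert (Ez : z + h - z = h) by ring.
    replace (f (z + h)) with (P h + h * h * (g (z + h) - b)).
    2: { rewrite (H (z + h)); [|rewrite Ez; lra]. unfold P; rewrite Ez; ring. }
    eapply Rle_trans; [|apply Cmod_plus_sqr_ge].
    rewrite !Cmod_mult, Eh.
    assert (HP : (Cmod (P h) <= C0)%R).
    { unfold P, C0. generalize (Cmod_triangle (f z) (h * (a + h * b))).
      generalize (Cmod_triangle a (h * b)) (Cmod_ge_0 (a + h * b)).
      rewrite !Cmod_mult, Eh. intros T1 T2 T3.
      assert (r * Cmod b <= 1 * Cmod b)%R by (apply Rmult_le_compat_r; lra).
      assert (r * Cmod (a + h * b) <= 1 * Cmod (a + h * b))%R
        by (apply Rmult_le_compat_r; lra).
      lra. }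
    assert (Hgb : (Cmod (g (z + h)%C - b) <= eps / (8 * C0))%R).
    { rewrite <- Hb; apply Rlt_le, Hgd. rewrite Ez; lra. }
    assert (P0 := Cmod_ge_0 (P h)). assert (Q0 := Cmod_ge_0 (g (z + h) - b)).
    assert (K : (Cmod (P h) * Cmod (g (z + h)%C - b) <= eps / 8)%R).
    { apply Rle_trans with (C0 * (eps / (8 * C0)))%R.
      - apply Rmult_le_compat; assumption.
      - right; field; lra. }
    nra. }
  assert (Er : Cmod (RtoC r) = r) by (rewrite Cmod_R; apply Rabs_pos_eq; lra).
  assert (Eir : Cmod (Ci * RtoC r) = r) by (rewrite Cmod_mult, Cmod_Ci; lra).
  assert (K1 := Hh (RtoC r) Er).
  assert (K2 := Hh (- RtoC r)). rewrite Cmod_opp in K2; specialize (K2 Er).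
  assert (K3 := Hh (Ci * RtoC r) Eir).
  assert (K4 := Hh (- (Ci * RtoC r))).
  rewrite Cmod_opp in K4; specialize (K4 Eir).
  assert (E : (Cmod (P (RtoC r)) ^ 2 + Cmod (P (- RtoC r)%C) ^ 2
      + Cmod (P (Ci * RtoC r)%C) ^ 2 + Cmod (P (- (Ci * RtoC r))%C) ^ 2
      = 4 * (Cmod (f z) ^ 2 + Cmod a ^ 2 * r ^ 2 + Cmod b ^ 2 * r ^ 4))%R).
  { rewrite !Cmod2_alt; unfold P.
    destruct (f z) as [f1 f2], a as [a1 a2], b as [b1 b2]; simpl; ring. }
  assert (0 <= Cmod a ^ 2 * r ^ 2 + Cmod b ^ 2 * r ^ 4)%R.
  { apply Rplus_le_le_0_compat; apply Rmult_le_pos; apply pow_le; lra. }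
  unfold Cminus. lra.
Qed.

Definition on_edge (a b c d : R) (z : C) : Prop :=
  in_box a b c d z /\ (Re z = a \/ Re z = b \/ Im z = c \/ Im z = d).

Lemma in_box_bounded (a b c d : R) : exists D, (0 < D)%R /\
  forall z, in_box a b c d z -> (Cmod z <= D)%R.
Proof.
  apply box_bounded; intros p _.
  destruct (cont_bounded (fun w => w) p (cont_id p)) as (r & B & Hr & H).
  exists r, B; auto.
Qed.

(** The term [eps |z|^2] turns the mean value inequality of
    [jet2_four_point] into a strict one, which excludes an interior maximum. *)
Lemma max_principle_cont (G : C -> C) (a b c d M : R) :
  (a <= b)%R -> (c <= d)%R -> (0 <= M)%R ->
  (forall z, in_box a b c d z -> cont G z) ->
  (forall z, in_box a b c d z -> G z <> 0 -> has_jet G z) ->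
  (forall z, on_edge a b c d z -> (Cmod (G z) <= M)%R) ->
  forall z, in_box a b c d z -> (Cmod (G z) <= M)%R.
Proof.
  intros Hab Hcd HM Hc Hj He q Hq.
  apply Rnot_lt_le; intros Hlt.
  set (m := Cmod (G q)) in *.
  destruct (in_box_bounded a b c d) as [D [HD HDb]].
  assert (Hm : (0 < m ^ 2 - M ^ 2)%R) by nra.
  set (eps := ((m ^ 2 - M ^ 2) / (2 * D ^ 2))%R).
  assert (HD2 : (0 < D ^ 2)%R) by (apply pow_lt; lra).
  assert (Heps : (0 < eps)%R) by (apply Rdiv_lt_0_compat; lra).
  assert (HepsD : (eps * D ^ 2 < m ^ 2 - M ^ 2)%R).
  { replace (eps * D ^ 2)%R with ((m ^ 2 - M ^ 2) / 2)%R
      by (unfold eps; field; lra). lra. }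
  set (v := fun z => (Cmod (G z) ^ 2 + eps * Cmod z ^ 2)%R).
  destruct (box_max a b c d v Hab Hcd) as [p [Hp Hmax]].
  { intros p Hp e He'.
    assert (G0 := Cmod_ge_0 (G p)). assert (P0 := Cmod_ge_0 p).
    set (T := (2 * Cmod (G p) + 1 + eps * (2 * Cmod p + 1) + 1)%R).
    assert (HT : (0 < T)%R) by (unfold T; nra).
    assert (Hdl : (0 < Rmin 1 (e / T))%R)
      by (apply Rmin_pos; [lra|apply Rdiv_lt_0_compat; lra]).
    set (dl := Rmin 1 (e / T)) in *.
    assert (Hdl1 : (dl <= 1)%R) by apply Rmin_l.
    assert (HdlT : (dl * T <= e)%R).
    { apply Rle_trans with (e / T * T)%R;
        [apply Rmult_le_compat_r; [lra|apply Rmin_r]|right; field; lra]. }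
    destruct (Hc p Hp dl Hdl) as [r [Hr H]].
    exists (Rmin r dl); split; [now apply Rmin_pos|intros w Hw Hwp].
    assert (K1 := H w (lt_Rmin_l Hwp)).
    assert (K2 := lt_Rmin_r Hwp).
    assert (L1 := Cmod_triangle_sub (G w) (G p)).
    assert (L2 := Cmod_triangle_sub w p).
    assert (N1 := Cmod_ge_0 (G w)). assert (N2 := Cmod_ge_0 w).
    unfold v.
    assert (Q2 : (Cmod w ^ 2 <= Cmod p ^ 2 + dl * (2 * Cmod p + 1))%R) by nra.
    apply Rmult_le_compat_l with (r := eps) in Q2; [|lra].
    unfold T in HdlT. nra. }
  assert (Hvp : (m ^ 2 <= v p)%R).
  { apply Rle_trans with (v q); [|now apply Hmax]. unfold v; fold m.
    assert (0 <= eps * Cmod q ^ 2)%R by (apply Rmult_le_pos; nra). lra. }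
  assert (HpD : (eps * Cmod p ^ 2 <= eps * D ^ 2)%R).
  { apply Rmult_le_compat_l; [lra|]. apply pow_incr; split;
      [apply Cmod_ge_0|now apply HDb]. }
  assert (HGp : (M < Cmod (G p))%R).
  { apply Rnot_le_lt; intros K. unfold v in Hvp.
    assert (N := Cmod_ge_0 (G p)). nra. }
  assert (Hin : (a < Re p < b /\ c < Im p < d)%R).
  { assert (Hne : ~ on_edge a b c d p)
      by (intros K; generalize (He p K); lra).
    unfold on_edge, in_box in Hne; unfold in_box in Hp.
    destruct Hp as [[Q1 Q2] [Q3 Q4]].
    repeat split; apply Rnot_le_lt; intros K; apply Hne;
      (split; [tauto|]).
    - left; lra.
    - right; left; lra.
    - right; right; left; lra.
    - right; right; right; lra. }
  assert (HGp0 : G p <> 0) by (apply Cmod_gt_0; lra).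
  destruct (jet2_four_point G p eps (Hj p Hp HGp0) Heps) as [r0 [Hr0 Hfour]].
  set (r := (Rmin (r0 / 2) (Rmin (Rmin (Re p - a) (b - Re p))
                                 (Rmin (Im p - c) (d - Im p))))%R).
  assert (Hr : (0 < r)%R) by (unfold r; repeat apply Rmin_pos; lra).
  assert (R0 : (r <= r0 / 2)%R) by apply Rmin_l.
  assert (R1 : (r <= Re p - a /\ r <= b - Re p /\ r <= Im p - c
                /\ r <= d - Im p)%R).
  { unfold r.
    generalize (Rmin_r (r0 / 2) (Rmin (Rmin (Re p - a) (b - Re p))
                                 (Rmin (Im p - c) (d - Im p)))).
    generalize (Rmin_l (Rmin (Re p - a) (b - Re p))
                                 (Rmin (Im p - c) (d - Im p))).
    generalize (Rmin_r (Rmin (Re p - a) (b - Re p))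
                                 (Rmin (Im p - c) (d - Im p))).
    generalize (Rmin_l (Re p - a) (b - Re p)) (Rmin_r (Re p - a) (b - Re p)).
    generalize (Rmin_l (Im p - c) (d - Im p)) (Rmin_r (Im p - c) (d - Im p)).
    lra. }
  specialize (Hfour r ltac:(lra)).
  assert (M1 := Hmax (p + RtoC r)). assert (M2 := Hmax (p - RtoC r)).
  assert (M3 := Hmax (p + Ci * RtoC r)). assert (M4 := Hmax (p - Ci * RtoC r)).
  assert (E : (Cmod (p + RtoC r) ^ 2 + Cmod (p - RtoC r) ^ 2
      + Cmod (p + Ci * RtoC r) ^ 2 + Cmod (p - Ci * RtoC r) ^ 2
      = 4 * Cmod p ^ 2 + 4 * r ^ 2)%R).
  { rewrite !Cmod2_alt. destruct p as [p1 p2]; simpl; ring. }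
  unfold in_box in *. destruct p as [p1 p2]; simpl in Hin, R1.
  specialize (M1 ltac:(simpl; lra)). specialize (M2 ltac:(simpl; lra)).
  specialize (M3 ltac:(simpl; lra)). specialize (M4 ltac:(simpl; lra)).
  unfold v in *.
  assert (0 < eps * r ^ 2)%R by (apply Rmult_lt_0_compat; [lra|apply pow_lt; lra]).
  nra.
Qed.

Definition Croots (l : list C) (z : C) : C :=
  fold_right (fun w p => (z - w) * p) 1 l.

Lemma Croots_in (l : list C) (z : C) : In z l -> Croots l z = 0.
Proof.
  induction l as [|w l IH]; simpl; [contradiction|].
  intros [->|H]; [ring|rewrite (IH H); ring].
Qed.

Lemma Croots_notin (l : list C) (z : C) : ~ In z l -> Croots l z <> 0.
Proof.
  induction l as [|w l IH]; simpl; intros H.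
  - apply Cmod_gt_0; rewrite Cmod_1; lra.
  - apply Cmult_neq_0; [apply C_sub_neq_0; intros E; apply H; auto|].
    apply IH; tauto.
Qed.

Lemma has_jet_Croots (l : list C) (z : C) : has_jet (Croots l) z.
Proof.
  induction l as [|w l IH].
  - exists 0, 0; exact (jet2_const 1 z).
  - apply (has_jet_mult (fun z => z - w) (Croots l)); [|exact IH].
    eexists _, _; apply jet2_minus; [apply jet2_id|apply jet2_const].
Qed.

Lemma has_jet_cont (f : C -> C) (z : C) : has_jet f z -> cont f z.
Proof. intros (a & b & H); eapply jet2_cont; eauto. Qed.

(** Holomorphy on the box, up to removable singularities in [l]. *)
Definition holo_box (a b c d : R) (l : list C) (f : C -> C) : Prop :=
  (forall z, in_box a b c d z -> ~ In z l -> has_jet f z) /\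
  (forall p, In p l -> exists r B, (0 < r)%R /\
     forall z, (0 < Cmod (z - p) < r)%R -> (Cmod (f z) <= B)%R).

(** The singularities are killed by the factor [Croots l], whose effect on the
    bound vanishes when one compares high powers of [f]. *)
Theorem max_principle (a b c d M : R) (l : list C) (f : C -> C) :
  (a <= b)%R -> (c <= d)%R -> (0 < M)%R ->
  holo_box a b c d l f ->
  (forall z, on_edge a b c d z -> ~ In z l -> (Cmod (f z) <= M)%R) ->
  forall z, in_box a b c d z -> ~ In z l -> (Cmod (f z) <= M)%R.
Proof.
  intros Hab Hcd HM [Hj Hb] He q Hq Hql.
  destruct (box_bounded a b c d (fun z => Cmod (Croots l z))) as [P [HP HPb]].
  { intros p _.
    destruct (cont_bounded _ _ (has_jet_cont _ _ (has_jet_Croots l p)))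
      as (r & B & Hr & H). exists r, B; auto. }
  assert (HG : forall n, (Cmod (f q ^ n * Croots l q) <= M ^ n * P)%R).
  { intros n.
    apply (max_principle_cont (fun z => f z ^ n * Croots l z) a b c d);
      auto.
    - apply Rmult_le_pos; [apply pow_le|]; lra.
    - intros z Hz.
      destruct (in_dec Ceq_dec z l) as [Hzl|Hzl].
      2: { apply has_jet_cont, has_jet_mult;
             [now apply has_jet_pow, Hj|apply has_jet_Croots]. }
      destruct (Hb z Hzl) as (r & B & Hr & HB).
      assert (HBp := Rabs_pos B).
      assert (HT : (0 < (1 + Rabs B) ^ n)%R) by (apply pow_lt; lra).
      intros e He0.
      destruct (has_jet_cont _ _ (has_jet_Croots l z)
                  (e / ((1 + Rabs B) ^ n))%R) as [s [Hs H]].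
      { now apply Rdiv_lt_0_compat. }
      exists (Rmin r s); split; [now apply Rmin_pos|intros w Hw].
      rewrite (Croots_in l z Hzl) in H |- *.
      replace (f w ^ n * Croots l w - f z ^ n * 0)
        with (f w ^ n * Croots l w) by ring.
      destruct (Ceq_dec w z) as [->|Hwz].
      { rewrite (Croots_in l z Hzl), Cmult_0_r, Cmod_0; exact He0. }
      specialize (HB w (conj (Cmod_sub_pos _ _ Hwz)
                     (lt_Rmin_l Hw))).
      specialize (H w (lt_Rmin_r Hw)).
      replace (Croots l w - 0) with (Croots l w) in H by ring.
      rewrite Cmod_mult, Cmod_pow.
      apply Rle_lt_trans with ((1 + Rabs B) ^ n * Cmod (Croots l w))%R.
      + apply Rmult_le_compat_r; [apply Cmod_ge_0|].
        apply pow_incr; split; [apply Cmod_ge_0|].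
        generalize (Rle_abs B); lra.
      + apply Rlt_div_r in H; [lra|exact HT].
    - intros z Hz Hz0.
      apply has_jet_mult; [|apply has_jet_Croots].
      apply has_jet_pow, Hj; [exact Hz|intros K; apply Hz0].
      rewrite (Croots_in l z K); ring.
    - intros z Hz.
      destruct (in_dec Ceq_dec z l) as [Hzl|Hzl].
      { rewrite (Croots_in l z Hzl), Cmult_0_r, Cmod_0.
        apply Rmult_le_pos; [apply pow_le|]; lra. }
      rewrite Cmod_mult, Cmod_pow.
      apply Rmult_le_compat; [apply pow_le, Cmod_ge_0|apply Cmod_ge_0| |].
      + apply pow_incr; split; [apply Cmod_ge_0|auto].
      + apply HPb; apply Hz. }
  apply Rnot_lt_le; intros Hlt.
  assert (Hk : (0 < Cmod (Croots l q))%R) by now apply Cmod_gt_0, Croots_notin.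
  set (x := (Cmod (f q) / M - 1)%R).
  assert (Hx : (0 < x)%R).
  { unfold x.
    assert (1 < Cmod (f q) / M)%R by (apply Rlt_div_r; lra). lra. }
  destruct (archimed_cor1 (x * Cmod (Croots l q) / P)%R) as [n [Hn Hn0]].
  { apply Rdiv_lt_0_compat; [|exact HP]. now apply Rmult_lt_0_compat. }
  assert (Hnp : (0 < INR n)%R) by now apply lt_0_INR.
  assert (K := HG n). rewrite Cmod_mult, Cmod_pow in K.
  replace (Cmod (f q)) with (M * (1 + x))%R in K by (unfold x; field; lra).
  rewrite Rpow_mult_distr, Rmult_assoc in K.
  apply Rmult_le_reg_l in K; [|now apply pow_lt].
  assert (Kp := poly n x Hx).
  assert (L : (P < INR n * x * Cmod (Croots l q))%R).
  { apply Rmult_lt_reg_l with (/ INR n)%R; [now apply Rinv_0_lt_compat|].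
    replace (/ INR n * (INR n * x * Cmod (Croots l q)))%R
      with (x * Cmod (Croots l q))%R by (field; lra).
    apply Rlt_div_r in Hn; [lra|exact HP]. }
  nra.
Qed.

Lemma avoid_list (l : list R) (a b : R) :
  (a < b)%R -> exists s, (a < s < b)%R /\ ~ In s l.
Proof.
  revert a b; induction l as [|x l IH]; intros a b Hab.
  - exists ((a + b) / 2)%R; split; [lra|simpl; tauto].
  - destruct (Rlt_dec a x) as [Hx|Hx].
    + destruct (IH a (Rmin x b)) as [s [[H1 H2] H3]]; [now apply Rmin_glb_lt|].
      assert (K1 := lt_Rmin_l H2).
      assert (K2 := lt_Rmin_r H2).
      exists s; split; [lra|]. intros [E|E]; [lra|tauto].
    + destruct (IH a b Hab) as [s [H1 H3]].
      exists s; split; [lra|]. intros [E|E]; [lra|tauto].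
Qed.

(** As in Schwarz's lemma: division by [z - t] gains the factor [1 / r] on
    the boundary, and costs at most one more removable singularity. The
    point [t] may itself be a singularity of [f], whose value there is then
    replaced by [v]; this allows to iterate. *)
Lemma holo_box_divided_difference
  (a b c d M r : R) (l : list C) (f g : C -> C) (t v : C) (rho : R) :
  (a <= b)%R -> (c <= d)%R -> (0 < M)%R -> (0 < r)%R -> (0 < rho)%R ->
  holo_box a b c d l f ->
  (forall z, on_edge a b c d z -> ~ In z l -> (Cmod (f z) <= M)%R) ->
  in_box a b c d t ->
  (forall z, on_edge a b c d z -> (r <= Cmod (z - t))%R) ->
  (Cmod v <= M)%R -> cont g t ->
  (forall z, (0 < Cmod (z - t) < rho)%R -> f z = v + (z - t) * g z) ->
  let q := fun z => (f z - v) / (z - t) in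
  let M' := (2 * M / r)%R in
  holo_box a b c d (t :: l) q /\
  (forall z, on_edge a b c d z -> ~ In z (t :: l) -> (Cmod (q z) <= M')%R) /\
  (forall z, in_box a b c d z -> ~ In z (t :: l) -> (Cmod (q z) <= M')%R) /\
  (Cmod (g t) <= M')%R.
Proof.
  intros Hab Hcd HM Hr Hrho [Hj Hb] He Ht Hdist Hv Hg Hfg q M'.
  assert (HM' : (0 < M')%R) by (apply Rdiv_lt_0_compat; lra).
  assert (Hqg : forall z, (0 < Cmod (z - t) < rho)%R -> q z = g z).
  { intros z Hz. unfold q; rewrite (Hfg z Hz). field.
    now apply Cmod_gt_0. }
  assert (Hhol : holo_box a b c d (t :: l) q).
  { split.
    - intros z Hz Hzl; simpl in Hzl.
      destruct (Hj z Hz) as (a1 & b1 & J); [tauto|].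
      apply (has_jet_mult (fun z => f z - v) (fun z => / (z - t))).
      + eexists _, _; apply jet2_minus; [exact J|apply jet2_const].
      + eexists _, _. apply (jet2_inv (fun z => z - t)).
        * apply jet2_minus; [apply jet2_id|apply jet2_const].
        * apply C_sub_neq_0; intros E; apply Hzl; auto.
    - intros p Hp.
      destruct (Ceq_dec p t) as [->|Hpt].
      + destruct (cont_bounded g t Hg) as (s & B & Hs & HB).
        exists (Rmin s rho), B; split; [now apply Rmin_pos|intros z [Hz1 Hz2]].
        rewrite Hqg; [apply HB, (lt_Rmin_l Hz2)|].
        split; [exact Hz1|apply (lt_Rmin_r Hz2)].
      + destruct Hp as [E|Hp]; [congruence|].
        destruct (Hb p Hp) as (s & B & Hs & HB).
        assert (C1 : cont (fun z => / (z - t)) p).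
        { apply cont_inv; [apply cont_minus; [apply cont_id|apply cont_const]|].
          now apply C_sub_neq_0. }
        destruct (cont_bounded _ _ C1) as (s' & B' & Hs' & HB').
        exists (Rmin s s'), ((B + Cmod v) * B')%R.
        split; [now apply Rmin_pos|intros z [Hz1 Hz2]].
        specialize (HB z (conj Hz1 (lt_Rmin_l Hz2))).
        specialize (HB' z (lt_Rmin_r Hz2)).
        unfold q, Cdiv; rewrite Cmod_mult.
        apply Rmult_le_compat; try apply Cmod_ge_0; [|exact HB'].
        generalize (Cmod_sub_le (f z) v); lra. }
  assert (Hedge : forall z, on_edge a b c d z -> ~ In z (t :: l) ->
            (Cmod (q z) <= M')%R).
  { intros z Hz Hzl; simpl in Hzl.
    assert (Hzt := Hdist z Hz).
    unfold q, M'; rewrite Cmod_div; [|apply Cmod_gt_0; lra].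
    assert (K : (Cmod (f z - v) <= 2 * M)%R).
    { generalize (Cmod_sub_le (f z) v) (He z Hz); intros K1 K2.
      specialize (K2 ltac:(tauto)); lra. }
    unfold Rdiv; apply Rmult_le_compat; [apply Cmod_ge_0| |exact K|].
    - apply Rlt_le, Rinv_0_lt_compat; lra.
    - apply Rinv_le_contravar; assumption. }
  assert (Hall := max_principle a b c d M' (t :: l) q Hab Hcd HM' Hhol Hedge).
  split; [exact Hhol|split; [exact Hedge|split; [exact Hall|]]].
  (* The value g t is a limit of values of q at points that avoid t :: l. *)
  apply Rnot_lt_le; intros Hlt.
  destruct (Hg (Cmod (g t) - M')%R) as [s [Hs Hgs]]; [lra|].
  assert (Hlt_b : (Re t < b)%R).
  { destruct Ht as [[T1 [T2|T2]] T3]; [exact T2|].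
    assert (K : on_edge a b c d t) by (split; [split; lra|tauto]).
    apply Hdist in K. replace (t - t) with (RtoC 0) in K by ring.
    rewrite Cmod_0 in K; lra. }
  destruct (avoid_list (map (fun w => (Re w - Re t)%R) (t :: l)) 0
              (Rmin s (Rmin rho (b - Re t)))) as [y [[Hy0 Hy] Hyl]].
  { repeat apply Rmin_pos; lra. }
  assert (Hy1 := lt_Rmin_l Hy).
  assert (Hy2 := lt_Rmin_r Hy).
  assert (Hy3 := lt_Rmin_l Hy2).
  assert (Hy4 := lt_Rmin_r Hy2).
  assert (Ez : Cmod (t + RtoC y - t) = y).
  { replace (t + RtoC y - t) with (RtoC y) by ring.
    rewrite Cmod_R; apply Rabs_pos_eq; lra. }
  assert (Kq : (Cmod (q (t + RtoC y)%C) <= M')%R).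
  { apply Hall.
    - destruct t as [t1 t2]; unfold in_box in *; simpl in *; lra.
    - intros K. apply Hyl.
      apply (in_map (fun w => (Re w - Re t)%R)) in K.
      replace y with (Re (t + RtoC y) - Re t)%R; [exact K|].
      destruct t; simpl; ring. }
  rewrite Hqg in Kq by (rewrite Ez; lra).
  specialize (Hgs (t + RtoC y)); rewrite Ez in Hgs; specialize (Hgs Hy1).
  generalize (Cmod_triangle_sub (g t) (g (t + RtoC y))).
  rewrite Cmod_sym; lra.
Qed.

(** Cauchy's estimates, by the maximum principle for the first and the second
    divided differences of [f] at [t]. *)
Theorem cauchy_estimates
  (a b c d M r : R) (l : list C) (f : C -> C) (t u v : C) :
  (a <= b)%R -> (c <= d)%R -> (0 < M)%R -> (0 < r)%R ->
  holo_box a b c d l f ->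
  (forall z, on_edge a b c d z -> ~ In z l -> (Cmod (f z) <= M)%R) ->
  in_box a b c d t -> ~ In t l ->
  (forall z, on_edge a b c d z -> (r <= Cmod (z - t))%R) ->
  jet2 f t u v ->
  (forall z, in_box a b c d z -> ~ In z l ->
     (Cmod (f z - f t) <= Cmod (z - t) * (2 * M / r))%R) /\
  (Cmod u <= 2 * M / r)%R /\ (Cmod v <= 4 * M / r ^ 2)%R.
Proof.
  intros Hab Hcd HM Hr Hhol He Ht Htl Hdist (g & Hg & Hgv & rho & Hrho & H).
  assert (Hft := max_principle a b c d M l f Hab Hcd HM Hhol He t Ht Htl).
  assert (Hg1 : cont (fun z => u + (z - t) * g z) t) by cont_tac.
  destruct (holo_box_divided_difference a b c d M r l f _ t (f t) rho
              Hab Hcd HM Hr Hrho Hhol He Ht Hdist Hft Hg1)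
    as (Q1 & Q2 & Q3 & Q4).
  { intros z Hz; apply H, Hz. }
  replace (u + (t - t) * g t) with u in Q4 by ring.
  set (q := fun z => (f z - f t) / (z - t)) in *.
  assert (HM' : (0 < 2 * M / r)%R) by (apply Rdiv_lt_0_compat; lra).
  destruct (holo_box_divided_difference a b c d (2 * M / r) r (t :: l) q g t u
              rho Hab Hcd HM' Hr Hrho Q1 Q2 Ht Hdist Q4 Hg) as (_ & _ & _ & P4).
  { intros z Hz. unfold q; rewrite (H z (proj2 Hz)). field.
    now apply Cmod_gt_0. }
  split; [|split].
  - intros z Hz Hzl.
    destruct (Ceq_dec z t) as [->|Hzt].
    { replace (f t - f t) with (RtoC 0) by ring.
      replace (t - t) with (RtoC 0) by ring. rewrite Cmod_0; lra. }
    assert (K := Q3 z Hz ltac:(simpl; intros [E|E]; [congruence|tauto])).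
    unfold q in K; rewrite Cmod_div in K by now apply C_sub_neq_0.
    apply (proj1 (Rle_div_l _ _ _ (Cmod_sub_pos _ _ Hzt))) in K.
    rewrite Rmult_comm; exact K.
  - exact Q4.
  - rewrite Hgv in P4. eapply Rle_trans; [exact P4|right; field; lra].
Qed.

Open Scope R_scope.

(** * Remainder bounds for exp, cos and sin *)

Lemma bound_of_derivative (f f' : R -> R) (A : R) (n : nat) (x : R) :
  f 0 = 0 -> (forall y, Rabs y <= Rabs x -> is_derive f y (f' y)) ->
  (forall y, Rabs y <= Rabs x -> Rabs (f' y) <= A * Rabs y ^ n) ->
  0 <= A -> Rabs (f x) <= A * Rabs x ^ S n.
Proof.
  intros H0 Hd Hb HA.
  destruct (MVT_gen f 0 x f') as [y [Hy1 Hy2]].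
  - intros y Hy; apply Hd.
    unfold Rmin, Rmax in Hy; destruct (Rle_dec 0 x); unfold Rabs;
      destruct (Rcase_abs y), (Rcase_abs x); lra.
  - intros y Hy; apply derivable_continuous_pt.
    exists (f' y); apply is_derive_Reals, Hd.
    unfold Rmin, Rmax in Hy; destruct (Rle_dec 0 x); unfold Rabs;
      destruct (Rcase_abs y), (Rcase_abs x); lra.
  - assert (Hyx : Rabs y <= Rabs x).
    { unfold Rmin, Rmax in Hy1; destruct (Rle_dec 0 x); unfold Rabs;
        destruct (Rcase_abs y), (Rcase_abs x); lra. }
    rewrite H0, !Rminus_0_r in Hy2. rewrite Hy2, Rabs_mult.
    simpl. rewrite (Rmult_comm (Rabs x)), <- Rmult_assoc.
    apply Rmult_le_compat_r; [apply Rabs_pos|].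
    apply Rle_trans with (1 := Hb y Hyx).
    apply Rmult_le_compat_l; [exact HA|].
    apply pow_incr; split; [apply Rabs_pos|exact Hyx].
Qed.

Lemma cos_sub_1_bound (x : R) : Rabs (cos x - 1) <= Rabs x ^ 2.
Proof.
  rewrite <- (Rmult_1_l (Rabs x ^ 2)).
  apply (bound_of_derivative (fun x => cos x - 1)) with (fun y => - sin y);
    [rewrite cos_0; ring|intros; auto_derive; [auto|ring]| |lra].
  intros y _. rewrite Rabs_Ropp, Rmult_1_l.
  replace (sin y) with (sin y - 0) by ring.
  replace (Rabs y ^ 1) with (1 * Rabs y ^ 1) by ring.
  apply (bound_of_derivative (fun t => sin t - 0)) with cos;
    [rewrite sin_0; ring|intros; auto_derive; [auto|ring]| |lra].
  intros u _. generalize (COS_bound u); unfold Rabs.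
  destruct (Rcase_abs (cos u)); simpl; lra.
Qed.

Lemma sin_sub_id_bound (x : R) : Rabs (sin x - x) <= Rabs x ^ 3.
Proof.
  rewrite <- (Rmult_1_l (Rabs x ^ 3)).
  apply (bound_of_derivative (fun x => sin x - x)) with (fun y => cos y - 1);
    [rewrite sin_0; ring|intros; auto_derive; [auto|ring]| |lra].
  intros y _. rewrite Rmult_1_l; apply cos_sub_1_bound.
Qed.

Lemma cos_taylor_bound (x : R) : Rabs (cos x - 1 + x ^ 2 / 2) <= Rabs x ^ 4.
Proof.
  rewrite <- (Rmult_1_l (Rabs x ^ 4)).
  apply (bound_of_derivative (fun x => cos x - 1 + x ^ 2 / 2))
    with (fun y => - (sin y - y));
    [rewrite cos_0; field|intros; auto_derive; [auto|field]| |lra].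
  intros y _. rewrite Rmult_1_l, Rabs_Ropp; apply sin_sub_id_bound.
Qed.

Lemma exp_taylor_bound (x : R) :
  Rabs x <= 1 -> Rabs (exp x - 1 - x - x ^ 2 / 2) <= 3 * Rabs x ^ 3.
Proof.
  intros Hx.
  apply (bound_of_derivative (fun x => exp x - 1 - x - x ^ 2 / 2))
    with (fun y => exp y - 1 - y);
    [rewrite exp_0; field|intros; auto_derive; [auto|field]| |lra].
  intros y Hy.
  apply (bound_of_derivative (fun x => exp x - 1 - x)) with (fun y => exp y - 1);
    [rewrite exp_0; field|intros; auto_derive; [auto|field]| |lra].
  intros u Hu.
  apply (bound_of_derivative (fun x => exp x - 1)) with exp;
    [rewrite exp_0; field|intros; auto_derive; [auto|field]| |lra].
  intros v Hv. simpl. rewrite Rmult_1_r, Rabs_pos_eq by apply Rlt_le, exp_pos.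
  apply Rle_trans with (2 := exp_le_3).
  destruct (Req_dec v 1) as [->|H]; [lra|].
  apply Rlt_le, exp_increasing.
  assert (v <= 1) by (generalize (Rle_abs v); lra). lra.
Qed.

Lemma Cexp_plus (u v : C) : Cexp (u + v) = (Cexp u * Cexp v)%C.
Proof.
  unfold Cexp; destruct u as [a b], v as [c d]; simpl.
  rewrite exp_plus, cos_plus, sin_plus. unfold Cmult; simpl. f_equal; ring.
Qed.

Lemma Cexp_0 : Cexp 0 = 1%C.
Proof.
  unfold Cexp; simpl. rewrite exp_0, cos_0, sin_0. unfold RtoC; f_equal; ring.
Qed.

Lemma Cexp_neq_0 (u : C) : Cexp u <> 0%C.
Proof. apply Cmod_gt_0; rewrite Cmod_Cexp; apply exp_pos. Qed.

Lemma Cexp_opp (u : C) : Cexp (- u) = (/ Cexp u)%C.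
Proof.
  assert (H : (Cexp (- u) * Cexp u)%C = 1%C).
  { rewrite <- Cexp_plus. replace (- u + u)%C with (RtoC 0) by ring.
    apply Cexp_0. }
  rewrite <- (Cmult_1_l (/ Cexp u)), <- H. field. apply Cexp_neq_0.
Qed.

Lemma Cexp_RtoC (r : R) : Cexp (RtoC r) = RtoC (exp r).
Proof.
  unfold Cexp, RtoC; simpl. rewrite cos_0, sin_0; f_equal; ring.
Qed.

(** Only the order of the remainder matters; the constant is crude. *)
Lemma Cexp_taylor_bound (h : C) :
  Cmod h <= 1 -> Cmod (Cexp h - (1 + h + h * h / 2))%C <= 50 * Cmod h ^ 3.
Proof.
  intros Hh. set (m := Cmod h) in *.
  assert (Hm : 0 <= m) by apply Cmod_ge_0.
  assert (Ha := re_le_Cmod h). assert (Hb := im_le_Cmod h). fold m in Ha, Hb.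
  destruct h as [a b]; simpl in Ha, Hb.
  assert (E := exp_taylor_bound a ltac:(lra)).
  assert (S := sin_sub_id_bound b). assert (K := cos_taylor_bound b).
  set (e3 := exp a - 1 - a - a ^ 2 / 2) in *.
  set (s3 := sin b - b) in *. set (c4 := cos b - 1 + b ^ 2 / 2) in *.
  assert (Pa : Rabs a ^ 3 <= m ^ 3)
    by (apply pow_incr; split; [apply Rabs_pos|exact Ha]).
  assert (Pb : Rabs b ^ 3 <= m ^ 3)
    by (apply pow_incr; split; [apply Rabs_pos|exact Hb]).
  assert (Hm3 : 0 <= m ^ 3) by now apply pow_le.
  assert (Pb4 : Rabs b ^ 4 <= m ^ 3).
  { simpl in *. assert (B0 := Rabs_pos b).
    nra. }
  assert (He3 : Rabs e3 <= 3 * m ^ 3) by lra.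
  assert (Hs3 : Rabs s3 <= m ^ 3) by lra.
  assert (Hc4 : Rabs c4 <= m ^ 3) by lra.
  apply Rabs_le_between in Ha. apply Rabs_le_between in Hb.
  assert (Hprod : forall p q u v : R, Rabs p <= u -> Rabs q <= v ->
            Rabs (p * q) <= u * v).
  { intros p q u v H1 H2. rewrite Rabs_mult.
    apply Rmult_le_compat; auto using Rabs_pos. }
  assert (Aa : Rabs a <= m) by now apply Rabs_le_between.
  assert (Ab : Rabs b <= m) by now apply Rabs_le_between.
  assert (Ah : Rabs (/ 2) <= 1) by (rewrite Rabs_pos_eq; lra).
  assert (Acos : Rabs (cos b) <= 1)
    by (apply Rabs_le_between; apply COS_bound).
  assert (Asin : Rabs (sin b) <= 1)
    by (apply Rabs_le_between; apply SIN_bound).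
  assert (Aexp : Rabs (1 + a + a ^ 2 / 2) <= 3).
  { apply Rabs_le_between; nra. }
  eapply Rle_trans; [apply Cmod_le_abs|].
  replace (Re (Cexp (a, b) - (1 + (a, b) + (a, b) * (a, b) / 2))%C)
    with (e3 * cos b + (1 + a + a ^ 2 / 2) * c4
          - a * b * b * / 2 - a * b * (a * b) * / 2 * / 2).
  2: { unfold e3, c4, Cexp; simpl. field. }
  replace (Im (Cexp (a, b) - (1 + (a, b) + (a, b) * (a, b) / 2))%C)
    with (e3 * sin b + (1 + a + a ^ 2 / 2) * s3 + a * a * b * / 2).
  2: { unfold e3, s3, Cexp; simpl. field. }
  assert (Q1 := Hprod _ _ _ _ He3 Acos). assert (Q2 := Hprod _ _ _ _ He3 Asin).
  assert (Q3 := Hprod _ _ _ _ Aexp Hc4). assert (Q4 := Hprod _ _ _ _ Aexp Hs3).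
  assert (Q5 := Hprod _ _ _ _ (Hprod _ _ _ _ (Hprod _ _ _ _ Aa Ab) Ab) Ah).
  assert (Q6 := Hprod _ _ _ _ (Hprod _ _ _ _ (Hprod _ _ _ _ Aa Aa) Ab) Ah).
  assert (Q7 := Hprod _ _ _ _ (Hprod _ _ _ _ (Hprod _ _ _ _
                  (Hprod _ _ _ _ Aa Ab) (Hprod _ _ _ _ Aa Ab)) Ah) Ah).
  assert (M4 : m * m * (m * m) <= m ^ 3) by (simpl; nra).
  apply Rabs_le_between in Q1, Q2, Q3, Q4, Q5, Q6, Q7.
  replace (m * m * m) with (m ^ 3) in Q5, Q6 by ring.
  assert (Rabs (e3 * cos b + (1 + a + a ^ 2 / 2) * c4
          - a * b * b * / 2 - a * b * (a * b) * / 2 * / 2) <= 20 * m ^ 3)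
    by (apply Rabs_le_between; lra).
  assert (Rabs (e3 * sin b + (1 + a + a ^ 2 / 2) * s3 + a * a * b * / 2)
          <= 20 * m ^ 3) by (apply Rabs_le_between; lra).
  lra.
Qed.

(** * The equation w + log w = c in polar coordinates *)

(** On the curve [Im (w + log w) = beta] in the upper half plane, the argument
    [th] of [w] determines its modulus, which is [(beta - th) / sin th];
    [polar_re] is then the real part of [w + log w]. *)
Definition polar_re (beta th : R) : R :=
  (beta - th) / sin th * cos th + ln ((beta - th) / sin th).

(** The numerator is [sin th ^ 2 * |1 + w| ^ 2], which vanishes only at the
    branch point [w = -1]. Therefore [polar_re] is strictly monotone, and
    this gives existence and uniqueness of the branches. *)
Lemma polar_re_derive (beta th : R) :
  0 < th < PI -> th < beta ->
  is_derive (polar_re beta) th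
    (- (((beta - th) + sin th * cos th) ^ 2 + sin th ^ 4)
     / ((beta - th) * sin th ^ 2)).
Proof.
  intros H1 H2.
  assert (Hs : 0 < sin th) by (apply sin_gt_0; lra).
  unfold polar_re. auto_derive.
  - repeat split; try lra. apply Rdiv_lt_0_compat; lra.
  - assert (E : sin th ^ 2 = 1 - cos th ^ 2)
      by (generalize (sin2_cos2 th); unfold Rsqr; lra).
    replace (sin th ^ 4) with (sin th ^ 2 * (1 - cos th ^ 2))
      by (rewrite <- E; ring).
    field_simplify_eq; [|lra]. ring [E].
Qed.

Lemma polar_re_decreasing (beta th1 th2 : R) :
  0 < th1 < th2 -> th2 < PI -> th2 < beta ->
  polar_re beta th2 < polar_re beta th1.
Proof.
  intros H1 H2 H3.
  destruct (MVT_gen (polar_re beta) th1 th2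
    (fun th => - (((beta - th) + sin th * cos th) ^ 2 + sin th ^ 4)
               / ((beta - th) * sin th ^ 2))) as [c [Hc E]].
  - rewrite Rmin_left, Rmax_right by lra. intros y Hy.
    apply polar_re_derive; lra.
  - rewrite Rmin_left, Rmax_right by lra. intros y Hy.
    apply derivable_continuous_pt. eexists. apply is_derive_Reals.
    apply polar_re_derive; lra.
  - rewrite Rmin_left, Rmax_right in Hc by lra.
    assert (Hs : 0 < sin c) by (apply sin_gt_0; lra).
    assert (N : 0 < ((beta - c) + sin c * cos c) ^ 2 + sin c ^ 4).
    { apply Rplus_le_lt_0_compat; [apply pow2_ge_0|now apply pow_lt]. }
    assert (D : 0 < (beta - c) * sin c ^ 2)
      by (apply Rmult_lt_0_compat; [lra|now apply pow_lt]).
    assert (Q := Rdiv_lt_0_compat _ _ N D).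
    replace (- (((beta - c) + sin c * cos c) ^ 2 + sin c ^ 4)
               / ((beta - c) * sin c ^ 2)) with
      (- ((((beta - c) + sin c * cos c) ^ 2 + sin c ^ 4)
               / ((beta - c) * sin c ^ 2))) in E by (field; nra).
    nra.
Qed.

Lemma ln_le_sub_1 (y : R) : 0 < y -> ln y <= y - 1.
Proof.
  intros H. generalize (exp_ineq1_le (ln y)). rewrite exp_ln by exact H. lra.
Qed.

(** Near [th = 0] the modulus of [w] tends to infinity. *)
Lemma polar_re_large (alpha beta : R) :
  0 < beta -> exists th, 0 < th < PI /\ th < beta /\ alpha < polar_re beta th.
Proof.
  intros Hb. assert (HP := PI2_1).
  assert (Ea := exp_pos alpha).
  destruct (pos_below_3 1 (beta / 2) (beta / 2 / exp alpha))
    as (th & H0 & H1 & H2 & H3); [lra|lra|apply Rdiv_lt_0_compat; lra|].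
  apply (Rle_div_r th (beta / 2) (exp alpha) Ea) in H3.
  exists th; repeat split; try lra.
  assert (Hs : 0 < sin th) by (apply sin_gt_0; lra).
  assert (Hs1 := sin_lt_x th H0).
  assert (Hc : 0 < cos th) by (apply cos_gt_0; lra).
  unfold polar_re.
  assert (Hr : exp alpha <= (beta - th) / sin th).
  { apply (proj1 (Rle_div_r _ _ _ Hs)).
    assert (exp alpha * sin th <= exp alpha * th)
      by (apply Rmult_le_compat_l; lra). lra. }
  assert (Hl : alpha <= ln ((beta - th) / sin th)).
  { rewrite <- (ln_exp alpha) at 1. now apply ln_le. }
  assert (0 < (beta - th) / sin th * cos th)
    by (apply Rmult_lt_0_compat; lra).
  lra.
Qed.

Lemma sin_ge_half (y : R) : 0 < y <= 1 / 2 -> y / 2 <= sin y.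
Proof.
  intros H. assert (K := sin_sub_id_bound y).
  rewrite (Rabs_pos_eq y) in K by lra. apply Rabs_le_between in K. nra.
Qed.

Lemma ln_le_quarter (y : R) : 0 < y -> ln y <= y / 4 + 2.
Proof.
  intros H. rewrite <- (ln_exp (y / 4 + 2)). apply ln_le; [exact H|].
  replace (y / 4 + 2) with ((y / 8 + 1) + (y / 8 + 1)) by field.
  rewrite exp_plus.
  assert (K := exp_ineq1_le (y / 8 + 1)).
  apply Rle_trans with ((2 + y / 8) * (2 + y / 8)).
  - generalize (pow2_ge_0 (2 - y / 8)); lra.
  - apply Rmult_le_compat; lra.
Qed.

(** The other end of the curve. The exception is the case of the two real
    branches: for [beta = PI] the curve ends at [w = -1], where [w + log w] has
    real part [-1]. *)
Lemma polar_re_small (alpha beta : R) :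
  0 < beta -> (beta = PI -> -1 < alpha) ->
  exists th, 0 < th < PI /\ th < beta /\ polar_re beta th < alpha.
Proof.
  intros Hb Hex. assert (HP := PI2_1).
  destruct (Rtotal_order beta PI) as [Hlt|[Heq|Hgt]].
  - assert (Hsb : 0 < sin beta) by (apply sin_gt_0; lra).
    assert (HC : continuity_pt sin beta) by apply continuity_sin.
    destruct (HC (sin beta / 2)) as [dl [Hdl HdlC]]; [lra|].
    assert (Ea := exp_pos (alpha - 1)).
    destruct (pos_below_3 (dl / 2) (beta / 2)
      (sin beta / 4 * Rmin 1 (exp (alpha - 1)))) as (eta & E0 & E1 & E2 & E3);
      [lra|lra|apply Rmult_lt_0_compat; [lra|apply Rmin_pos; lra]|].
    assert (M1 := Rmin_l 1 (exp (alpha - 1))).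
    assert (M2 := Rmin_r 1 (exp (alpha - 1))).
    exists (beta - eta); repeat split; try lra.
    assert (Hs : sin beta / 2 < sin (beta - eta)).
    { specialize (HdlC (beta - eta)). simpl in HdlC. unfold R_dist in HdlC.
      assert (K : Rabs (sin (beta - eta) - sin beta) < sin beta / 2).
      { apply HdlC. split; [split; [exact I|lra]|].
        rewrite Rabs_left; lra. }
      apply Rabs_lt_between in K; lra. }
    unfold polar_re. replace (beta - (beta - eta)) with eta by ring.
    set (rho := eta / sin (beta - eta)).
    assert (R0 : 0 < rho) by (apply Rdiv_lt_0_compat; lra).
    assert (Er : rho * sin (beta - eta) = eta) by (unfold rho; field; lra).
    assert (R2 : rho < exp (alpha - 1)) by nra.
    assert (L : ln rho < alpha - 1)
      by (rewrite <- (ln_exp (alpha - 1)); now apply ln_increasing).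
    assert (C := COS_bound (beta - eta)). nra.
  - specialize (Hex Heq).
    set (eta := Rmin (1 / 2) ((alpha + 1) / 4)).
    assert (E0 : 0 < eta) by (apply Rmin_pos; lra).
    assert (E1 : eta <= 1 / 2) by apply Rmin_l.
    assert (E2 : eta <= (alpha + 1) / 4) by apply Rmin_r.
    exists (PI - eta); repeat split; try lra.
    unfold polar_re. rewrite Heq. replace (PI - (PI - eta)) with eta by ring.
    rewrite sin_PI_x, cos_minus, cos_PI, sin_PI.
    set (rho := eta / sin eta).
    assert (S := sin_ge_half eta ltac:(lra)).
    assert (R0 : 0 < rho) by (apply Rdiv_lt_0_compat; lra).
    assert (Er : rho * sin eta = eta) by (unfold rho; field; lra).
    assert (L := ln_le_sub_1 rho R0).
    assert (K := cos_sub_1_bound eta).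
    rewrite (Rabs_pos_eq eta) in K by lra. apply Rabs_le_between in K. nra.
  - set (eta := Rmin (1 / 2) ((beta - PI) / (4 * (3 + Rabs alpha)))).
    assert (Ap := Rabs_pos alpha).
    assert (E0 : 0 < eta)
      by (apply Rmin_pos; [lra|apply Rdiv_lt_0_compat; lra]).
    assert (E1 : eta <= 1 / 2) by apply Rmin_l.
    assert (E2 : eta * (4 * (3 + Rabs alpha)) <= beta - PI).
    { apply Rle_trans with
        ((beta - PI) / (4 * (3 + Rabs alpha)) * (4 * (3 + Rabs alpha))).
      - apply Rmult_le_compat_r; [lra|apply Rmin_r].
      - right; field; lra. }
    exists (PI - eta); repeat split; try lra.
    unfold polar_re. replace (beta - (PI - eta)) with (beta - PI + eta) by ring.
    rewrite sin_PI_x, cos_minus, cos_PI, sin_PI.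
    set (rho := (beta - PI + eta) / sin eta).
    assert (S := sin_ge_half eta ltac:(lra)).
    assert (S' := sin_lt_x eta E0).
    assert (R0 : 0 < rho) by (apply Rdiv_lt_0_compat; lra).
    assert (Er : rho * sin eta = beta - PI + eta) by (unfold rho; field; lra).
    assert (L := ln_le_quarter rho R0).
    assert (K := cos_sub_1_bound eta).
    rewrite (Rabs_pos_eq eta) in K by lra. apply Rabs_le_between in K.
    assert (cos eta >= 1 / 2) by nra.
    assert (HA : - Rabs alpha <= alpha)
      by (generalize (Rle_abs (- alpha)); rewrite Rabs_Ropp; lra).
    nra.
Qed.

Lemma polar_exists_pos (alpha beta : R) :
  0 < beta -> (beta = PI -> -1 < alpha) ->
  exists lam th, 0 < th < PI /\
    exp lam * cos th + lam = alpha /\ exp lam * sin th + th = beta.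
Proof.
  intros Hb Hex.
  destruct (polar_re_large alpha beta Hb) as (th1 & H1 & H1b & H1a).
  destruct (polar_re_small alpha beta Hb Hex) as (th2 & H2 & H2b & H2a).
  assert (Hlt : th1 < th2).
  { apply Rnot_le_lt; intros [H|H]; [|subst; lra].
    generalize (polar_re_decreasing beta th2 th1); intros K.
    specialize (K ltac:(lra) ltac:(lra) ltac:(lra)); lra. }
  destruct (Ranalysis5.IVT_interv (fun th => alpha - polar_re beta th) th1 th2)
    as [th [Hth E]]; try lra.
  - intros y Hy.
    apply continuity_pt_minus; [apply continuity_pt_const; now intros u v|].
    apply derivable_continuous_pt. eexists. apply is_derive_Reals.
    apply polar_re_derive; lra.
  - assert (Hs : 0 < sin th) by (apply sin_gt_0; lra).
    assert (R0 : 0 < (beta - th) / sin th) by (apply Rdiv_lt_0_compat; lra).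
    exists (ln ((beta - th) / sin th)), th.
    rewrite exp_ln by exact R0. unfold polar_re in E.
    repeat split; try lra. field; lra.
Qed.

Lemma exp_plus_id_surj (alpha : R) : exists lam, exp lam + lam = alpha.
Proof.
  assert (A := Rle_abs alpha). assert (A' := Rle_abs (- alpha)).
  rewrite Rabs_Ropp in A'.
  destruct (Ranalysis5.IVT_interv (fun y => exp y + y - alpha)
    (- Rabs alpha - 2) (Rabs alpha + 1)) as [y [_ H]].
  - intros y _. apply derivable_continuous_pt. eexists.
    apply is_derive_Reals. auto_derive; [auto|reflexivity].
  - generalize (Rabs_pos alpha); lra.
  - assert (exp (- Rabs alpha - 2) <= exp 0).
    { left; apply exp_increasing; generalize (Rabs_pos alpha); lra. }
    rewrite exp_0 in H. lra.
  - assert (H := exp_pos (Rabs alpha + 1)). lra.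
  - exists y; lra.
Qed.

Lemma polar_exists (alpha beta : R) :
  (Rabs beta = PI -> -1 < alpha) ->
  exists lam th, - PI < th < PI /\
    exp lam * cos th + lam = alpha /\ exp lam * sin th + th = beta.
Proof.
  intros Hex. assert (HP := PI_RGT_0).
  destruct (Rtotal_order beta 0) as [Hb|[->|Hb]].
  - destruct (polar_exists_pos alpha (- beta)) as (lam & th & H1 & H2 & H3);
      [lra| |].
    { intros E; apply Hex. rewrite Rabs_left; lra. }
    exists lam, (- th). rewrite cos_neg, sin_neg. repeat split; lra.
  - destruct (exp_plus_id_surj alpha) as [lam H].
    exists lam, 0. rewrite cos_0, sin_0. repeat split; lra.
  - destruct (polar_exists_pos alpha beta) as (lam & th & H1 & H2 & H3);
      [lra| |].
    { intros E; apply Hex. rewrite Rabs_pos_eq; lra. }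
    exists lam, th. repeat split; lra.
Qed.

Lemma polar_re_of_solution (alpha beta lam th : R) :
  0 < th < PI -> exp lam * cos th + lam = alpha ->
  exp lam * sin th + th = beta -> th < beta /\ polar_re beta th = alpha.
Proof.
  intros Ht Ha Hb.
  assert (Hs : 0 < sin th) by (apply sin_gt_0; lra).
  assert (He := exp_pos lam).
  assert (E : (beta - th) / sin th = exp lam) by (rewrite <- Hb; field; lra).
  split; [nra|]. unfold polar_re. rewrite E, ln_exp. lra.
Qed.

Lemma polar_unique_nonneg (alpha beta l1 t1 l2 t2 : R) :
  0 <= t1 < PI -> 0 <= t2 < PI ->
  exp l1 * cos t1 + l1 = alpha -> exp l1 * sin t1 + t1 = beta ->
  exp l2 * cos t2 + l2 = alpha -> exp l2 * sin t2 + t2 = beta ->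
  l1 = l2 /\ t1 = t2.
Proof.
  intros H1 H2 A1 B1 A2 B2.
  assert (Hpos : forall l t, 0 < t < PI -> 0 < exp l * sin t + t).
  { intros l t Ht. assert (0 < sin t) by (apply sin_gt_0; lra).
    assert (P := exp_pos l). nra. }
  destruct (Req_dec t1 0) as [->|N1]; destruct (Req_dec t2 0) as [->|N2].
  - split; [|reflexivity]. rewrite cos_0 in A1, A2.
    destruct (Rtotal_order l1 l2) as [L|[L|L]]; [|exact L|];
      apply exp_increasing in L as L'; lra.
  - rewrite sin_0 in B1. generalize (Hpos l2 t2); lra.
  - rewrite sin_0 in B2. generalize (Hpos l1 t1); lra.
  - destruct (polar_re_of_solution alpha beta l1 t1) as [T1 E1]; try lra.
    destruct (polar_re_of_solution alpha beta l2 t2) as [T2 E2]; try lra.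
    assert (Et : t1 = t2).
    { destruct (Rtotal_order t1 t2) as [L|[L|L]]; [|exact L|].
      - generalize (polar_re_decreasing beta t1 t2); lra.
      - generalize (polar_re_decreasing beta t2 t1); lra. }
    split; [|exact Et]. subst t2.
    assert (Hs : 0 < sin t1) by (apply sin_gt_0; lra).
    assert (exp l1 = exp l2) by (apply Rmult_eq_reg_r with (sin t1); lra).
    now apply exp_inv.
Qed.

Lemma polar_unique (alpha beta l1 t1 l2 t2 : R) :
  - PI < t1 < PI -> - PI < t2 < PI ->
  exp l1 * cos t1 + l1 = alpha -> exp l1 * sin t1 + t1 = beta ->
  exp l2 * cos t2 + l2 = alpha -> exp l2 * sin t2 + t2 = beta ->
  l1 = l2 /\ t1 = t2.
Proof.
  assert (Hsgn : forall l t, - PI < t < PI -> 0 <= (exp l * sin t + t) -> 0 <= t).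
  { intros l t Ht H. apply Rnot_lt_le; intros L.
    assert (K : 0 < sin (- t)) by (apply sin_gt_0; lra).
    rewrite sin_neg in K. generalize (exp_pos l); intros E. nra. }
  intros H1 H2 A1 B1 A2 B2.
  destruct (Rle_dec 0 beta) as [Hb|Hb].
  - apply polar_unique_nonneg with alpha beta; auto;
      split; try lra; [apply (Hsgn l1)|apply (Hsgn l2)]; lra.
  - assert (K1 := Hsgn l1 (- t1)). assert (K2 := Hsgn l2 (- t2)).
    rewrite sin_neg in K1, K2.
    assert (K : l1 = l2 /\ - t1 = - t2).
    { apply polar_unique_nonneg with alpha (- beta);
        rewrite ?sin_neg, ?cos_neg; try split; lra. }
    lra.
Qed.

(** * The two real branches *)

Lemma exp_m1 : exp (-1) = / exp 1.
Proof. rewrite <- exp_Ropp; f_equal; ring. Qed.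

Lemma mul_exp_MVT (y1 y2 : R) : y1 < y2 ->
  exists c, y1 < c < y2 /\
    y2 * exp y2 - y1 * exp y1 = (1 + c) * exp c * (y2 - y1).
Proof.
  intros H.
  destruct (MVT_cor2 (fun y => y * exp y) (fun y => (1 + y) * exp y) y1 y2 H)
    as [c [E Hc]].
  - intros c _. apply is_derive_Reals. auto_derive; [auto|ring].
  - exists c; auto.
Qed.

Lemma mul_exp_inj (y1 y2 : R) :
  (-1 <= y1 /\ -1 <= y2) \/ (y1 <= -1 /\ y2 <= -1) ->
  y1 * exp y1 = y2 * exp y2 -> y1 = y2.
Proof.
  intros H E.
  destruct (Rtotal_order y1 y2) as [L|[L|L]]; [|exact L|];
    destruct (mul_exp_MVT _ _ L) as [c [Hc K]]; exfalso;
    assert (P := exp_pos c); assert (D : (1 + c) * exp c <> 0)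
      by (apply Rmult_integral_contrapositive; lra); apply D;
    (apply Rmult_eq_reg_r with (y2 - y1) || apply Rmult_eq_reg_r with (y1 - y2));
    lra.
Qed.

Lemma continuity_mul_exp (r : R) : continuity (fun y => y * exp y - r).
Proof.
  intros y. apply derivable_continuous_pt. eexists.
  apply is_derive_Reals. auto_derive; [auto|reflexivity].
Qed.

Lemma mul_exp_surj_right (r : R) :
  - / exp 1 <= r < 0 -> exists y, -1 <= y /\ y * exp y = r.
Proof.
  intros H.
  destruct (IVT_cor (fun y => y * exp y - r) (-1) 0) as [y [Hy E]].
  - apply continuity_mul_exp.
  - lra.
  - rewrite exp_m1. nra.
  - exists y; lra.
Qed.

Lemma mul_exp_surj_left (r : R) :
  - / exp 1 <= r < 0 -> exists y, y <= -1 /\ y * exp y = r.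
Proof.
  intros H.
  set (N := 1 + 4 / (- r)).
  assert (HN : 0 < 4 / (- r)) by (apply Rdiv_lt_0_compat; lra).
  assert (Hr : 4 <= N * - r).
  { unfold N. replace ((1 + 4 / - r) * - r) with (- r + 4) by (field; lra). lra. }
  assert (HE : N * exp (- N) <= - r).
  { rewrite exp_Ropp.
    assert (K : N * N <= 4 * exp N).
    { replace N with (N / 2 + N / 2) at 3 by field. rewrite exp_plus.
      assert (K := exp_ineq1_le (N / 2)).
      assert (N / 2 * (N / 2) <= exp (N / 2) * exp (N / 2))
        by (apply Rmult_le_compat; unfold N in *; lra). lra. }
    assert (P := exp_pos N).
    apply (proj2 (Rle_div_l N (- r) (exp N) P)).
    assert (1 <= N) by (unfold N; lra).
    apply Rmult_le_reg_l with N; [lra|]. nra. }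
  destruct (IVT_cor (fun y => y * exp y - r) (- N) (-1)) as [y [Hy E]].
  - apply continuity_mul_exp.
  - unfold N; lra.
  - rewrite exp_m1. nra.
  - exists y; lra.
Qed.

Lemma mul_exp_real_branches (r : R) : - / exp 1 <= r < 0 ->
  (exists! y, -1 <= y /\ y * exp y = r) /\
  (exists! y, y <= -1 /\ y * exp y = r).
Proof.
  intros Hr. split.
  - destruct (mul_exp_surj_right r Hr) as [y [Hy E]].
    exists y; split; [auto|intros y' [Hy' E']]. apply mul_exp_inj; lra.
  - destruct (mul_exp_surj_left r Hr) as [y [Hy E]].
    exists y; split; [auto|intros y' [Hy' E']]. apply mul_exp_inj; lra.
Qed.

(** * Existence and uniqueness of the branches *)

Definition generic (k : Z) (x : C) : Prop :=
  ~ (in_segment x /\ (k = 0%Z \/ k = (-1)%Z)).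

Lemma log_target (k : Z) (x : C) :
  (Clog x + 2 * IZR k * PI * Ci)%C
  = (ln (Cmod x), Im (Clog x) + 2 * PI * IZR k).
Proof. unfold Clog, Ci, RtoC; simpl. unfold Cplus, Cmult; simpl. f_equal; ring. Qed.

Lemma log_equation_polar (x w : C) (k : Z) : w <> 0%C ->
  (w + Clog w)%C = (Clog x + 2 * IZR k * PI * Ci)%C <->
  exp (Re (Clog w)) * cos (Im (Clog w)) + Re (Clog w) = ln (Cmod x) /\
  exp (Re (Clog w)) * sin (Im (Clog w)) + Im (Clog w)
    = Im (Clog x) + 2 * PI * IZR k.
Proof.
  intros Hw. rewrite log_target.
  assert (E := proj1 (Cexp_log w Hw)).
  rewrite <- E at 1. unfold Cexp.
  destruct (Clog w) as [l t]; simpl. unfold Cplus; simpl.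
  split; [intros K; injection K; auto|intros [-> ->]; reflexivity].
Qed.

Lemma IZR_lt_1_eq_0 (k : Z) : -1 < IZR k < 1 -> k = 0%Z.
Proof. intros [H1 H2]; apply lt_IZR in H1; apply lt_IZR in H2; lia. Qed.

Lemma arg_eq_PI_iff (x : C) : x <> 0%C ->
  Im (Clog x) = PI <-> Im x = 0 /\ Re x < 0.
Proof.
  intros Hx. assert (Hm : 0 < Cmod x) by now apply Cmod_gt_0.
  destruct (Cexp_log x Hx) as [E _].
  split.
  - intros H. rewrite <- E. unfold Cexp; simpl in *. rewrite H, sin_PI, cos_PI.
    rewrite exp_ln by exact Hm. lra.
  - intros [H1 H2].
    assert (K : Cexp (ln (Cmod x), PI) = x).
    { unfold Cexp; simpl. rewrite exp_ln, cos_PI, sin_PI by exact Hm.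
      assert (Em : Cmod x = - Re x).
      { destruct x as [a b]; simpl in *; subst b.
        change (a, 0) with (RtoC a). rewrite Cmod_R, Rabs_left; lra. }
      rewrite Em. destruct x as [a b]; simpl in *. f_equal; lra. }
    rewrite <- K, Clog_exp; simpl; [reflexivity|].
    generalize PI_RGT_0; lra.
Qed.

Lemma Cmod_neg_real (x : C) : Im x = 0 -> Re x < 0 -> Cmod x = - Re x.
Proof.
  intros H1 H2. destruct x as [a b]; simpl in *; subst b.
  change (a, 0) with (RtoC a). rewrite Cmod_R, Rabs_left; lra.
Qed.

Lemma target_im_PI (x : C) (k : Z) : x <> 0%C ->
  Rabs (Im (Clog x) + 2 * PI * IZR k) = PI ->
  Im (Clog x) = PI /\ (k = 0%Z \/ k = (-1)%Z).
Proof.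
  intros Hx H. destruct (Cexp_log x Hx) as [_ Hb].
  set (phi := Im (Clog x)) in *.
  unfold Rabs in H; destruct (Rcase_abs _) as [Hn|Hn].
  - assert (K : (k + 1 = 0)%Z).
    { apply IZR_lt_1_eq_0. rewrite plus_IZR.
      split; apply Rmult_lt_reg_l with (2 * PI); lra. }
    assert (k = (-1)%Z) by lia. subst k. split; [lra|auto].
  - assert (K : k = 0%Z).
    { apply IZR_lt_1_eq_0.
      split; apply Rmult_lt_reg_l with (2 * PI); lra. }
    subst k. split; [lra|auto].
Qed.

Lemma generic_target (x : C) (k : Z) : x <> 0%C -> generic k x ->
  Rabs (Im (Clog x) + 2 * PI * IZR k) = PI -> -1 < ln (Cmod x).
Proof.
  intros Hx Hg H. destruct (target_im_PI x k Hx H) as [H1 H2].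
  apply arg_eq_PI_iff in H1; [|exact Hx]. destruct H1 as [Hi Hr].
  apply Rnot_le_lt; intros L. apply Hg; split; [|exact H2].
  split; [exact Hi|]. split; [|exact Hr].
  rewrite Cmod_neg_real in L by assumption.
  assert (K : - Re x <= exp (-1)).
  { rewrite <- (exp_ln (- Re x)) by lra.
    destruct L as [L|L]; [left; now apply exp_increasing|rewrite L; lra]. }
  rewrite exp_m1 in K. lra.
Qed.

(** Argument [PI] would force [w + log w <= -1] on the line [Im = PI]. *)
Lemma generic_arg_lt_PI (x w : C) (k : Z) : x <> 0%C -> w <> 0%C ->
  generic k x -> (w + Clog w)%C = (Clog x + 2 * IZR k * PI * Ci)%C ->
  - PI < Im (Clog w) < PI.
Proof.
  intros Hx Hw Hg E. apply log_equation_polar in E; [|exact Hw]. destruct E as [E1 E2].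
  destruct (Cexp_log w Hw) as [_ [T1 [T2|T2]]]; [lra|exfalso].
  rewrite T2, sin_PI in E2. rewrite T2, cos_PI in E1.
  assert (K := generic_target x k Hx Hg).
  rewrite <- E2, Rabs_pos_eq in K by lra. specialize (K ltac:(lra)).
  generalize (exp_ineq1_le (Re (Clog w))). lra.
Qed.

Lemma lambertW_generic_exists (x : C) (k : Z) : x <> 0%C -> generic k x ->
  exists w : C, w <> 0%C /\ (w + Clog w)%C = (Clog x + 2 * IZR k * PI * Ci)%C.
Proof.
  intros Hx Hg.
  destruct (polar_exists (ln (Cmod x)) (Im (Clog x) + 2 * PI * IZR k))
    as (lam & th & Ht & E1 & E2).
  { now apply generic_target. }
  exists (Cexp (lam, th)); split; [apply Cexp_neq_0|].
  apply log_equation_polar; [apply Cexp_neq_0|].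
  rewrite Clog_exp by (simpl; lra). split; assumption.
Qed.

Lemma lambertW_generic_unique (x w1 w2 : C) (k : Z) :
  x <> 0%C -> generic k x -> w1 <> 0%C -> w2 <> 0%C ->
  (w1 + Clog w1)%C = (Clog x + 2 * IZR k * PI * Ci)%C ->
  (w2 + Clog w2)%C = (Clog x + 2 * IZR k * PI * Ci)%C -> w1 = w2.
Proof.
  intros Hx Hg H1 H2 E1 E2.
  assert (T1 := generic_arg_lt_PI x w1 k Hx H1 Hg E1).
  assert (T2 := generic_arg_lt_PI x w2 k Hx H2 Hg E2).
  apply log_equation_polar in E1; [|exact H1].
  apply log_equation_polar in E2; [|exact H2].
  destruct E1 as [A1 B1], E2 as [A2 B2].
  destruct (polar_unique _ _ _ _ _ _ T1 T2 A1 B1 A2 B2) as [L T].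
  rewrite <- (proj1 (Cexp_log w1 H1)), <- (proj1 (Cexp_log w2 H2)).
  unfold Clog in *; simpl in *. rewrite L, T. reflexivity.
Qed.

Lemma real_mul_Cexp (w : C) : Im w = 0 ->
  (w * Cexp w)%C = RtoC (Re w * exp (Re w)).
Proof.
  destruct w as [a b]; simpl; intros ->. change (a, 0) with (RtoC a).
  rewrite Cexp_RtoC. unfold RtoC, Cmult; simpl. f_equal; ring.
Qed.

Lemma C_of_parts (z w : C) : Re z = Re w -> Im z = Im w -> z = w.
Proof. destruct z, w; simpl; intros -> ->; reflexivity. Qed.

Lemma lambertW_exists_unique (k : Z) (x : C) :
  x <> 0%C -> exists! w, is_lambertW k x w.
Proof.
  intros Hx.
  destruct (excluded_middle_informative (generic k x)) as [Hg|Hg].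
  - destruct (lambertW_generic_exists x k Hx Hg) as [w Hw].
    exists w; split.
    + split; [intros _; exact Hw|].
      split; intros Hs Hk; elim Hg; split; auto.
    + intros w' [H _]. destruct (H Hg) as [H1 H2], Hw.
      now apply (lambertW_generic_unique x w w' k).
  - apply NNPP in Hg. destruct Hg as [[Hi Hr] Hk].
    assert (Hlift : forall P : R -> Prop,
      (exists! y, P y /\ y * exp y = Re x) ->
      exists! w, (w * Cexp w)%C = x /\ Im w = 0 /\ P (Re w)).
    { intros P (y & [Hy E] & Hu). exists (RtoC y); split.
      - rewrite real_mul_Cexp by reflexivity. simpl. rewrite E.
        split; [apply C_of_parts; simpl; lra|auto].
      - intros w (A & B & D). apply C_of_parts; [|simpl; lra].
        apply Hu; split; [exact D|].
        rewrite real_mul_Cexp in A by exact B. now rewrite <- A. }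
    destruct (mul_exp_real_branches _ Hr) as [Hb0 Hb1].
    destruct Hk as [->| ->];
      [destruct (Hlift _ Hb0) as [w [Hw Hu]]|destruct (Hlift _ Hb1) as [w [Hw Hu]]];
      exists w; split.
    + split; [intros N; elim N; split; [split|]; auto|].
      split; [auto|intros _ K; discriminate K].
    + intros w' [_ [H _]]. apply Hu, H; [split|]; auto.
    + split; [intros N; elim N; split; [split|]; auto|].
      split; [intros _ K; discriminate K|auto].
    + intros w' [_ [_ H]]. apply Hu, H; [split|]; auto.
Qed.

Lemma lambertW_spec (k : Z) (x : C) :
  x <> 0%C -> is_lambertW k x (lambertW k x).
Proof. intros Hx; apply lambertW_correct, lambertW_exists_unique, Hx. Qed.

Lemma lambertW_unique (k : Z) (x w : C) :
  x <> 0%C -> is_lambertW k x w -> w = lambertW k x.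
Proof.
  intros Hx Hw. destruct (lambertW_exists_unique k x Hx) as [w' [_ H]].
  rewrite <- (H w Hw). apply H, lambertW_spec, Hx.
Qed.

Lemma lambertW_unique_generic (k : Z) (x w : C) :
  x <> 0%C -> generic k x -> w <> 0%C ->
  (w + Clog w)%C = (Clog x + 2 * IZR k * PI * Ci)%C -> w = lambertW k x.
Proof.
  intros Hx Hg Hw E. apply lambertW_unique; [exact Hx|].
  split; [auto|]. split; intros Hs Hk; elim Hg; split; auto.
Qed.

Lemma Cexp_2kPI (k : Z) : Cexp (2 * IZR k * PI * Ci) = 1%C.
Proof.
  replace (2 * IZR k * PI * Ci)%C with ((0, 2 * IZR k * PI) : C)
    by (unfold Ci, RtoC, Cmult; simpl; f_equal; ring).
  unfold Cexp; simpl. rewrite exp_0.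
  assert (E : cos (2 * IZR k * PI) = 1 /\ sin (2 * IZR k * PI) = 0).
  { replace (2 * IZR k * PI) with (2 * (IZR k * PI)) by ring.
    rewrite cos_2a_sin, sin_2a.
    rewrite (sin_eq_0_1 (IZR k * PI)) by (exists k; reflexivity). split; ring. }
  destruct E as [-> ->]. unfold RtoC; f_equal; ring.
Qed.

Lemma Cexp_eq (u v : C) :
  Cexp u = Cexp v -> exists k : Z, u = (v + 2 * IZR k * PI * Ci)%C.
Proof.
  intros H.
  assert (E : Cexp (u - v) = 1%C).
  { unfold Cminus. rewrite Cexp_plus, Cexp_opp, H. field. apply Cexp_neq_0. }
  assert (Er : Re (u - v) = 0).
  { apply exp_inv. rewrite <- Cmod_Cexp, E, Cmod_1, exp_0. reflexivity. }
  assert (Ed : u = (v + (u - v))%C) by ring.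
  set (d := (u - v)%C) in *. clearbody d.
  unfold Cexp in E. rewrite Er, exp_0 in E. injection E; intros Es Ec.
  rewrite Rmult_1_l in Es, Ec. change (snd d) with (Im d) in *.
  assert (E2 : sin (Im d / 2) = 0).
  { assert (K := cos_2a_sin (Im d / 2)).
    replace (2 * (Im d / 2)) with (Im d) in K by field.
    rewrite Ec in K. apply Rsqr_0_uniq; unfold Rsqr; lra. }
  destruct (sin_eq_0_0 _ E2) as [k Hk]. exists k.
  rewrite Ed. f_equal.
  apply C_of_parts.
  - rewrite Er; simpl; ring.
  - replace (Im d) with (2 * (IZR k * PI)) by (rewrite <- Hk; field).
    simpl; ring.
Qed.

(** * Location and multiplicity of the values of the branches *)

Lemma lambertW_eq (k : Z) (x : C) :
  x <> 0%C -> (lambertW k x * Cexp (lambertW k x))%C = x.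
Proof.
  intros Hx. destruct (lambertW_spec k x Hx) as (H1 & H2 & H3).
  destruct (excluded_middle_informative (generic k x)) as [Hg|Hg].
  - destruct (H1 Hg) as [Hw E]. set (w := lambertW k x) in *.
    rewrite <- (proj1 (Cexp_log w Hw)) at 1.
    rewrite <- Cexp_plus, Cplus_comm, E, Cexp_plus, Cexp_2kPI.
    rewrite (proj1 (Cexp_log x Hx)). ring.
  - apply NNPP in Hg. destruct Hg as [Hs [Hk|Hk]];
      [apply (H2 Hs Hk)|apply (H3 Hs Hk)].
Qed.

Lemma lambertW_neq_0 (k : Z) (x : C) : x <> 0%C -> lambertW k x <> 0%C.
Proof.
  intros Hx E. assert (K := lambertW_eq k x Hx). rewrite E in K.
  apply Hx. rewrite <- K. ring.
Qed.

Lemma sin_sign (t : R) : - PI < t <= PI ->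
  (0 <= t -> 0 <= sin t) /\ (t < 0 -> sin t < 0).
Proof.
  intros H; split; intros K.
  - apply sin_ge_0; lra.
  - assert (0 < sin (- t)) by (apply sin_gt_0; lra).
    rewrite sin_neg in *; lra.
Qed.

(** Off the real branches, [Im w] is [beta] minus the argument of [w], and
    both have the sign of [beta]. *)
Lemma lambertW_im_bound (k : Z) (x : C) : x <> 0%C ->
  let beta := Im (Clog x) + 2 * PI * IZR k in
  let w := lambertW k x in
  Rabs (Im w - beta) <= PI /\
  ((1 <= k)%Z -> Im w <= beta) /\ ((k <= -1)%Z -> beta <= Im w).
Proof.
  intros Hx beta w. destruct (lambertW_spec k x Hx) as (H1 & H2 & H3). fold w in H1, H2, H3.
  destruct (Cexp_log x Hx) as [_ Hphi].
  destruct (excluded_middle_informative (generic k x)) as [Hg|Hg].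
  - destruct (H1 Hg) as [Hw E].
    assert (T := generic_arg_lt_PI x w k Hx Hw Hg E).
    assert (Ew : Im w = exp (Re (Clog w)) * sin (Im (Clog w))).
    { rewrite <- (proj1 (Cexp_log w Hw)) at 1. reflexivity. }
    apply log_equation_polar in E; [|exact Hw]. destruct E as [_ E].
    fold beta in E. rewrite <- Ew in E.
    assert (P := exp_pos (Re (Clog w))).
    destruct (sin_sign (Im (Clog w))) as [S1 S2]; [lra|].
    split; [apply Rabs_le_between; lra|split; intros Hk; apply IZR_le in Hk].
    + destruct (Rle_dec 0 (Im (Clog w))) as [L|L]; [lra|].
      apply Rnot_le_lt in L. specialize (S2 L). unfold beta in *. nra.
    + destruct (Rlt_dec (Im (Clog w)) 0) as [L|L]; [lra|].
      apply Rnot_lt_le in L. specialize (S1 L).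
      assert (beta <= - PI) by (unfold beta; nra).
      nra.
  - apply NNPP in Hg. destruct Hg as [Hs Hk].
    assert (Ephi : Im (Clog x) = PI).
    { apply arg_eq_PI_iff; [exact Hx|]. destruct Hs as [A [B D]]; auto. }
    assert (Ew : Im w = 0)
      by (destruct Hk as [Hk|Hk]; [apply (H2 Hs Hk)|apply (H3 Hs Hk)]).
    unfold beta; rewrite Ew, Ephi.
    destruct Hk as [->| ->]; (split; [apply Rabs_le_between; lra|split; intros];
      [lia|lra]) || (split; [apply Rabs_le_between; lra|split; intros; try lia; lra]).
Qed.

Lemma tan_gt_id (y : R) : 0 < y < PI -> y * cos y < sin y.
Proof.
  intros H.
  destruct (MVT_cor2 (fun y => sin y - y * cos y) (fun y => y * sin y) 0 y)
    as [c [E Hc]]; [lra| |].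
  - intros c _. apply is_derive_Reals. auto_derive; [auto|ring].
  - rewrite sin_0 in E. assert (0 < sin c) by (apply sin_gt_0; lra).
    assert (0 < c * sin c * (y - 0)) by (repeat apply Rmult_lt_0_compat; lra).
    lra.
Qed.

(** On the line [Im (w + log w) = PI], above the negative real axis, the
    real part of [w + log w] exceeds [-1] because [tan y > y]. *)
Lemma polar_PI_gt (alpha lam th : R) : 0 < th < PI ->
  exp lam * cos th + lam = alpha -> exp lam * sin th + th = PI -> -1 < alpha.
Proof.
  intros Ht E1 E2.
  assert (K := tan_gt_id (PI - th) ltac:(lra)).
  rewrite sin_PI_x, cos_minus, cos_PI, sin_PI in K.
  assert (S : 0 < sin th) by (apply sin_gt_0; lra).
  assert (S' : sin th < PI - th).
  { rewrite <- sin_PI_x. apply sin_lt_x; lra. }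
  assert (C1 : exp lam * - cos th < 1) by nra.
  assert (C2 : 1 < exp lam) by nra.
  assert (0 < lam).
  { apply exp_lt_inv. now rewrite exp_0. }
  lra.
Qed.

(** The exponential of [w + log w] is [x], so [w + log w] differs from [log
    x] by a multiple of [2 i pi]. The case that remains is [x] in the
    segment with index [0] or [-1]: then [w] must be real by [polar_PI_gt]. *)
Lemma lambertW_complete (x w : C) :
  x <> 0%C -> (w * Cexp w)%C = x -> exists k, w = lambertW k x.
Proof.
  intros Hx E. assert (Hw : w <> 0%C) by (intros ->; apply Hx; rewrite <- E; ring).
  destruct (Cexp_eq (w + Clog w) (Clog x)) as [k Hk].
  { rewrite Cexp_plus, (proj1 (Cexp_log w Hw)), (proj1 (Cexp_log x Hx)).
    rewrite <- E; ring. }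
  destruct (excluded_middle_informative (generic k x)) as [Hg|Hg].
  { exists k. now apply lambertW_unique_generic. }
  apply NNPP in Hg. destruct Hg as [Hs Hk2].
  assert (Ephi : Im (Clog x) = PI).
  { apply arg_eq_PI_iff; [exact Hx|]. destruct Hs as [A [B D]]; auto. }
  apply log_equation_polar in Hk; [|exact Hw]. destruct Hk as [K1 K2].
  destruct (Cexp_log w Hw) as [Ew T].
  destruct (sin_sign (Im (Clog w)) T) as [S1 S2].
  assert (P := exp_pos (Re (Clog w))).
  assert (Lx : ln (Cmod x) <= -1).
  { destruct Hs as [A [B D]]. rewrite Cmod_neg_real by assumption.
    rewrite <- (ln_exp (-1)), exp_m1. apply ln_le; lra. }
  assert (Hpi : Im (Clog w) = PI).
  { rewrite Ephi in K2.
    destruct (Req_dec (Im (Clog w)) PI) as [T1|T1]; [exact T1|exfalso].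
    destruct (Rtotal_order (Im (Clog w)) 0) as [T0|[T0|T0]].
    - destruct Hk2 as [->| ->]; [specialize (S2 T0); nra|].
      assert (Q := polar_PI_gt (ln (Cmod x)) (Re (Clog w)) (- Im (Clog w))).
      rewrite cos_neg, sin_neg in Q.
      specialize (Q ltac:(lra) K1 ltac:(lra)). lra.
    - rewrite T0, sin_0 in K2. destruct Hk2 as [->| ->]; lra.
    - destruct Hk2 as [->| ->]; [|specialize (S1 ltac:(lra)); nra].
      assert (Q := polar_PI_gt (ln (Cmod x)) (Re (Clog w)) (Im (Clog w))).
      specialize (Q ltac:(lra) K1 ltac:(lra)). lra. }
  apply arg_eq_PI_iff in Hpi; [|exact Hw]. destruct Hpi as [Wi Wr].
  destruct (Rle_dec (-1) (Re w)) as [L|L].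
  - exists 0%Z. apply lambertW_unique; [exact Hx|].
    split; [intros N; elim N; split; auto|].
    split; [auto|intros _ N; discriminate N].
  - exists (-1)%Z. apply lambertW_unique; [exact Hx|].
    split; [intros N; elim N; split; auto|].
    split; [intros _ N; discriminate N|].
    intros; repeat split; auto; lra.
Qed.

(** On two generic branches, [w + log w] determines the index. A real branch
    does not meet a generic one, where the argument avoids [PI]. *)
Lemma lambertW_inj (x : C) (j k : Z) : x <> 0%C ->
  lambertW j x = lambertW k x ->
  j = k \/ (lambertW j x = RtoC (-1)
            /\ (j = 0%Z \/ j = (-1)%Z) /\ (k = 0%Z \/ k = (-1)%Z)).
Proof.
  intros Hx E. assert (HP := PI_RGT_0).
  destruct (lambertW_spec j x Hx) as (J1 & J2 & J3).
  destruct (lambertW_spec k x Hx) as (K1 & K2 & K3).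
  rewrite <- E in K1, K2, K3. set (w := lambertW j x) in *.
  assert (Hw : w <> 0%C) by now apply lambertW_neq_0.
  assert (Hmix : forall m n, in_segment x -> (m = 0%Z \/ m = (-1)%Z) ->
    generic n x -> Im w = 0 -> (w * Cexp w)%C = x ->
    (w + Clog w)%C = (Clog x + 2 * IZR n * PI * Ci)%C -> False).
  { intros _ n Hs _ Hgn Wi We Eq.
    assert (Ephi : Im (Clog x) = PI).
    { apply arg_eq_PI_iff; [exact Hx|]. destruct Hs as [A [B D]]; auto. }
    assert (Wr : Re w < 0).
    { rewrite real_mul_Cexp in We by exact Wi. destruct Hs as [_ [_ D]].
      rewrite <- We in D. change (Re w * exp (Re w) < 0) in D.
      generalize (exp_pos (Re w)); nra. }
    assert (T : Im (Clog w) = PI) by now apply arg_eq_PI_iff.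
    assert (Q := generic_arg_lt_PI x w n Hx Hw Hgn Eq). lra. }
  destruct (excluded_middle_informative (generic j x)) as [Gj|Gj];
  destruct (excluded_middle_informative (generic k x)) as [Gk|Gk].
  - left. destruct (J1 Gj) as [_ Ej], (K1 Gk) as [_ Ek].
    rewrite Ej, !log_target in Ek. injection Ek; intros Q.
    apply eq_IZR. apply Rmult_eq_reg_l with (2 * PI); lra.
  - exfalso. apply NNPP in Gk. destruct Gk as [Hs Hk].
    apply (Hmix k j Hs Hk Gj); [| |apply (J1 Gj)];
      destruct Hk as [Hk|Hk]; (apply (K2 Hs Hk) || apply (K3 Hs Hk)).
  - exfalso. apply NNPP in Gj. destruct Gj as [Hs Hj].
    apply (Hmix j k Hs Hj Gk); [| |apply (K1 Gk)];
      destruct Hj as [Hj|Hj]; (apply (J2 Hs Hj) || apply (J3 Hs Hj)).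
  - apply NNPP in Gj. destruct Gj as [Hs Hj].
    apply NNPP in Gk. destruct Gk as [_ Hk].
    destruct Hj as [Hj|Hj], Hk as [Hk|Hk]; try (left; congruence); right;
      (split; [|auto]).
    + destruct (J2 Hs Hj) as (A & B & D), (K3 Hs Hk) as (A' & B' & D').
      apply C_of_parts; [change (Re w = -1)|change (Im w = 0)]; lra.
    + destruct (J3 Hs Hj) as (A & B & D), (K2 Hs Hk) as (A' & B' & D').
      apply C_of_parts; [change (Re w = -1)|change (Im w = 0)]; lra.
Qed.

Lemma mul_exp_m1 : (RtoC (-1) * Cexp (RtoC (-1)))%C = RtoC (- / exp 1).
Proof.
  rewrite Cexp_RtoC, <- RtoC_mult. f_equal. rewrite exp_m1. ring.
Qed.

Lemma lambertW_eq_m1 (x : C) (k : Z) : x <> 0%C ->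
  lambertW k x = RtoC (-1) -> x = RtoC (- / exp 1).
Proof.
  intros Hx E. rewrite <- (lambertW_eq k x Hx), E. apply mul_exp_m1.
Qed.

Lemma lambertW_branch_point (k : Z) : k = 0%Z \/ k = (-1)%Z ->
  lambertW k (RtoC (- / exp 1)) = RtoC (-1).
Proof.
  intros Hk. assert (P := exp_pos 1). assert (P' := Rinv_0_lt_compat _ P).
  assert (Hs : in_segment (RtoC (- / exp 1))) by (split; simpl; lra).
  symmetry; apply lambertW_unique.
  - intros E. injection E. lra.
  - split; [intros N; elim N; split; auto|].
    split; intros _ _; repeat split; try apply mul_exp_m1; simpl; lra.
Qed.

Open Scope C_scope.

(** * Finite sums *)

Notation Csum := (@sum_n C_AbelianMonoid).

Ltac eq_in_C := match goal with |- @eq _ ?a ?b => change (@eq C a b) end.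

Lemma Csum_Sn (u : nat -> C) (n : nat) :
  Csum u (S n) = Csum u n + u (S n).
Proof. exact (sum_Sn (G := C_AbelianMonoid) u n). Qed.

Lemma Csum_bound (u : nat -> C) (v : nat -> R) (n : nat) :
  (forall j, (j <= n)%nat -> (Cmod (u j) <= v j)%R) ->
  (Cmod (Csum u n) <= sum_n v n)%R.
Proof.
  induction n as [|n IH]; intros H.
  - rewrite !sum_O. apply H; lia.
  - rewrite Csum_Sn, sum_Sn.
    eapply Rle_trans; [apply Cmod_triangle|].
    apply Rplus_le_compat; [apply IH; intros; apply H; lia|apply H; lia].
Qed.

Lemma Rsum_const (c : R) (n : nat) : sum_n (fun _ => c) n = (INR (S n) * c)%R.
Proof. apply sum_n_const. Qed.

Lemma sum_n_rev {G : AbelianMonoid} (f : nat -> G) (n : nat) :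
  sum_n (fun j => f (n - j)%nat) n = sum_n f n.
Proof.
  induction n as [|n IH].
  - rewrite !sum_O. reflexivity.
  - transitivity (plus (f (S n)) (sum_n (fun j => f (n - j)%nat) n)).
    + unfold sum_n. rewrite sum_Sn_m by lia.
      rewrite <- (sum_n_m_S (fun j => f (S n - j)%nat)). reflexivity.
    + rewrite IH, sum_Sn. apply plus_comm.
Qed.

Lemma sum_n_delta (c : C) (j0 n : nat) :
  Csum (fun j => if Nat.eqb j j0 then c else RtoC 0) n
  = if Nat.leb j0 n then c else RtoC 0.
Proof.
  induction n as [|n IH].
  - rewrite sum_O. destruct j0; reflexivity.
  - rewrite Csum_Sn, IH.
    destruct (Nat.leb_spec j0 n), (Nat.leb_spec j0 (S n)),
      (Nat.eqb_spec (S n) j0); try lia; eq_in_C; ring.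
Qed.

Lemma sum_inv_sqrt_bound (n : nat) :
  (sum_n (fun j => / (INR j + 1)) n <= 2 * sqrt (INR n + 1))%R.
Proof.
  induction n as [|n IH].
  - rewrite sum_O. simpl. rewrite Rplus_0_l, sqrt_1. lra.
  - rewrite sum_Sn. rewrite S_INR.
    set (m := (INR n + 1)%R) in *.
    assert (Hm : (1 <= m)%R) by (unfold m; generalize (pos_INR n); lra).
    assert (S1 : (0 < sqrt m)%R) by (apply sqrt_lt_R0; lra).
    assert (Q1 : (sqrt m * sqrt m = m)%R) by (apply sqrt_sqrt; lra).
    assert (Q2 : (sqrt (m + 1) * sqrt (m + 1) = m + 1)%R)
      by (apply sqrt_sqrt; lra).
    assert (S2 : (1 < sqrt (m + 1))%R)
      by (rewrite <- sqrt_1 at 1; apply sqrt_lt_1; lra).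
    change (plus (sum_n (fun j => / (INR j + 1)) n) (/ (m + 1))
            <= 2 * sqrt (m + 1))%R.
    assert (K : (/ (m + 1) <= 2 * sqrt (m + 1) - 2 * sqrt m)%R).
    { apply Rmult_le_reg_l with (m + 1)%R; [lra|].
      rewrite Rinv_r by lra.
      set (p := sqrt (m + 1)) in *. set (q := sqrt m) in *.
      assert (q < p)%R by nra.
      nra. }
    unfold plus; simpl. lra.
Qed.

(** * The entire function whose zeros are the Lambert values *)

Definition lamb (x z : C) : C := x * Cexp (- z) - z.

Lemma lamb_eq_0_iff (x z : C) : lamb x z = 0 <-> z * Cexp z = x.
Proof.
  unfold lamb. assert (H := Cexp_neq_0 z). rewrite Cexp_opp. split; intros E.
  - replace z with (x * / Cexp z) at 1.
    + field; exact H.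
    + replace (x * / Cexp z) with ((x * / Cexp z - z) + z) by ring.
      rewrite E; ring.
  - rewrite <- E. field; exact H.
Qed.

Lemma lamb_lambertW (x : C) (k : Z) : x <> 0 -> lamb x (lambertW k x) = 0.
Proof. intros Hx; now apply lamb_eq_0_iff, lambertW_eq. Qed.

Lemma lamb_neq_0 (x t : C) : x <> 0 ->
  (forall k, t <> lambertW k x) -> lamb x t <> 0.
Proof.
  intros Hx Ht E. apply lamb_eq_0_iff in E.
  destruct (lambertW_complete x t Hx E) as [k Hk]. now apply (Ht k).
Qed.

Lemma jet2_Cexp_opp (z : C) :
  jet2 (fun w => Cexp (- w)) z (- Cexp (- z)) (Cexp (- z) / 2).
Proof.
  set (e := Cexp (- z)).
  exists (fun w => if Ceq_dec w z then e / 2 else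
    (Cexp (- w) - e + (w - z) * e) / ((w - z) * (w - z))).
  split; [|split].
  - intros eps Heps.
    assert (He : (0 < Cmod e)%R) by apply Cmod_gt_0, Cexp_neq_0.
    exists (Rmin 1 (eps / (50 * Cmod e))).
    split; [apply Rmin_pos; [lra|apply Rdiv_lt_0_compat; lra]|intros w Hw].
    destruct (Ceq_dec z z) as [_|N]; [|congruence].
    destruct (Ceq_dec w z) as [->|N].
    { replace (e / 2 - e / 2) with (RtoC 0) by ring. now rewrite Cmod_0. }
    assert (Hw1 := lt_Rmin_l Hw).
    assert (Hw2 := lt_Rmin_r Hw).
    assert (Hu := C_sub_neq_0 _ _ N). assert (Hu' := Cmod_sub_pos _ _ N).
    set (u := w - z) in *.
    replace (Cexp (- w)) with (e * Cexp (- u))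
      by (unfold e, u; rewrite <- Cexp_plus; f_equal; ring).
    replace ((e * Cexp (- u) - e + u * e) / (u * u) - e / 2) with
      (e * (Cexp (- u) - (1 + - u + - u * - u / 2)) / (u * u))
      by (field; auto).
    rewrite Cmod_div by now apply Cmult_neq_0. rewrite !Cmod_mult.
    assert (T := Cexp_taylor_bound (- u)). rewrite Cmod_opp in T.
    specialize (T ltac:(lra)).
    set (m := Cmod u) in *.
    apply (proj2 (Rlt_div_l _ _ (m * m)%R ltac:(nra))).
    apply Rle_lt_trans with (Cmod e * (50 * m ^ 3))%R.
    { apply Rmult_le_compat_l; lra. }
    apply (Rlt_div_r m eps (50 * Cmod e)) in Hw2; [|lra].
    replace (Cmod e * (50 * m ^ 3))%R with (m * (50 * Cmod e) * (m * m))%R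
      by ring.
    apply Rmult_lt_compat_r; [nra|exact Hw2].
  - cbv beta. destruct (Ceq_dec z z); [reflexivity|congruence].
  - exists 1%R; split; [lra|intros w _]. fold e.
    destruct (Ceq_dec w z) as [->|N]; [fold e; ring|].
    field. now apply C_sub_neq_0.
Qed.

Lemma jet2_lamb (x z : C) :
  jet2 (lamb x) z (- (x * Cexp (- z)) - 1) (x * Cexp (- z) / 2).
Proof.
  eapply jet2_eq; [apply jet2_minus;
    [apply (jet2_scal x), jet2_Cexp_opp|apply jet2_id]| |]; unfold Cdiv; ring.
Qed.

(** It equals [-1/2 - lamb' / lamb], where [lamb' = - lamb - z - 1]. *)
Definition lamb_sum (x z : C) : C := / 2 + (1 + z) / lamb x z.

(** The derivative of [lamb_sum x]. *)
Definition lamb_sum_d1 (x z : C) : C :=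
  (x * Cexp (- z) * (2 + z) + 1) / (lamb x z * lamb x z).

(** Half of the second derivative of [lamb_sum x]. *)
Definition lamb_sum_d2 (x z : C) : C :=
  (x * Cexp (- z) + 1) / (lamb x z * lamb x z)
  + (1 + z) * ((x * Cexp (- z) + 1) * (x * Cexp (- z) + 1)
                 / (lamb x z * lamb x z * lamb x z)
               - x * Cexp (- z) / 2 / (lamb x z * lamb x z)).

Lemma C2_neq_0 : RtoC 2 <> 0.
Proof. intros E; injection E; lra. Qed.

Lemma jet2_lamb_sum (x z : C) : lamb x z <> 0 ->
  jet2 (lamb_sum x) z (lamb_sum_d1 x z) (lamb_sum_d2 x z).
Proof.
  intros H. assert (J := jet2_plus _ _ z _ _ _ _ (jet2_const (/ 2) z)
    (jet2_mult _ _ z _ _ _ _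
      (jet2_plus _ _ z _ _ _ _ (jet2_const 1 z) (jet2_id z))
      (jet2_inv _ _ _ _ (jet2_lamb x z) H))).
  apply (jet2_eq _ _ _ _ _ _ J).
  - unfold lamb_sum_d1, lamb in *. field. exact H.
  - unfold lamb_sum_d2. field. exact H.
Qed.

(** * The partial sums and their defect *)

(** The shift of the index is that of the symmetric partial sums. *)
Definition branch (x : C) (K j : nat) : C :=
  lambertW (Z.of_nat j - Z.of_nat K) x.

Definition branch_sum (x : C) (K : nat) (z : C) : C :=
  Csum (fun j => / (branch x K j - z)) (2 * K).

Definition branches (x : C) (K : nat) : list C :=
  map (branch x K) (seq 0 (2 * K + 1)).

Definition defect (x : C) (K : nat) (z : C) : C :=
  lamb_sum x z - branch_sum x K z.

Lemma in_branches (x : C) (K : nat) (z : C) :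
  In z (branches x K) <-> exists j, (j <= 2 * K)%nat /\ z = branch x K j.
Proof.
  unfold branches. rewrite in_map_iff. split.
  - intros [j [E H]]. apply in_seq in H. exists j; split; [lia|auto].
  - intros [j [H E]]. exists j; split; [auto|]. apply in_seq; lia.
Qed.

Lemma lamb_branch (x : C) (K j : nat) : x <> 0 -> lamb x (branch x K j) = 0.
Proof. apply lamb_lambertW. Qed.

Lemma lamb_neq_0_notin (x : C) (K : nat) (z : C) : x <> 0 ->
  lamb x z <> 0 -> ~ In z (branches x K).
Proof.
  intros Hx Hz H. apply in_branches in H. destruct H as [j [_ ->]].
  now apply Hz, lamb_branch.
Qed.

Lemma jet2_sum_inv (u : nat -> C) (z : C) (n : nat) :
  (forall j, (j <= n)%nat -> u j <> z) ->
  jet2 (fun w => Csum (fun j => / (u j - w)) n) z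
    (Csum (fun j => / (u j - z) ^ 2) n) (Csum (fun j => / (u j - z) ^ 3) n).
Proof.
  intros H.
  assert (J : forall j, (j <= n)%nat ->
    jet2 (fun w => / (u j - w)) z (/ (u j - z) ^ 2) (/ (u j - z) ^ 3)).
  { intros j Hj. assert (N := C_sub_neq_0 _ _ (H j Hj)).
    assert (J := jet2_inv _ _ _ _
      (jet2_minus _ _ _ _ _ _ _ (jet2_const (u j) z) (jet2_id z)) N).
    apply (jet2_eq _ _ _ _ _ _ J); simpl; field; exact N. }
  clear H. induction n as [|n IH].
  - rewrite !sum_O.
    apply jet2_ext with (fun w => / (u 0%nat - w));
      [intros; now rewrite sum_O|apply J; lia].
  - rewrite !Csum_Sn.
    apply jet2_ext with
      (fun w => Csum (fun j => / (u j - w)) n + / (u (S n) - w));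
      [intros; now rewrite Csum_Sn|].
    apply jet2_plus; [apply IH; intros; apply J; lia|apply J; lia].
Qed.

Lemma jet2_defect (x z : C) (K : nat) : x <> 0 -> lamb x z <> 0 ->
  jet2 (defect x K) z
    (lamb_sum_d1 x z - Csum (fun j => / (branch x K j - z) ^ 2) (2 * K))
    (lamb_sum_d2 x z - Csum (fun j => / (branch x K j - z) ^ 3) (2 * K)).
Proof.
  intros Hx Hz. apply jet2_minus; [now apply jet2_lamb_sum|].
  apply jet2_sum_inv. intros j _ E. apply Hz. rewrite <- E.
  now apply lamb_branch.
Qed.

(** The terms whose pole is [p] are identical, and the others are bounded
    near [p]. *)
Lemma sum_inv_near_pole (u : nat -> C) (p : C) (n : nat) :
  exists r B, (0 < r)%R /\ forall z, (0 < Cmod (z - p) < r)%R ->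
    (Cmod (Csum (fun j => / (u j - z)) n
       - Csum (fun j => if Ceq_dec (u j) p then RtoC 1 else RtoC 0) n
         * / (p - z))%C <= B)%R.
Proof.
  assert (H1 : forall j, exists r B, (0 < r)%R /\
    forall z, (0 < Cmod (z - p) < r)%R ->
    (Cmod (/ (u j - z) - (if Ceq_dec (u j) p then RtoC 1 else RtoC 0) * / (p - z))%C
     <= B)%R).
  { intros j. destruct (Ceq_dec (u j) p) as [->|N].
    - exists 1%R, 0%R; split; [lra|intros z _].
      replace (/ (p - z) - 1 * / (p - z)) with (RtoC 0) by ring.
      rewrite Cmod_0; lra.
    - assert (C1 : cont (fun z => / (u j - z)) p).
      { apply cont_inv; [cont_tac|]. now apply C_sub_neq_0. }
      destruct (cont_bounded _ _ C1) as (r & B & Hr & HB).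
      exists r, B; split; [exact Hr|intros z [_ Hz]].
      replace (/ (u j - z) - 0 * / (p - z)) with (/ (u j - z)) by ring.
      now apply HB. }
  induction n as [|n IH].
  - destruct (H1 0%nat) as (r & B & Hr & HB).
    exists r, B; split; [exact Hr|intros z Hz]. rewrite !sum_O. now apply HB.
  - destruct (H1 (S n)) as (r & B & Hr & HB).
    destruct IH as (r' & B' & Hr' & HB').
    exists (Rmin r r'), (B' + B)%R; split; [now apply Rmin_pos|intros z [Z1 Z2]].
    specialize (HB z (conj Z1 (lt_Rmin_l Z2))).
    specialize (HB' z (conj Z1 (lt_Rmin_r Z2))).
    rewrite !Csum_Sn. eapply Rle_trans;
      [|apply (Rplus_le_compat _ _ _ _ HB' HB)].
    eapply Rle_trans; [|apply Cmod_triangle].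
    assert (E : forall a b c d e : C, a + b - (c + d) * e
                = a - c * e + (b - d * e)) by (intros; ring).
    rewrite E. apply Rle_refl.
Qed.

(** * Removable singularities of the defect *)

Lemma indicator_sum_one (u : nat -> C) (p : C) (n j0 : nat) :
  (j0 <= n)%nat -> (forall j, (j <= n)%nat -> u j = p <-> j = j0) ->
  Csum (fun j => if Ceq_dec (u j) p then RtoC 1 else RtoC 0) n = RtoC 1.
Proof.
  intros H0 H.
  rewrite (sum_n_ext_loc _ (fun j => if Nat.eqb j j0 then RtoC 1 else RtoC 0)).
  - rewrite sum_n_delta. destruct (Nat.leb_spec j0 n); [reflexivity|lia].
  - intros j Hj. destruct (Ceq_dec (u j) p) as [E|E], (Nat.eqb_spec j j0) as [F|F];
      try reflexivity; elim F || elim E; now apply H.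
Qed.

Lemma indicator_sum_two (u : nat -> C) (p : C) (n j0 j1 : nat) :
  (j0 <= n)%nat -> (j1 <= n)%nat -> j0 <> j1 ->
  (forall j, (j <= n)%nat -> u j = p <-> (j = j0 \/ j = j1)) ->
  Csum (fun j => if Ceq_dec (u j) p then RtoC 1 else RtoC 0) n = RtoC 2.
Proof.
  intros H0 H1 Hne H.
  rewrite (sum_n_ext_loc _ (fun j => plus
    ((fun j => if Nat.eqb j j0 then RtoC 1 else RtoC 0) j)
    ((fun j => if Nat.eqb j j1 then RtoC 1 else RtoC 0) j))).
  - rewrite sum_n_plus, !sum_n_delta.
    destruct (Nat.leb_spec j0 n), (Nat.leb_spec j1 n); try lia.
    unfold plus; simpl. unfold Cplus, RtoC; simpl. f_equal; ring.
  - intros j Hj. specialize (H j Hj).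
    assert (E1 : plus (RtoC 1) (RtoC 0) = RtoC 1)
      by (unfold plus; simpl; unfold Cplus, RtoC; simpl; f_equal; ring).
    assert (E2 : plus (RtoC 0) (RtoC 1) = RtoC 1)
      by (unfold plus; simpl; unfold Cplus, RtoC; simpl; f_equal; ring).
    assert (E3 : plus (RtoC 0) (RtoC 0) = RtoC 0)
      by (unfold plus; simpl; unfold Cplus, RtoC; simpl; f_equal; ring).
    destruct (Ceq_dec (u j) p) as [E|E], (Nat.eqb_spec j j0) as [F0|F0],
      (Nat.eqb_spec j j1) as [F1|F1]; rewrite ?E1, ?E2, ?E3; try reflexivity;
      try (exfalso; tauto); exfalso; congruence.
Qed.

(** For [K >= 1] both indices [0] and [-1] are in the range, so the count is
    the multiplicity of [p] as a zero of [lamb x]. *)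
Lemma branch_count (x : C) (K j0 : nat) : x <> 0 -> (1 <= K)%nat ->
  (j0 <= 2 * K)%nat ->
  let p := branch x K j0 in
  Csum (fun j => if Ceq_dec (branch x K j) p then RtoC 1 else RtoC 0) (2 * K)
  = if Ceq_dec p (RtoC (-1)) then RtoC 2 else RtoC 1.
Proof.
  intros Hx HK Hj0 p.
  destruct (Ceq_dec p (RtoC (-1))) as [Hp|Hp].
  - assert (Ex := lambertW_eq_m1 x _ Hx Hp).
    apply (indicator_sum_two _ _ _ K (K - 1)); try lia.
    intros j Hj. unfold branch at 1. rewrite Hp. split; intros E.
    + assert (E0 : lambertW (Z.of_nat j - Z.of_nat K) x = lambertW 0 x).
      { rewrite E, Ex, lambertW_branch_point; auto. }
      destruct (lambertW_inj x _ _ Hx E0) as [Q|[_ [[Q|Q] _]]]; lia.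
    + rewrite Ex. apply lambertW_branch_point. lia.
  - apply (indicator_sum_one _ _ _ j0 Hj0).
    intros j Hj. split; [|intros ->; reflexivity].
    unfold p, branch; intros E.
    destruct (lambertW_inj x _ _ Hx E) as [Q|[Q _]]; [lia|].
    elim Hp. unfold p, branch. now rewrite <- E.
Qed.

(** At the zero [p], the derivative of [lamb x] is [- (p + 1)]: the zero is
    simple, and the residue of [lamb_sum x] is [-1]. *)
Lemma lamb_sum_near_simple_zero (x p : C) : lamb x p = 0 -> p <> RtoC (-1) ->
  exists r B, (0 < r)%R /\ forall z, (0 < Cmod (z - p) < r)%R ->
    (Cmod (lamb_sum x z - 1 * / (p - z))%C <= B)%R.
Proof.
  intros Hp Hne.
  destruct (jet2_lamb x p) as (g & Hg & _ & r & Hr & H).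
  assert (Ea : - (x * Cexp (- p)) - 1 = - (p + 1)).
  { unfold lamb in Hp.
    replace (x * Cexp (- p)) with ((x * Cexp (- p) - p) + p) by ring.
    rewrite Hp; ring. }
  rewrite Ea in H.
  assert (Ha : - (p + 1) + (p - p) * g p <> 0).
  { intros E. apply Hne.
    replace p with (- (- (p + 1) + (p - p) * g p) - 1) by ring.
    rewrite E. unfold Cminus, RtoC, Copp, Cplus; simpl; f_equal; ring. }
  assert (C1 : cont (fun z => - (p + 1) + (z - p) * g z) p) by cont_tac.
  destruct (cont_neq _ p 0 C1 Ha) as [s [Hs Hs0]].
  assert (C2 : cont (fun z => / 2 + (1 + g z) * / (- (p + 1) + (z - p) * g z)) p)
    by cont_tac.
  destruct (cont_bounded _ _ C2) as (r' & B & Hr' & HB).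
  exists (Rmin r (Rmin s r')), B.
  split; [repeat apply Rmin_pos; assumption|intros z [Z0 Z]].
  assert (Zr := lt_Rmin_l Z).
  assert (Z' := lt_Rmin_r Z).
  assert (Zs := lt_Rmin_l Z').
  assert (Zr' := lt_Rmin_r Z').
  assert (Hu : z - p <> 0) by now apply Cmod_gt_0.
  assert (Hu' : p - z <> 0).
  { intros E; apply Hu. replace (z - p) with (- (p - z)) by ring.
    rewrite E; ring. }
  specialize (Hs0 z Zs).
  replace (lamb_sum x z - 1 * / (p - z))
    with (/ 2 + (1 + g z) * / (- (p + 1) + (z - p) * g z)); [now apply HB|].
  unfold lamb_sum. rewrite (H z Zr), Hp.
  field. repeat split; try assumption; exact C2_neq_0.
Qed.

(** At the branch point, the zero [-1] of [lamb x] is double. *)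
Lemma lamb_sum_near_double_zero (x p : C) :
  lamb x p = 0 -> p = RtoC (-1) ->
  exists r B, (0 < r)%R /\ forall z, (0 < Cmod (z - p) < r)%R ->
    (Cmod (lamb_sum x z - 2 * / (p - z))%C <= B)%R.
Proof.
  intros Hp Ep.
  exists (/ 200)%R, (401)%R; split; [lra|intros z [Z0 Z1]].
  assert (Hu : z - p <> 0) by now apply Cmod_gt_0.
  set (u := z - p) in *.
  set (rho := Cexp (- u) - (1 + - u + - u * - u / 2)).
  assert (T : (Cmod rho <= 50 * Cmod u ^ 3)%R).
  { unfold rho. rewrite <- (Cmod_opp u). apply Cexp_taylor_bound.
    rewrite Cmod_opp; lra. }
  assert (El : lamb x z = - (u * u / 2) - rho).
  { apply lamb_eq_0_iff in Hp. unfold lamb.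
    rewrite <- Hp, <- Cmult_assoc, <- Cexp_plus.
    replace (p + - z) with (- u) by (unfold u; ring).
    replace (Cexp (- u)) with (rho + (1 + - u + - u * - u / 2))
      by (unfold rho; ring).
    replace z with (u + p) by (unfold u; ring).
    rewrite Ep. replace (RtoC (-1)) with (- RtoC 1)
      by (unfold RtoC, Copp; simpl; f_equal; ring).
    unfold Cdiv; ring. }
  assert (Hl : (Cmod u ^ 2 / 4 <= Cmod (lamb x z))%R).
  { rewrite El.
    replace (- (u * u / 2) - rho) with (- (u * u / 2 + rho)) by ring.
    rewrite Cmod_opp.
    assert (K := Cmod_triangle_sub (u * u / 2) (- rho)).
    rewrite Cmod_opp in K.
    replace (u * u / 2 - - rho) with (u * u / 2 + rho) in K by ring.
    rewrite Cmod_div, Cmod_mult in K by exact C2_neq_0.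
    rewrite Cmod_R, (Rabs_pos_eq 2) in K by lra.
    assert (Cmod u ^ 3 <= / 200 * Cmod u ^ 2)%R.
    { simpl. rewrite Rmult_1_r. apply Rmult_le_compat_r; nra. }
    lra. }
  assert (Hl0 : lamb x z <> 0).
  { apply Cmod_gt_0. nra. }
  assert (Hu' : p - z <> 0).
  { intros E; apply Hu. unfold u. replace (z - p) with (- (p - z)) by ring.
    rewrite E; ring. }
  replace (lamb_sum x z - 2 * / (p - z)) with (/ 2 - 2 * rho / (u * lamb x z)).
  2: { unfold lamb_sum.
       replace (2 * rho) with (- (u * u) - 2 * lamb x z)
         by (rewrite El; field; exact C2_neq_0).
       replace (p - z) with (- u) by (unfold u; ring).
       replace (1 + z) with u.
       - field. repeat split; auto using C2_neq_0.
       - unfold u; rewrite Ep. unfold Cminus, RtoC, Copp, Cplus; simpl.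
         f_equal; ring. }
  eapply Rle_trans; [apply Cmod_sub_le|].
  rewrite Cmod_inv, Cmod_div, !Cmod_mult by
    (exact C2_neq_0 || now apply Cmult_neq_0).
  rewrite !Cmod_R, (Rabs_pos_eq 2) by lra.
  assert (Hq : (2 * Cmod rho / (Cmod u * Cmod (lamb x z)) <= 400)%R).
  { set (m := Cmod u) in *. set (q := Cmod (lamb x z)) in *.
    assert (Hq0 : (0 < q)%R) by now apply Cmod_gt_0.
    apply (proj2 (Rle_div_l _ _ (m * q)%R ltac:(nra))).
    replace (400 * (m * q))%R with (m * (400 * q))%R by ring.
    apply Rle_trans with (m * (100 * m ^ 2))%R; [lra|].
    apply Rmult_le_compat_l; lra. }
  lra.
Qed.

Lemma defect_bounded_near (x : C) (K : nat) (p : C) : x <> 0 -> (1 <= K)%nat ->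
  In p (branches x K) ->
  exists r B, (0 < r)%R /\ forall z, (0 < Cmod (z - p) < r)%R ->
    (Cmod (defect x K z) <= B)%R.
Proof.
  intros Hx HK Hp. apply in_branches in Hp. destruct Hp as (j0 & Hj0 & ->).
  assert (Hl := lamb_branch x K j0 Hx).
  destruct (sum_inv_near_pole (branch x K) (branch x K j0) (2 * K))
    as (r1 & B1 & Hr1 & H1).
  rewrite branch_count in H1 by assumption.
  assert (H2 : exists r B, (0 < r)%R /\
    forall z, (0 < Cmod (z - branch x K j0) < r)%R ->
    (Cmod (lamb_sum x z - (if Ceq_dec (branch x K j0) (RtoC (-1)) then RtoC 2 else RtoC 1)
                     * / (branch x K j0 - z))%C <= B)%R).
  { destruct (Ceq_dec (branch x K j0) (RtoC (-1))) as [E|E].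
    - now apply lamb_sum_near_double_zero.
    - now apply lamb_sum_near_simple_zero. }
  destruct H2 as (r2 & B2 & Hr2 & H2).
  exists (Rmin r1 r2), (B2 + B1)%R; split; [now apply Rmin_pos|intros z [Z1 Z2]].
  specialize (H1 z (conj Z1 (lt_Rmin_l Z2))).
  specialize (H2 z (conj Z1 (lt_Rmin_r Z2))).
  eapply Rle_trans; [|apply (Rplus_le_compat _ _ _ _ H2 H1)].
  eapply Rle_trans; [|apply Cmod_sub_le].
  unfold defect, branch_sum.
  assert (E : forall a b c : C, a - b = (a - c) - (b - c)) by (intros; ring).
  rewrite <- E. apply Rle_refl.
Qed.

(** * Estimates on the boundary of a box *)

Definition box_top (x : C) (K : nat) : R :=
  (Im (Clog x) + 2 * PI * INR K + PI / 2)%R.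

Definition box_bot (x : C) (K : nat) : R :=
  (Im (Clog x) - 2 * PI * INR K - PI / 2)%R.

Lemma PI_gt_3 : (3 < PI)%R.
Proof. generalize PI2_3_2; lra. Qed.

(** These linear gaps bound the partial sum on the horizontal edges by a
    harmonic sum. *)
Lemma branch_im_gap (x : C) (K j : nat) : x <> 0 -> (1 <= K)%nat ->
  (j <= 2 * K)%nat ->
  (INR (2 * K - j) + 1 <= box_top x K - Im (branch x K j))%R /\
  (INR j + 1 <= Im (branch x K j) - box_bot x K)%R.
Proof.
  intros Hx HK Hj. assert (HP := PI_gt_3).
  destruct (lambertW_im_bound (Z.of_nat j - Z.of_nat K) x Hx) as (H1 & H2 & H3).
  fold (branch x K j) in H1, H2, H3.
  rewrite minus_IZR, <- !INR_IZR_INZ in H1, H2, H3.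
  apply Rabs_le_between in H1. unfold box_top, box_bot.
  rewrite minus_INR by lia. rewrite mult_INR. change (INR 2) with 2%R.
  split.
  - destruct (Nat.eq_dec j (2 * K)) as [->|N].
    + specialize (H2 ltac:(lia)). rewrite mult_INR in H2 |- *.
      change (INR 2) with 2%R in *. lra.
    + assert (L : (INR j + 1 <= 2 * INR K)%R).
      { change 2%R with (INR 2). rewrite <- mult_INR, <- S_INR.
        apply le_INR; lia. }
      nra.
  - destruct (Nat.eq_dec j 0) as [->|N].
    + specialize (H3 ltac:(lia)). simpl (INR 0) in *. lra.
    + assert (L : (1 <= INR j)%R) by (apply (le_INR 1); lia).
      nra.
Qed.

(** The edges separate the zeros with [|k| <= K] strictly from the others. *)
Lemma zero_in_strip (x z : C) (K : nat) : x <> 0 -> lamb x z = 0 ->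
  (box_bot x K <= Im z <= box_top x K)%R -> In z (branches x K).
Proof.
  intros Hx Hz Hb. assert (HP := PI_gt_3).
  apply lamb_eq_0_iff in Hz.
  destruct (lambertW_complete x z Hx Hz) as [k ->].
  destruct (lambertW_im_bound k x Hx) as (H1 & _ & _).
  apply Rabs_le_between in H1. unfold box_top, box_bot in Hb.
  rewrite INR_IZR_INZ in Hb.
  assert (L1 : (k < Z.of_nat K + 1)%Z).
  { apply lt_IZR. rewrite plus_IZR.
    apply Rmult_lt_reg_l with (2 * PI)%R; lra. }
  assert (L2 : (- Z.of_nat K - 1 < k)%Z).
  { apply lt_IZR. rewrite minus_IZR, opp_IZR.
    apply Rmult_lt_reg_l with (2 * PI)%R; lra. }
  apply in_branches. exists (Z.to_nat (k + Z.of_nat K)).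
  split; [lia|]. unfold branch. f_equal. lia.
Qed.

Lemma lamb_polar (x z : C) : x <> 0 ->
  lamb x z = ((Cmod x * exp (- Re z) * cos (Im (Clog x) - Im z) - Re z)%R,
              (Cmod x * exp (- Re z) * sin (Im (Clog x) - Im z) - Im z)%R).
Proof.
  intros Hx. unfold lamb.
  rewrite <- (proj1 (Cexp_log x Hx)) at 1. rewrite <- Cexp_plus.
  unfold Cexp. destruct z as [a b]; simpl.
  assert (Hm : (0 < Cmod x)%R) by now apply Cmod_gt_0.
  rewrite exp_plus, (exp_ln _ Hm). unfold Cminus, Copp, Cplus; simpl.
  f_equal; unfold Rminus; ring.
Qed.

Lemma Cmod_le_of_parts (u v : C) :
  (Rabs (Re u) <= Rabs (Re v))%R -> (Rabs (Im u) <= Rabs (Im v))%R ->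
  (Cmod u <= Cmod v)%R.
Proof.
  intros H1 H2. apply Rsqr_incr_0_var; [|apply Cmod_ge_0].
  unfold Rsqr. generalize (Cmod2_alt u) (Cmod2_alt v).
  simpl; rewrite !Rmult_1_r; intros -> ->.
  apply Rplus_le_compat; apply Rsqr_le_abs_1; assumption.
Qed.

Lemma cos_sin_shift (K : nat) (s : R) :
  cos (2 * PI * INR K + s) = cos s /\ sin (2 * PI * INR K + s) = sin s.
Proof.
  replace (2 * PI * INR K + s)%R with (s + 2 * INR K * PI)%R by ring.
  split; [apply cos_period|apply sin_period].
Qed.

(** The heights of the horizontal edges are chosen so that [x e^{-z}] is there
    purely imaginary, of the sign opposite to that of [Im z]. *)
Lemma lamb_horizontal_edge (x z : C) (K : nat) : x <> 0 -> (1 <= K)%nat ->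
  Im z = box_top x K \/ Im z = box_bot x K -> (Cmod z <= Cmod (lamb x z))%R.
Proof.
  intros Hx HK Hz. destruct (Cexp_log x Hx) as [_ Hphi].
  assert (HK1 : (1 <= INR K)%R) by now apply (le_INR 1).
  assert (Hp : (0 < Cmod x * exp (- Re z))%R).
  { apply Rmult_lt_0_compat; [now apply Cmod_gt_0|apply exp_pos]. }
  rewrite lamb_polar by exact Hx.
  unfold box_top, box_bot in Hz.
  destruct Hz as [Hz|Hz].
  - assert (E : (Im (Clog x) - Im z = - (2 * PI * INR K + PI / 2))%R) by lra.
    rewrite E, cos_neg, sin_neg.
    destruct (cos_sin_shift K (PI / 2)) as [-> ->].
    rewrite cos_PI2, sin_PI2.
    apply Cmod_le_of_parts; simpl Re; simpl Im.
    + right. rewrite Rmult_0_r, Rminus_0_l, Rabs_Ropp. reflexivity.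
    + rewrite (Rabs_pos_eq (Im z)) by nra.
      rewrite Rabs_left by nra. lra.
  - assert (E : (Im (Clog x) - Im z = 2 * PI * INR K + PI / 2)%R) by lra.
    rewrite E. destruct (cos_sin_shift K (PI / 2)) as [-> ->].
    rewrite cos_PI2, sin_PI2.
    apply Cmod_le_of_parts; simpl Re; simpl Im.
    + right. rewrite Rmult_0_r, Rminus_0_l, Rabs_Ropp. reflexivity.
    + rewrite (Rabs_left (Im z)) by nra.
      rewrite Rabs_pos_eq by nra. lra.
Qed.

Lemma exp_ge_sqr_quarter (y : R) : (0 <= y -> y ^ 2 / 4 <= exp y)%R.
Proof.
  intros H. replace (exp y) with (exp (y / 2) * exp (y / 2))%R
    by (rewrite <- exp_plus; f_equal; field).
  assert (K := exp_ineq1_le (y / 2)).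
  replace (y ^ 2 / 4)%R with (y / 2 * (y / 2))%R by field.
  apply Rmult_le_compat; lra.
Qed.

(** On the left edge [x e^{-z}] dominates [z], on the right edge it is the
    other way round. *)
Lemma lamb_vertical_edge (x z : C) (A : R) : x <> 0 ->
  (2 * Cmod x <= A)%R -> (16 / Cmod x <= A)%R -> (Rabs (Im z) <= A)%R ->
  Re z = A \/ Re z = (- A)%R -> (Cmod z / 2 <= Cmod (lamb x z))%R.
Proof.
  intros Hx H1 H2 Hi Hz.
  assert (Hm : (0 < Cmod x)%R) by now apply Cmod_gt_0.
  assert (He : Cmod (x * Cexp (- z)) = (Cmod x * exp (- Re z))%R)
    by (rewrite Cmod_mult, Cmod_Cexp; reflexivity).
  unfold lamb. destruct Hz as [Hz|Hz].
  - rewrite Cmod_sym.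
    assert (K := Cmod_triangle_sub z (x * Cexp (- z))).
    rewrite He, Hz in K.
    assert (exp (- A) <= 1)%R.
    { rewrite <- exp_0. destruct (Req_dec A 0) as [->|N];
        [rewrite Ropp_0; lra|left; apply exp_increasing; lra]. }
    assert (L := re_le_Cmod z). rewrite Hz, Rabs_pos_eq in L by lra.
    nra.
  - assert (K := Cmod_triangle_sub (x * Cexp (- z)) z).
    rewrite He, Hz, Ropp_involutive in K.
    assert (L := Cmod_le_abs z). rewrite Hz, Rabs_Ropp, Rabs_pos_eq in L by lra.
    assert (Q := exp_ge_sqr_quarter A ltac:(lra)).
    assert (A16 : (16 <= A * Cmod x)%R) by now apply Rle_div_l.
    assert (4 * A <= Cmod x * exp A)%R.
    { apply Rle_trans with (Cmod x * (A ^ 2 / 4))%R; [nra|].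
      apply Rmult_le_compat_l; lra. }
    lra.
Qed.

Lemma Im_sub (u v : C) : Im (u - v) = (Im u - Im v)%R.
Proof. reflexivity. Qed.

Lemma branch_sum_horizontal_edge (x z : C) (K : nat) :
  x <> 0 -> (1 <= K)%nat -> Im z = box_top x K \/ Im z = box_bot x K ->
  (Cmod (branch_sum x K z) <= 2 * sqrt (INR (2 * K) + 1))%R.
Proof.
  intros Hx HK Hz.
  eapply Rle_trans; [|apply sum_inv_sqrt_bound].
  assert (Hinv : forall j, (0 < INR j + 1)%R)
    by (intros j; generalize (pos_INR j); lra).
  unfold branch_sum. destruct Hz as [Hz|Hz].
  - rewrite <- (sum_n_rev (fun j => (/ (INR j + 1))%R)).
    apply Csum_bound. intros j Hj.
    destruct (branch_im_gap x K j Hx HK Hj) as [H _].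
    assert (L := im_le_Cmod (branch x K j - z)).
    replace (Im (branch x K j - z)) with (- (box_top x K - Im (branch x K j)))%R
      in L by (rewrite Im_sub, Hz; ring).
    assert (L0 := Hinv (2 * K - j)%nat).
    rewrite Rabs_Ropp, Rabs_pos_eq in L by lra.
    rewrite Cmod_inv by (apply Cmod_gt_0; lra).
    apply Rinv_le_contravar; lra.
  - apply Csum_bound. intros j Hj.
    destruct (branch_im_gap x K j Hx HK Hj) as [_ H].
    assert (L := im_le_Cmod (branch x K j - z)).
    replace (Im (branch x K j - z)) with (Im (branch x K j) - box_bot x K)%R
      in L by (rewrite Im_sub, Hz; ring).
    assert (L0 := Hinv j). rewrite Rabs_pos_eq in L by lra.
    rewrite Cmod_inv by (apply Cmod_gt_0; lra).
    apply Rinv_le_contravar; lra.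
Qed.

Lemma branch_sum_vertical_edge (x z : C) (K : nat) (A : R) :
  (forall j, (j <= 2 * K)%nat ->
     Cmod (branch x K j) + INR (2 * K) + 1 <= A)%R ->
  Re z = A \/ Re z = (- A)%R -> (Cmod (branch_sum x K z) <= 1)%R.
Proof.
  intros HA Hz.
  assert (HK := pos_INR (2 * K)).
  apply Rle_trans with (sum_n (fun _ => (/ (INR (2 * K) + 1))%R) (2 * K)).
  - apply Csum_bound. intros j Hj. specialize (HA j Hj).
    assert (L := Cmod_triangle_sub z (branch x K j)).
    rewrite Cmod_sym in L. assert (L' := re_le_Cmod z).
    assert (L0 := Cmod_ge_0 (branch x K j)).
    assert (Rabs (Re z) = A)
      by (destruct Hz as [-> | ->]; rewrite ?Rabs_Ropp, Rabs_pos_eq; lra).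
    rewrite Cmod_inv by (apply Cmod_gt_0; lra).
    apply Rinv_le_contravar; lra.
  - rewrite Rsum_const, S_INR. right; field; lra.
Qed.

Lemma branch_uniform_bound (x : C) (K : nat) : exists B, (0 <= B)%R /\
  forall j, (j <= 2 * K)%nat -> (Cmod (branch x K j) <= B)%R.
Proof.
  generalize (2 * K)%nat; intros n. induction n as [|n [B [HB0 HB]]].
  - exists (Cmod (branch x K 0)); split; [apply Cmod_ge_0|].
    intros j Hj; replace j with 0%nat by lia; lra.
  - exists (B + Cmod (branch x K (S n)))%R.
    assert (L := Cmod_ge_0 (branch x K (S n))).
    split; [lra|intros j Hj]. destruct (Nat.eq_dec j (S n)) as [->|N]; [lra|].
    generalize (HB j ltac:(lia)); lra.
Qed.

Definition defect_bound (K : nat) : R := (5 + 2 * sqrt (INR (2 * K) + 1))%R.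

Lemma defect_box (x : C) (K : nat) : x <> 0 -> (1 <= K)%nat ->
  exists A, (INR K <= A)%R /\
    holo_box (- A) A (box_bot x K) (box_top x K) (branches x K) (defect x K) /\
    (forall z, on_edge (- A) A (box_bot x K) (box_top x K) z ->
       (INR K <= Cmod z)%R /\ (Cmod (defect x K z) <= defect_bound K)%R) /\
    (forall t, (Cmod t <= INR K)%R ->
       in_box (- A) A (box_bot x K) (box_top x K) t).
Proof.
  intros Hx HK. assert (HP := PI_gt_3). assert (HP4 := PI_4).
  assert (Hm : (0 < Cmod x)%R) by now apply Cmod_gt_0.
  assert (HK1 : (1 <= INR K)%R) by now apply (le_INR 1).
  destruct (Cexp_log x Hx) as [_ Hphi].
  destruct (branch_uniform_bound x K) as [B [HB0 HB]].
  assert (Hx16 : (0 < 16 / Cmod x)%R) by (apply Rdiv_lt_0_compat; lra).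
  set (A := (2 * Cmod x + 16 / Cmod x + B + 2 * PI * INR K + 6
             + INR (2 * K) + 1)%R).
  assert (HK2 := pos_INR (2 * K)).
  assert (HPK : (3 * INR K <= PI * INR K)%R)
    by (apply Rmult_le_compat_r; lra).
  assert (HT : (INR K <= box_top x K <= A)%R) by (unfold box_top, A; lra).
  assert (HBt : (INR K <= - box_bot x K <= A)%R) by (unfold box_bot, A; lra).
  assert (HSq : (1 <= sqrt (INR (2 * K) + 1))%R).
  { rewrite <- sqrt_1 at 1. apply sqrt_le_1; lra. }
  exists A. split; [lra|split; [|split]].
  - split.
    + intros z [_ Hz] Hl.
      eexists _, _. apply jet2_defect; [exact Hx|].
      intros E. apply Hl. now apply zero_in_strip.
    + intros p Hp. now apply defect_bounded_near.
  - intros z [[Z1 Z2] Hz].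
    assert (LR := re_le_Cmod z). assert (LI := im_le_Cmod z).
    assert (Hi : (Rabs (Im z) <= A)%R) by (apply Rabs_le_between; lra).
    assert (Hedge : (Re z = A \/ Re z = - A)%R \/
                    (Im z = box_top x K \/ Im z = box_bot x K)) by tauto.
    assert (Hmod : (INR K <= Cmod z)%R).
    { destruct Hedge as [[E|E]|[E|E]]; rewrite E in LR || rewrite E in LI.
      - rewrite Rabs_pos_eq in LR by (unfold A; lra). lra.
      - rewrite Rabs_Ropp, Rabs_pos_eq in LR by lra. lra.
      - rewrite Rabs_pos_eq in LI by lra. lra.
      - rewrite Rabs_left in LI by lra. lra. }
    split; [exact Hmod|].
    assert (Hlamb : (Cmod z / 2 <= Cmod (lamb x z))%R).
    { destruct Hedge as [E|E].
      - apply lamb_vertical_edge with A; auto; unfold A; lra.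
      - generalize (lamb_horizontal_edge x z K Hx HK E); lra. }
    assert (Hsum : (Cmod (branch_sum x K z) <= 2 * sqrt (INR (2 * K) + 1))%R).
    { destruct Hedge as [E|E].
      - apply Rle_trans with 1%R; [|lra].
        apply branch_sum_vertical_edge with A; [|exact E].
        intros j Hj. generalize (HB j Hj). unfold A; lra.
      - now apply branch_sum_horizontal_edge. }
    unfold defect, defect_bound.
    eapply Rle_trans; [apply Cmod_sub_le|].
    apply Rplus_le_compat; [|exact Hsum].
    unfold lamb_sum. eapply Rle_trans; [apply Cmod_triangle|].
    rewrite Cmod_div by (apply Cmod_gt_0; lra).
    rewrite Cmod_inv, Cmod_R, (Rabs_pos_eq 2) by (lra || exact C2_neq_0).
    assert (H1 := Cmod_triangle 1 z). rewrite Cmod_1 in H1.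
    assert ((Cmod (1 + z) / Cmod (lamb x z) <= 4)%R).
    { apply (proj2 (Rle_div_l _ _ (Cmod (lamb x z)) ltac:(lra))). lra. }
    lra.
  - intros t Ht. assert (LR := re_le_Cmod t). assert (LI := im_le_Cmod t).
    assert (LR' : (Rabs (Re t) <= INR K)%R) by lra.
    assert (LI' : (Rabs (Im t) <= INR K)%R) by lra.
    apply Rabs_le_between in LR'. apply Rabs_le_between in LI'.
    unfold in_box; lra.
Qed.

(** The defect grows at most like [sqrt K] on a boundary at distance [K]:
    hence it is almost constant on bounded sets. *)
Lemma defect_estimates (x : C) (K : nat) (R0 : R) (t : C) :
  x <> 0 -> (1 <= K)%nat -> (2 * R0 <= INR K)%R ->
  (Cmod t <= R0)%R -> lamb x t <> 0 ->
  let eta := (4 * defect_bound K / INR K)%R in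
  (forall s, (Cmod s <= R0)%R -> lamb x s <> 0 ->
     (Cmod (defect x K s - defect x K t) <= Cmod (s - t) * eta)%R) /\
  (Cmod (lamb_sum_d1 x t
         - Csum (fun j => / (branch x K j - t) ^ 2) (2 * K))%C <= eta)%R /\
  (Cmod (lamb_sum_d2 x t
         - Csum (fun j => / (branch x K j - t) ^ 3) (2 * K))%C
     <= 4 * eta)%R.
Proof.
  intros Hx HK HR Ht Hlt eta.
  assert (HK1 : (1 <= INR K)%R) by now apply (le_INR 1).
  assert (Hpos : (0 < defect_bound K)%R).
  { unfold defect_bound. generalize (sqrt_pos (INR (2 * K) + 1)); lra. }
  destruct (defect_box x K Hx HK) as (A & HA & Hhol & Hedge & Hin).
  assert (Hbox := Hin 0). rewrite Cmod_0 in Hbox.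
  specialize (Hbox ltac:(lra)). unfold in_box in Hbox; simpl in Hbox.
  assert (Ht_in := Hin t ltac:(generalize (Cmod_ge_0 t); lra)).
  assert (Htl := lamb_neq_0_notin x K t Hx Hlt).
  assert (Hdist : forall z, on_edge (- A) A (box_bot x K) (box_top x K) z ->
            (INR K / 2 <= Cmod (z - t))%R).
  { intros z Hz.
    generalize (proj1 (Hedge z Hz)) (Cmod_triangle_sub z t); lra. }
  destruct (cauchy_estimates (- A) A (box_bot x K) (box_top x K)
    (defect_bound K) (INR K / 2) (branches x K) (defect x K) t _ _
    ltac:(lra) ltac:(lra) Hpos ltac:(lra) Hhol
    (fun z Hz _ => proj2 (Hedge z Hz)) Ht_in Htl Hdist (jet2_defect x t K Hx Hlt))
    as (E1 & E2 & E3).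
  replace (2 * defect_bound K / (INR K / 2))%R with eta in E1, E2
    by (unfold eta; field; lra).
  split; [|split; [exact E2|]].
  - intros s Hs Hls. apply E1; [|now apply lamb_neq_0_notin].
      apply Hin; generalize (Cmod_ge_0 s); lra.
  - eapply Rle_trans; [exact E3|].
      replace (4 * defect_bound K / (INR K / 2) ^ 2)%R
        with (4 * eta * / INR K)%R by (unfold eta; field; lra).
      rewrite <- (Rmult_1_r (4 * eta)) at 2.
      apply Rmult_le_compat_l.
      * unfold eta. apply Rmult_le_pos; [lra|].
        apply Rmult_le_pos; [lra|left; apply Rinv_0_lt_compat; lra].
      * rewrite <- Rinv_1. apply Rinv_le_contravar; lra.
Qed.

Lemma defect_bound_small (eps : R) : (0 < eps)%R ->
  exists K0, (1 <= K0)%nat /\ forall K, (K0 <= K)%nat ->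
    (4 * defect_bound K / INR K <= eps)%R.
Proof.
  intros He.
  destruct (archimed_cor1 (eps * eps / (16 * 100))%R) as [n [Hn Hn0]];
    [apply Rdiv_lt_0_compat; nra|].
  exists n; split; [lia|intros K HK].
  assert (Hnp : (0 < INR n)%R) by now apply lt_0_INR.
  assert (HKn : (INR n <= INR K)%R) by now apply le_INR.
  assert (HK1 : (1 <= INR K)%R) by (apply (le_INR 1); lia).
  apply (proj2 (Rle_div_l _ _ (INR K) ltac:(lra))).
  unfold defect_bound. rewrite mult_INR. change (INR 2) with 2%R.
  set (k := INR K) in *.
  assert (S0 : (1 <= sqrt k)%R).
  { rewrite <- sqrt_1 at 1. apply sqrt_le_1; lra. }
  assert (Sk : (sqrt k * sqrt k = k)%R) by (apply sqrt_sqrt; lra).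
  assert (S1 : (sqrt (2 * k + 1) <= 2 * sqrt k)%R).
  { apply Rle_trans with (sqrt ((2 * sqrt k) * (2 * sqrt k)));
      [apply sqrt_le_1; nra|right; apply sqrt_square; lra]. }
  assert (S2 : (40 <= eps * sqrt k)%R).
  { assert (Q : (16 * 100 <= eps * eps * k)%R).
    { apply Rle_trans with (eps * eps * INR n)%R;
        [|apply Rmult_le_compat_l; nra].
      apply Rmult_le_reg_r with (/ INR n)%R; [now apply Rinv_0_lt_compat|].
      replace (eps * eps * INR n * / INR n)%R with (eps * eps)%R
        by (field; lra). lra. }
    rewrite <- Sk in Q.
    assert (0 <= eps * sqrt k)%R by nra. nra. }
  nra.
Qed.

(** * The defect tends to zero *)

(** [Re w = ln |x| - ln |w|], and the logarithm grows more slowly than the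
    square root. *)
Lemma mul_Cexp_re_bound (x w : C) : x <> 0 -> w * Cexp w = x ->
  (Rabs (Re w) <= 2 * Rabs (ln (Cmod x)) + 6 + 4 * sqrt (Rabs (Im w)))%R.
Proof.
  intros Hx E.
  assert (Hw : w <> 0) by (intros ->; apply Hx; rewrite <- E; ring).
  assert (Hm : (0 < Cmod w)%R) by now apply Cmod_gt_0.
  assert (L : (ln (Cmod x) = ln (Cmod w) + Re w)%R).
  { rewrite <- E, Cmod_mult, Cmod_Cexp, ln_mult, ln_exp;
      [reflexivity|exact Hm|apply exp_pos]. }
  assert (A0 := Rabs_pos (ln (Cmod x))). assert (S0 := sqrt_pos (Rabs (Im w))).
  assert (LR := re_le_Cmod w).
  destruct (Rle_dec 1 (Cmod w)) as [H1|H1]; [|lra].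
  set (m := Cmod w) in *. set (lam := ln (Cmod x)) in *.
  assert (Sm : (0 < sqrt m)%R) by (apply sqrt_lt_R0; lra).
  assert (Hln : (0 <= ln m <= 2 * sqrt m)%R).
  { split; [rewrite <- ln_1; apply ln_le; lra|].
    assert (K : ln m = (ln (sqrt m) + ln (sqrt m))%R)
      by (rewrite <- ln_mult, sqrt_sqrt by lra; reflexivity).
    assert (Q : (ln (sqrt m) <= sqrt m - 1)%R).
    { generalize (exp_ineq1_le (ln (sqrt m))).
      rewrite exp_ln by exact Sm. lra. }
    lra. }
  assert (Ha : (Rabs (Re w) <= Rabs lam + 2 * sqrt m)%R).
  { replace (Re w) with (lam - ln m)%R by lra.
    eapply Rle_trans; [apply Rabs_triang|].
    rewrite Rabs_Ropp, (Rabs_pos_eq (ln m)) by lra. lra. }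
  assert (Hsq : (sqrt m <= sqrt (Rabs (Re w)) + sqrt (Rabs (Im w)))%R).
  { eapply Rle_trans; [apply sqrt_le_1_alt, Cmod_le_abs|].
    assert (P1 := Rabs_pos (Re w)). assert (P2 := Rabs_pos (Im w)).
    apply Rsqr_incr_0_var.
    - rewrite Rsqr_sqrt by lra. rewrite Rsqr_plus, !Rsqr_sqrt by lra.
      assert (0 <= 2 * sqrt (Rabs (Re w)) * sqrt (Rabs (Im w)))%R
        by (repeat apply Rmult_le_pos; try apply sqrt_pos; lra). lra.
    - generalize (sqrt_pos (Rabs (Re w))); lra. }
  assert (Hq : (2 * sqrt (Rabs (Re w)) <= Rabs (Re w) / 2 + 2)%R).
  { assert (P1 := Rabs_pos (Re w)).
    rewrite <- (sqrt_sqrt (Rabs (Re w))) at 2 by lra.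
    generalize (pow2_ge_0 (sqrt (Rabs (Re w)) - 2)); lra. }
  lra.
Qed.

Definition index_size (k : Z) : R := (1 + Rabs (IZR k))%R.

Lemma index_size_ge_1 (k : Z) : (1 <= index_size k)%R.
Proof. unfold index_size; generalize (Rabs_pos (IZR k)); lra. Qed.

Lemma index_size_opp (k : Z) : index_size (- k) = index_size k.
Proof. unfold index_size; now rewrite opp_IZR, Rabs_Ropp. Qed.

Lemma lambertW_re_bound (x : C) : x <> 0 -> exists C1, (1 <= C1)%R /\
  forall k, (Rabs (Re (lambertW k x)) <= C1 * sqrt (index_size k))%R.
Proof.
  intros Hx. assert (HP4 := PI_4).
  exists (2 * Rabs (ln (Cmod x)) + 18)%R.
  assert (A0 := Rabs_pos (ln (Cmod x))). split; [lra|intros k].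
  assert (H := mul_Cexp_re_bound x _ Hx (lambertW_eq k x Hx)).
  destruct (lambertW_im_bound k x Hx) as (Hi & _ & _).
  destruct (Cexp_log x Hx) as [_ Hphi].
  assert (Q1 := index_size_ge_1 k).
  assert (S1 : (1 <= sqrt (index_size k))%R)
    by (rewrite <- sqrt_1 at 1; apply sqrt_le_1; lra).
  assert (Him : (Rabs (Im (lambertW k x)) <= 9 * index_size k)%R).
  { apply Rabs_le_between in Hi. unfold index_size.
    assert (K1 := Rle_abs (IZR k)). assert (K2 := Rle_abs (- IZR k)).
    rewrite Rabs_Ropp in K2. apply Rabs_le_between. nra. }
  assert (Hs : (sqrt (Rabs (Im (lambertW k x))) <= 3 * sqrt (index_size k))%R).
  { eapply Rle_trans; [apply sqrt_le_1_alt, Him|].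
    rewrite sqrt_mult by lra. replace 9%R with (3 * 3)%R by ring.
    rewrite sqrt_square by lra. lra. }
  nra.
Qed.

(** In the sum of the two fractions, the numerator [lambertW k x + lambertW
    (- k) x] is only of order [sqrt |k|] since the leading terms [2 k i pi]
    cancel, while both factors of the denominator are at least of order [|k|
    + s]. *)
Lemma lambertW_pair_bound (x : C) : x <> 0 -> exists D s0, (0 < D)%R /\
  forall k s, (s0 <= s)%R -> (0 < s)%R ->
  (Cmod (/ (lambertW k x - RtoC s) + / (lambertW (- k) x - - RtoC s))%C
   <= D * / ((index_size k + s) * sqrt (index_size k + s)))%R.
Proof.
  intros Hx. assert (HP := PI_gt_3). assert (HP4 := PI_4).
  destruct (lambertW_re_bound x Hx) as [C1 [HC1 Hre]].
  destruct (Cexp_log x Hx) as [_ Hphi].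
  set (C2 := (2 * (C1 + 2))%R).
  exists ((2 * C1 + 16) * (C2 * C2))%R, (4 * (C1 + 1))%R.
  split; [unfold C2; nra|intros k s Hs Hs0].
  assert (Hlow : forall n sg, Rabs sg = s ->
    (index_size n + s <= C2 * Cmod (lambertW n x - RtoC sg))%R).
  { intros n sg Hsg. set (q := index_size n).
    assert (Q1 : (1 <= q)%R) by apply index_size_ge_1.
    assert (Sq : (0 <= sqrt q <= q)%R).
    { split; [apply sqrt_pos|]. rewrite <- (sqrt_sqrt q) at 2 by lra.
      assert (1 <= sqrt q)%R by (rewrite <- sqrt_1 at 1; apply sqrt_le_1; lra).
      nra. }
    set (Z := Cmod (lambertW n x - RtoC sg)).
    assert (Z1 : (Rabs (Im (lambertW n x)) <= Z)%R).
    { eapply Rle_trans; [|apply im_le_Cmod]. rewrite Im_sub. simpl (Im (RtoC sg)).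
      rewrite Rminus_0_r. lra. }
    assert (Z2 : (s - Rabs (Re (lambertW n x)) <= Z)%R).
    { eapply Rle_trans; [|apply re_le_Cmod].
      change (Re (lambertW n x - RtoC sg)) with (Re (lambertW n x) + - sg)%R.
      rewrite <- Hsg. generalize (Rabs_triang_inv sg (Re (lambertW n x))).
      rewrite (Rabs_minus_sym sg). unfold Rminus. lra. }
    destruct (lambertW_im_bound n x Hx) as (Hi & _ & _).
    assert (Z3 : (q <= 2 + Z)%R).
    { unfold q, index_size.
      assert (K : (2 * PI * Rabs (IZR n) <= Rabs (Im (lambertW n x)) + 2 * PI)%R).
      { apply Rabs_le_between in Hi.
        unfold Rabs; destruct (Rcase_abs (IZR n)), (Rcase_abs (Im (lambertW n x)));
          nra. }
      assert (Z0 : (0 <= Z)%R) by apply Cmod_ge_0.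
      assert (Z <= 2 * PI * Z)%R by nra.
      assert (Rabs (IZR n) <= Z + 1)%R;
        [apply Rmult_le_reg_l with (2 * PI)%R|]; lra. }
    specialize (Hre n). fold q in Hre. unfold C2.
    nra. }
  set (q := index_size k) in *.
  assert (Q1 : (1 <= q)%R) by apply index_size_ge_1.
  set (y := (q + s)%R).
  assert (HC2 : (0 < C2)%R) by (unfold C2; lra).
  assert (L1 : (y / C2 <= Cmod (lambertW k x - RtoC s))%R).
  { apply Rle_div_l; [exact HC2|]. rewrite Rmult_comm.
    apply Hlow. apply Rabs_pos_eq; lra. }
  assert (L2 : (y / C2 <= Cmod (lambertW (- k) x - - RtoC s))%R).
  { apply Rle_div_l; [exact HC2|]. rewrite Rmult_comm.
    unfold y, q. rewrite <- (index_size_opp k), <- RtoC_opp.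
    apply Hlow. rewrite Rabs_Ropp; apply Rabs_pos_eq; lra. }
  assert (Hyc : (0 < y / C2)%R) by (apply Rdiv_lt_0_compat; unfold y; lra).
  assert (Hsum : (Cmod (lambertW k x + lambertW (- k) x)
                  <= (2 * C1 + 16) * sqrt y)%R).
  { eapply Rle_trans; [apply Cmod_le_abs|].
    assert (R1 := Hre k). assert (R2 := Hre (- k)%Z).
    rewrite index_size_opp in R2. fold q in R1, R2.
    destruct (lambertW_im_bound k x Hx) as (I1 & _ & _).
    destruct (lambertW_im_bound (- k) x Hx) as (I2 & _ & _).
    rewrite opp_IZR in I2.
    apply Rabs_le_between in I1. apply Rabs_le_between in I2.
    assert (I3 : (Rabs (Im (lambertW k x + lambertW (- k) x)) <= 4 * PI)%R).
    { change (Im (lambertW k x + lambertW (- k) x))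
        with (Im (lambertW k x) + Im (lambertW (- k) x))%R.
      apply Rabs_le_between; lra. }
    assert (R3 : (Rabs (Re (lambertW k x + lambertW (- k) x))
                  <= 2 * C1 * sqrt q)%R).
    { change (Re (lambertW k x + lambertW (- k) x))
        with (Re (lambertW k x) + Re (lambertW (- k) x))%R.
      eapply Rle_trans; [apply Rabs_triang|]. lra. }
    assert (Sq : (sqrt q <= sqrt y)%R) by (apply sqrt_le_1_alt; unfold y; lra).
    assert (S1 : (1 <= sqrt q)%R)
      by (rewrite <- sqrt_1 at 1; apply sqrt_le_1; lra).
    nra. }
  assert (N1 : lambertW k x - RtoC s <> 0) by (apply Cmod_gt_0; lra).
  assert (N2 : lambertW (- k) x - - RtoC s <> 0) by (apply Cmod_gt_0; lra).
  replace (/ (lambertW k x - RtoC s) + / (lambertW (- k) x - - RtoC s))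
    with ((lambertW k x + lambertW (- k) x)
          / ((lambertW k x - RtoC s) * (lambertW (- k) x - - RtoC s)))
    by (field; auto).
  rewrite Cmod_div, Cmod_mult by now apply Cmult_neq_0.
  assert (Hy : (0 < y)%R) by (unfold y; lra).
  assert (Sy : (0 < sqrt y)%R) by (apply sqrt_lt_R0; lra).
  assert (Sy2 : (sqrt y * sqrt y = y)%R) by (apply sqrt_sqrt; lra).
  apply Rle_trans with ((2 * C1 + 16) * sqrt y / (y / C2 * (y / C2)))%R.
  - unfold Rdiv at 1 2. apply Rmult_le_compat; try apply Cmod_ge_0; auto.
    + left; apply Rinv_0_lt_compat, Rmult_lt_0_compat; lra.
    + apply Rinv_le_contravar; [nra|].
      apply Rmult_le_compat; lra.
  - right. apply Rmult_eq_reg_r with (sqrt y)%R; [|lra].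
    replace ((2 * C1 + 16) * sqrt y / (y / C2 * (y / C2)) * sqrt y)%R
      with ((2 * C1 + 16) * (C2 * C2) * (sqrt y * sqrt y) / (y * y))%R
      by (field; lra).
    rewrite Sy2. field. lra.
Qed.

(** By comparison with a telescoping sum. *)
Lemma sum_three_halves_bound (s : R) (n : nat) : (0 < s)%R ->
  (sum_n (fun j => / ((1 + INR j + s) * sqrt (1 + INR j + s))) n
   <= 2 * / sqrt s - 2 * / sqrt (1 + INR n + s))%R.
Proof.
  intros Hs.
  assert (Hstep : forall y, (1 < y)%R ->
    (/ (y * sqrt y) <= 2 * / sqrt (y - 1) - 2 * / sqrt y)%R).
  { intros y Hy.
    assert (P : (0 < sqrt (y - 1))%R) by (apply sqrt_lt_R0; lra).
    assert (P2 : (sqrt (y - 1) * sqrt (y - 1) = y - 1)%R)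
      by (apply sqrt_sqrt; lra).
    assert (Q2 : (sqrt y * sqrt y = y)%R) by (apply sqrt_sqrt; lra).
    assert (PQ : (sqrt (y - 1) < sqrt y)%R) by (apply sqrt_lt_1; lra).
    set (p := sqrt (y - 1)) in *. set (q := sqrt y) in *.
    replace (2 * / p - 2 * / q)%R with (2 * (q - p) / (p * q))%R
      by (field; lra).
    assert (E : ((q - p) * (q + p) = 1)%R) by nra.
    replace (2 * (q - p) / (p * q))%R
      with (2 * ((q - p) * (q + p)) / (p * q * (q + p)))%R by (field; lra).
    rewrite E, Rmult_1_r.
    replace (2 / (p * q * (q + p)))%R with (/ (p * q * (q + p) / 2))%R
      by (field; lra).
    apply Rinv_le_contravar; [|nra].
    apply Rdiv_lt_0_compat; [|lra]. repeat apply Rmult_lt_0_compat; lra. }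
  induction n as [|n IH].
  - rewrite sum_O. simpl INR. rewrite Rplus_0_r.
    replace s with (1 + s - 1)%R at 3 by ring. apply Hstep; lra.
  - rewrite sum_Sn, S_INR.
    assert (N := pos_INR n).
    assert (K := Hstep (1 + (INR n + 1) + s)%R ltac:(lra)).
    replace (1 + (INR n + 1) + s - 1)%R with (1 + INR n + s)%R in K by ring.
    eapply Rle_trans; [apply Rplus_le_compat; [exact IH|exact K]|]. lra.
Qed.

Lemma sum_abs_index_bound (f : nat -> R) (K m : nat) : (0 <= f 0%nat)%R ->
  (sum_n (fun j => f (Z.abs_nat (Z.of_nat j - Z.of_nat K))) (K + m)
   <= sum_n f K + sum_n f m)%R.
Proof.
  intros H0. induction m as [|m IH].
  - rewrite Nat.add_0_r, sum_O.
    rewrite (sum_n_ext_loc _ (fun j => f (K - j)%nat)).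
    + rewrite sum_n_rev. lra.
    + intros j Hj. f_equal. lia.
  - rewrite Nat.add_succ_r, !sum_Sn.
    replace (Z.abs_nat (Z.of_nat (S (K + m)) - Z.of_nat K)) with (S m) by lia.
    unfold plus; simpl. lra.
Qed.

(** The term of index [k] at [s] is paired with that of index [- k] at [-
    s]. *)
Lemma branch_sum_odd_part (x : C) (eps : R) : x <> 0 -> (0 < eps)%R ->
  exists s0, forall s K, (s0 <= s)%R -> (0 < s)%R ->
  (Cmod (branch_sum x K (RtoC s) + branch_sum x K (- RtoC s)) <= eps)%R.
Proof.
  intros Hx He.
  destruct (lambertW_pair_bound x Hx) as (D & s1 & HD & H).
  exists (Rmax s1 (16 * (D / eps) * (D / eps)))%R.
  intros s K Hs Hs0.
  assert (Hs1 := Rle_trans _ _ _ (Rmax_l _ _) Hs).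
  assert (Hs2 := Rle_trans _ _ _ (Rmax_r _ _) Hs).
  unfold branch_sum.
  rewrite <- (sum_n_rev (fun j => / (branch x K j - - RtoC s))).
  change (Cplus ?a ?b) with (plus (a : C_AbelianMonoid) b).
  rewrite <- sum_n_plus.
  set (f := fun n => (D * / ((1 + INR n + s) * sqrt (1 + INR n + s)))%R).
  eapply Rle_trans.
  { apply Csum_bound with
      (v := fun j => f (Z.abs_nat (Z.of_nat j - Z.of_nat K))).
    intros j Hj. unfold f, branch.
    replace (Z.of_nat (2 * K - j) - Z.of_nat K)%Z
      with (- (Z.of_nat j - Z.of_nat K))%Z by lia.
    replace (INR (Z.abs_nat (Z.of_nat j - Z.of_nat K)))
      with (Rabs (IZR (Z.of_nat j - Z.of_nat K)))
      by (rewrite INR_IZR_INZ, Nat2Z.inj_abs_nat, abs_IZR; reflexivity).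
    now apply H. }
  assert (Ss : (0 < sqrt s)%R) by (apply sqrt_lt_R0; lra).
  assert (Hf : forall n, (sum_n f n <= D * (2 * / sqrt s))%R).
  { intros n.
    assert (E : sum_n f n = (D * sum_n (fun j =>
       / ((1 + INR j + s) * sqrt (1 + INR j + s))) n)%R)
      by apply (sum_n_mult_l (K := R_Ring)).
    rewrite E.
    apply Rmult_le_compat_l; [lra|].
    eapply Rle_trans; [apply sum_three_halves_bound, Hs0|].
    assert (P : (0 < sqrt (1 + INR n + s))%R)
      by (apply sqrt_lt_R0; generalize (pos_INR n); lra).
    apply Rinv_0_lt_compat in P. lra. }
  replace (2 * K)%nat with (K + K)%nat by lia.
  eapply Rle_trans; [apply sum_abs_index_bound|].
  { unfold f. simpl INR. apply Rmult_le_pos; [lra|].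
    left; apply Rinv_0_lt_compat, Rmult_lt_0_compat; [lra|].
    apply sqrt_lt_R0; lra. }
  assert (Hfin : (4 * (D / eps) <= sqrt s)%R).
  { assert (P : (0 < D / eps)%R) by now apply Rdiv_lt_0_compat.
    rewrite <- (sqrt_square (4 * (D / eps))) by lra.
    apply sqrt_le_1_alt. lra. }
  generalize (Hf K); intros HfK.
  assert (D * (2 * / sqrt s) <= eps / 2)%R; [|lra].
  apply Rmult_le_reg_r with (sqrt s); [exact Ss|].
  replace (D * (2 * / sqrt s) * sqrt s)%R with (eps / 2 * (4 * (D / eps)))%R
    by (field; lra).
  apply Rmult_le_compat_l; lra.
Qed.

(** [lamb_sum x] tends to [-1/2] at [+oo] and to [1/2] at [-oo]. *)
Lemma lamb_sum_odd_part (x : C) (eps : R) : x <> 0 -> (0 < eps)%R ->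
  exists s0, forall s, (s0 <= s)%R -> (0 < s)%R ->
  lamb x (RtoC s) <> 0 /\ lamb x (- RtoC s) <> 0 /\
  (Cmod (lamb_sum x (RtoC s) + lamb_sum x (- RtoC s)) <= eps)%R.
Proof.
  intros Hx He.
  assert (Hm : (0 < Cmod x)%R) by now apply Cmod_gt_0.
  set (m := Cmod x) in *.
  exists (Rmax (Rmax 1 (m + 2 * (1 + m) / eps)) (4 * (1 + 4 / eps) / m))%R.
  intros s Hs Hs0.
  assert (Hs1 := Rle_trans _ _ _ (Rmax_l _ _) Hs).
  assert (Hs2 := Rle_trans _ _ _ (Rmax_r _ _) Hs).
  assert (Hs3 := Rle_trans _ _ _ (Rmax_l _ _) Hs1).
  assert (Hs4 := Rle_trans _ _ _ (Rmax_r _ _) Hs1).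
  assert (He1 : (0 < 2 * (1 + m) / eps)%R) by (apply Rdiv_lt_0_compat; lra).
  assert (Hs5 : (4 * (1 + 4 / eps) <= s * m)%R) by now apply Rle_div_l.
  assert (Hs6 : (2 * (1 + m) <= eps * (s - m))%R).
  { rewrite (Rmult_comm eps). apply (proj1 (Rle_div_l _ _ _ He)). lra. }
  assert (Es : Cmod (RtoC s) = s) by (rewrite Cmod_R; apply Rabs_pos_eq; lra).
  assert (Exm : (Cmod (x * Cexp (- RtoC s)) <= m)%R).
  { rewrite Cmod_mult, Cmod_Cexp. fold m. simpl.
    assert (exp (- s) <= 1)%R
      by (rewrite <- exp_0; left; apply exp_increasing; lra).
    nra. }
  assert (L1 : (s - m <= Cmod (lamb x (RtoC s)))%R).
  { unfold lamb. rewrite Cmod_sym.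
    generalize (Cmod_triangle_sub (RtoC s) (x * Cexp (- RtoC s))). lra. }
  assert (L2 : (s * (4 / eps) <= Cmod (lamb x (- RtoC s)))%R).
  { unfold lamb. replace (- - RtoC s) with (RtoC s) by ring.
    generalize (Cmod_triangle_sub (x * Cexp (RtoC s)) (- RtoC s)).
    rewrite Cmod_opp, Es, Cmod_mult, Cmod_Cexp. fold m. simpl.
    assert (Q := exp_ge_sqr_quarter s ltac:(lra)).
    simpl in *. nra. }
  assert (N1 : lamb x (RtoC s) <> 0) by (apply Cmod_gt_0; lra).
  assert (N2 : lamb x (- RtoC s) <> 0) by (apply Cmod_gt_0; nra).
  split; [exact N1|split; [exact N2|]].
  replace (lamb_sum x (RtoC s) + lamb_sum x (- RtoC s)) with
    ((1 + x * Cexp (- RtoC s)) / lamb x (RtoC s)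
     + (1 - RtoC s) / lamb x (- RtoC s)).
  2: { unfold lamb_sum.
       replace (1 + x * Cexp (- RtoC s)) with (lamb x (RtoC s) + (1 + RtoC s))
         by (unfold lamb; ring).
       field. repeat split; auto using C2_neq_0. }
  eapply Rle_trans; [apply Cmod_triangle|].
  rewrite !Cmod_div by assumption.
  assert (T1 : (Cmod (1 + x * Cexp (- RtoC s)) / Cmod (lamb x (RtoC s))
                <= eps / 2)%R).
  { apply (proj2 (Rle_div_l _ _ (Cmod (lamb x (RtoC s))) ltac:(lra))).
    assert (K := Cmod_triangle 1 (x * Cexp (- RtoC s))).
    rewrite Cmod_1 in K. nra. }
  assert (T2 : (Cmod (1 - RtoC s) / Cmod (lamb x (- RtoC s)) <= eps / 2)%R).
  { apply (proj2 (Rle_div_l _ _ (Cmod (lamb x (- RtoC s))) ltac:(nra))).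
    assert (K := Cmod_sub_le 1 (RtoC s)). rewrite Cmod_1, Es in K.
    apply Rle_trans with (eps / 2 * (s * (4 / eps)))%R.
    - replace (eps / 2 * (s * (4 / eps)))%R with (2 * s)%R by (field; lra). lra.
    - apply Rmult_le_compat_l; lra. }
  lra.
Qed.

(** The Cauchy estimates leave a constant undetermined; it tends to [0] because the
    defect is almost odd far away on the real axis. *)
Theorem defect_tends_to_0 (x : C) (R0 eps : R) : x <> 0 -> (0 < eps)%R ->
  exists K0, (1 <= K0)%nat /\ forall K t, (K0 <= K)%nat ->
    (Cmod t <= R0)%R -> lamb x t <> 0 -> (Cmod (defect x K t) <= eps)%R.
Proof.
  intros Hx He.
  destruct (branch_sum_odd_part x (eps / 2) Hx ltac:(lra)) as [s1 H1].
  destruct (lamb_sum_odd_part x (eps / 2) Hx ltac:(lra)) as [s2 H2].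
  set (s := Rmax 1 (Rmax s1 s2)).
  assert (S1 : (1 <= s)%R) by apply Rmax_l.
  assert (S2 : (s1 <= s)%R) by
    (eapply Rle_trans; [apply Rmax_l|apply Rmax_r]).
  assert (S3 : (s2 <= s)%R) by
    (eapply Rle_trans; [apply Rmax_r|apply Rmax_r]).
  set (R1 := Rmax R0 s).
  assert (R01 : (R0 <= R1)%R) by apply Rmax_l.
  assert (Rs1 : (s <= R1)%R) by apply Rmax_r.
  destruct (defect_bound_small (eps / (4 * R1))) as [K1 [HK1 HK]];
    [apply Rdiv_lt_0_compat; lra|].
  destruct (INR_unbounded (2 * R1)) as [K2 HK2].
  exists (Nat.max K1 K2). split; [lia|intros K t HKK Ht Hlt].
  specialize (HK K ltac:(lia)).
  assert (HKR : (2 * R1 <= INR K)%R).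
  { assert (INR K2 <= INR K)%R by (apply le_INR; lia). lra. }
  destruct (H2 s S3 ltac:(lra)) as (N1 & N2 & Hl).
  specialize (H1 s K S2 ltac:(lra)).
  destruct (defect_estimates x K R1 t Hx ltac:(lia) HKR ltac:(lra) Hlt)
    as [He1 _].
  assert (Es : Cmod (RtoC s) = s) by (rewrite Cmod_R; apply Rabs_pos_eq; lra).
  assert (D1 := He1 (RtoC s) ltac:(lra) N1).
  assert (D2 := He1 (- RtoC s) ltac:(rewrite Cmod_opp; lra) N2).
  set (eta := (4 * defect_bound K / INR K)%R) in *.
  assert (Heta0 : (0 <= eta)%R).
  { unfold eta. assert (0 < INR K)%R by lra.
    apply Rmult_le_pos; [|left; now apply Rinv_0_lt_compat].
    unfold defect_bound. generalize (sqrt_pos (INR (2 * K) + 1)); lra. }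
  assert (Heta : (4 * R1 * eta <= eps)%R).
  { apply Rle_trans with (4 * R1 * (eps / (4 * R1)))%R.
    - apply Rmult_le_compat_l; lra.
    - right; field; lra. }
  assert (B1 : (Cmod (RtoC s - t) * eta <= 2 * R1 * eta)%R).
  { apply Rmult_le_compat_r; [exact Heta0|].
    generalize (Cmod_sub_le (RtoC s) t); lra. }
  assert (B2 : (Cmod (- RtoC s - t) * eta <= 2 * R1 * eta)%R).
  { apply Rmult_le_compat_r; [exact Heta0|].
    generalize (Cmod_sub_le (- RtoC s) t). rewrite Cmod_opp. lra. }
  assert (D3 : (Cmod (defect x K (RtoC s) + defect x K (- RtoC s)) <= eps)%R).
  { unfold defect.
    assert (E : forall a b c d : C, a - b + (c - d) = (a + c) - (b + d))
      by (intros; ring).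
    rewrite E. eapply Rle_trans; [apply Cmod_sub_le|]. lra. }
  assert (E : 2 * defect x K t =
    (defect x K (RtoC s) + defect x K (- RtoC s))
    - ((defect x K (RtoC s) - defect x K t)
       + (defect x K (- RtoC s) - defect x K t))) by ring.
  assert (F : (2 * Cmod (defect x K t) <= 2 * eps)%R).
  { replace (2 * Cmod (defect x K t))%R with (Cmod (2 * defect x K t)).
    - rewrite E. eapply Rle_trans; [apply Cmod_sub_le|].
      generalize (Cmod_triangle (defect x K (RtoC s) - defect x K t)
                    (defect x K (- RtoC s) - defect x K t)). lra.
    - rewrite Cmod_mult, Cmod_R, Rabs_pos_eq; lra. }
  lra.
Qed.

(** * Bilateral sums *)

(** [is_sum_Z] in terms of the modulus, instead of the square neighbourhoods
    of the product topology. *)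
Definition sum_to (a : Z -> C) (s : C) : Prop :=
  forall eps, (0 < eps)%R -> exists K0, forall K, (K0 <= K)%nat ->
    (Cmod (s - Csum (fun j => a (Z.of_nat j - Z.of_nat K)%Z) (2 * K))%C
     <= eps)%R.

Lemma filterlim_C_of_Cmod (u : nat -> C) (s : C) :
  (forall eps, (0 < eps)%R -> exists K0, forall K, (K0 <= K)%nat ->
     (Cmod (s - u K) <= eps)%R) ->
  filterlim u eventually (locally s).
Proof.
  intros H. apply (proj2 (filterlim_locally (U := C_UniformSpace) u s)).
  intros eps. assert (He := cond_pos eps).
  destruct (H (eps / 2)%R) as [K0 HK]; [lra|].
  exists K0; intros K HKK. apply C_NormedModule_mixin_compat1.
  specialize (HK K HKK). rewrite Cmod_sym in HK.
  change (Cmod (u K - s) < eps)%R. lra.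
Qed.

Lemma sum_to_is_sum_Z (a : Z -> C) (s : C) : sum_to a s -> is_sum_Z a s.
Proof. intros H. now apply filterlim_C_of_Cmod. Qed.

Lemma sum_to_ext (a b : Z -> C) (s s' : C) :
  (forall k, a k = b k) -> s = s' -> sum_to a s -> sum_to b s'.
Proof.
  intros H <- Ha eps He. destruct (Ha eps He) as [K0 HK].
  exists K0; intros K HKK. specialize (HK K HKK).
  rewrite (sum_n_ext _ (fun j => a (Z.of_nat j - Z.of_nat K)%Z)); [exact HK|].
  intros; now rewrite H.
Qed.

Lemma Csum_scal (c : C) (u : nat -> C) (n : nat) :
  Csum (fun j => c * u j) n = c * Csum u n.
Proof.
  induction n as [|n IH].
  - rewrite !sum_O. reflexivity.
  - rewrite !Csum_Sn, IH. eq_in_C. ring.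
Qed.

Lemma Csum_plus (u v : nat -> C) (n : nat) :
  Csum (fun j => u j + v j) n = Csum u n + Csum v n.
Proof.
  induction n as [|n IH].
  - rewrite !sum_O. reflexivity.
  - rewrite !Csum_Sn, IH. eq_in_C. ring.
Qed.

Lemma sum_to_scal (c : C) (a : Z -> C) (s : C) :
  sum_to a s -> sum_to (fun k => c * a k) (c * s).
Proof.
  intros Ha eps He. assert (Hc := Cmod_ge_0 c).
  destruct (Ha (eps / (1 + Cmod c))%R) as [K0 HK];
    [apply Rdiv_lt_0_compat; lra|].
  exists K0; intros K HKK. specialize (HK K HKK).
  rewrite (Csum_scal c (fun j => a (Z.of_nat j - Z.of_nat K)%Z)).
  assert (E : forall u v : C, c * u - c * v = c * (u - v)) by (intros; ring).
  rewrite E, Cmod_mult.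
  apply Rle_trans with (Cmod c * (eps / (1 + Cmod c)))%R.
  - apply Rmult_le_compat_l; assumption.
  - apply Rmult_le_reg_r with (1 + Cmod c)%R; [lra|].
    replace (Cmod c * (eps / (1 + Cmod c)) * (1 + Cmod c))%R
      with (Cmod c * eps)%R by (field; lra). lra.
Qed.

Lemma sum_to_plus (a b : Z -> C) (s s' : C) :
  sum_to a s -> sum_to b s' -> sum_to (fun k => a k + b k) (s + s').
Proof.
  intros Ha Hb eps He.
  destruct (Ha (eps / 2)%R) as [K1 H1]; [lra|].
  destruct (Hb (eps / 2)%R) as [K2 H2]; [lra|].
  exists (Nat.max K1 K2); intros K HKK.
  specialize (H1 K ltac:(lia)). specialize (H2 K ltac:(lia)).
  rewrite (Csum_plus (fun j => a (Z.of_nat j - Z.of_nat K)%Z)).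
  assert (E : forall u v w z : C, (u + v) - (w + z) = (u - w) + (v - z))
    by (intros; ring).
  rewrite E. eapply Rle_trans; [apply Cmod_triangle|]. lra.
Qed.

Lemma sum_to_minus (a b : Z -> C) (s s' : C) :
  sum_to a s -> sum_to b s' -> sum_to (fun k => a k - b k) (s - s').
Proof.
  intros Ha Hb.
  apply sum_to_ext with (fun k => a k + (-(1)) * b k) (s + (-(1)) * s');
    [intros; ring|ring|].
  apply sum_to_plus; [exact Ha|now apply sum_to_scal].
Qed.

Lemma lambertW_sum_inv (x t : C) (hx : x <> 0) (ht : forall k, t <> lambertW k x) :
  sum_to (fun k => / (lambertW k x - t)) (lamb_sum x t).
Proof.
  intros eps He.
  destruct (defect_tends_to_0 x (Cmod t) eps hx He) as [K0 [_ HK]].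
  exists K0; intros K HKK. apply (HK K t HKK); [lra|].
  now apply lamb_neq_0.
Qed.

(** The coefficients of the expansion of the defect at [t] are the
    differences of the two sides. *)
Lemma lambertW_sum_inv_powers (x t : C) (hx : x <> 0) (ht : forall k, t <> lambertW k x) :
  sum_to (fun k => / (lambertW k x - t) ^ 2) (lamb_sum_d1 x t) /\
  sum_to (fun k => / (lambertW k x - t) ^ 3) (lamb_sum_d2 x t).
Proof.
  assert (Hl := lamb_neq_0 x t hx ht).
  destruct (INR_unbounded (2 * Cmod t)) as [K2 HK2].
  split; intros eps He;
    destruct (defect_bound_small (eps / 4) ltac:(lra)) as [K1 [HK1 HK]];
    exists (Nat.max K1 K2); intros K HKK; specialize (HK K ltac:(lia));
    assert (HKI : (INR K2 <= INR K)%R) by (apply le_INR; lia);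
    destruct (defect_estimates x K (Cmod t) t hx ltac:(lia) ltac:(lra)
      ltac:(lra) Hl) as (_ & H2 & H3);
    [eapply Rle_trans; [exact H2|]|eapply Rle_trans; [exact H3|]]; lra.
Qed.

(** * The product *)

Lemma cont_comp (f g : C -> C) (z : C) :
  cont g z -> cont f (g z) -> cont (fun w => f (g w)) z.
Proof.
  intros Hg Hf e He. destruct (Hf e He) as [d [Hd H]].
  destruct (Hg d Hd) as [d' [Hd' H']].
  exists d'; split; [exact Hd'|intros w Hw]. now apply H, H'.
Qed.

Lemma jet2_comp (f g : C -> C) (z a b a' b' : C) :
  jet2 g z a' b' -> jet2 f (g z) a b ->
  jet2 (fun w => f (g w)) z (a * a') (b * (a' * a') + a * b').
Proof.
  intros Hg Hf. assert (Cg := jet2_cont _ _ _ _ Hg).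
  destruct Hg as (u & Hu & Hub & r & Hr & H).
  destruct Hf as (v & Hv & Hvb & s & Hs & H').
  destruct (Cg s Hs) as [d [Hd Hgd]].
  exists (fun w => u w * a
     + (a' + (w - z) * u w) * (a' + (w - z) * u w) * v (g w)).
  split; [|split].
  - assert (Cv : cont (fun w => v (g w)) z) by now apply cont_comp.
    cont_tac.
  - cbv beta. rewrite Hub, Hvb. ring.
  - exists (Rmin r d); split; [now apply Rmin_pos|intros w Hw].
    assert (Hw1 := lt_Rmin_l Hw).
    assert (Hw2 := lt_Rmin_r Hw).
    rewrite (H' (g w) (Hgd w Hw2)) at 1.
    assert (E : g w - g z = (w - z) * (a' + (w - z) * u w))
      by (rewrite (H w Hw1); ring).
    rewrite E. ring.
Qed.

Lemma jet2_real_derive (f : C -> C) (s : R) (a b : C) :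
  jet2 f (RtoC s) a b ->
  is_derive (fun y => Re (f (RtoC y))) s (Re a) /\
  is_derive (fun y => Im (f (RtoC y))) s (Im a).
Proof.
  intros (g & Hg & Hb & r & Hr & H).
  assert (C1 : cont (fun w => (w - RtoC s) * g w) (RtoC s)) by cont_tac.
  assert (Hlim : forall eps, (0 < eps)%R -> exists d, (0 < d)%R /\
    forall h, h <> 0%R -> (Rabs h < d)%R ->
    (Cmod ((f (RtoC (s + h)) - f (RtoC s)) / RtoC h - a)%C < eps)%R).
  { intros e He. destruct (C1 e He) as [d [Hd Hdd]].
    exists (Rmin d r); split; [now apply Rmin_pos|intros h Hh0 Hh].
    assert (E : RtoC (s + h) - RtoC s = RtoC h)
      by (rewrite RtoC_plus; ring).
    assert (Eh : Cmod (RtoC (s + h) - RtoC s) = Rabs h)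
      by (rewrite E; apply Cmod_R).
    assert (K := Hdd (RtoC (s + h))).
    rewrite Eh in K. specialize (K (lt_Rmin_l Hh)).
    rewrite (H (RtoC (s + h))), E.
    - rewrite E in K.
      replace ((f (RtoC s) + RtoC h * (a + RtoC h * g (RtoC (s + h)))
                - f (RtoC s)) / RtoC h - a)
        with (RtoC h * g (RtoC (s + h)) - (RtoC s - RtoC s) * g (RtoC s)).
      + exact K.
      + field. intros F; injection F; intros; lra.
    - rewrite Eh. apply (lt_Rmin_r Hh). }
  assert (Hre : forall (u v w : C) h, h <> 0%R ->
    ((Re u - Re v) / h - Re w)%R = Re ((u - v) / RtoC h - w) /\
    ((Im u - Im v) / h - Im w)%R = Im ((u - v) / RtoC h - w)).
  { intros [u1 u2] [v1 v2] [w1 w2] h Hh. simpl. split; field; lra. }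
  split; apply is_derive_Reals; intros e He;
    destruct (Hlim e He) as [d [Hd Hdd]];
    exists (mkposreal d Hd); simpl; intros h Hh0 Hh;
    specialize (Hdd h Hh0 Hh);
    destruct (Hre (f (RtoC (s + h))) (f (RtoC s)) a h Hh0) as [E1 E2].
  - rewrite E1. eapply Rle_lt_trans; [apply re_le_Cmod|exact Hdd].
  - rewrite E2. eapply Rle_lt_trans; [apply im_le_Cmod|exact Hdd].
Qed.

Lemma mean_value_bound (u u' : R -> R) (B s1 s2 : R) :
  (0 <= s1 <= 1)%R -> (0 <= s2 <= 1)%R ->
  (forall s, (0 <= s <= 1)%R -> is_derive u s (u' s)) ->
  (forall s, (0 <= s <= 1)%R -> (Rabs (u' s) <= B)%R) ->
  (Rabs (u s2 - u s1) <= B)%R.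
Proof.
  intros H1 H2 Hd Hb.
  assert (HR : forall y, (Rmin s1 s2 <= y <= Rmax s1 s2)%R -> (0 <= y <= 1)%R).
  { intros y. unfold Rmin, Rmax; destruct (Rle_dec s1 s2); lra. }
  destruct (MVT_gen u s1 s2 u') as [c [Hc E]].
  - intros y Hy. apply Hd, HR; lra.
  - intros y Hy. apply derivable_continuous_pt. eexists.
    apply is_derive_Reals, Hd, HR, Hy.
  - rewrite E, Rabs_mult.
    assert (K := Hb c (HR c Hc)). assert (K0 := Rabs_pos (u' c)).
    assert (Rabs (s2 - s1) <= 1)%R by (apply Rabs_le_between; lra).
    nra.
Qed.

(** The maximum [m] of the modulus of [f] on [0,1] satisfies [m <= 1 + 2 m
    eta], hence [m <= 2]. *)
Lemma small_log_derivative (f d : C -> C) (eta : R) :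
  f 0 = 1 -> (0 <= eta <= / 4)%R ->
  (forall s, (0 <= s <= 1)%R ->
     exists b, jet2 f (RtoC s) (f (RtoC s) * d (RtoC s)) b) ->
  (forall s, (0 <= s <= 1)%R -> (Cmod (d (RtoC s)) <= eta)%R) ->
  (Cmod (f 1 - 1) <= 4 * eta)%R.
Proof.
  intros H0 Heta Hj Hd.
  set (a := fun s : R => f (RtoC s) * d (RtoC s)).
  assert (Hder : forall s, (0 <= s <= 1)%R ->
    is_derive (fun y => Re (f (RtoC y))) s (Re (a s)) /\
    is_derive (fun y => Im (f (RtoC y))) s (Im (a s))).
  { intros s Hs. destruct (Hj s Hs) as [b Hb].
    now apply jet2_real_derive with b. }
  destruct (continuity_ab_maj
    (fun s => (Re (f (RtoC s)) ^ 2 + Im (f (RtoC s)) ^ 2)%R) 0 1)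
    as [s0 [Hmax Hs0]]; [lra| |].
  { intros s Hs. destruct (Hder s Hs) as [D1 D2].
    apply continuity_pt_plus; apply derivable_continuous_pt; eexists;
      apply is_derive_Reals; [apply (is_derive_pow _ 2 _ _ D1)
                             |apply (is_derive_pow _ 2 _ _ D2)]. }
  set (m := Cmod (f (RtoC s0))).
  assert (Hm : forall s, (0 <= s <= 1)%R -> (Cmod (f (RtoC s)) <= m)%R).
  { intros s Hs. specialize (Hmax s Hs). cbv beta in Hmax.
    rewrite <- !Cmod2_alt in Hmax. fold m in Hmax.
    apply Rsqr_incr_0_var; [unfold Rsqr; lra|apply Cmod_ge_0]. }
  assert (Ha : forall s, (0 <= s <= 1)%R -> (Cmod (a s) <= m * eta)%R).
  { intros s Hs. unfold a. rewrite Cmod_mult.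
    apply Rmult_le_compat; try apply Cmod_ge_0; auto. }
  assert (Hvar : forall s, (0 <= s <= 1)%R ->
            (Cmod (f (RtoC s) - 1) <= 2 * (m * eta))%R).
  { intros s Hs. rewrite <- H0.
    eapply Rle_trans; [apply Cmod_le_abs|].
    assert (B1 := mean_value_bound (fun y => Re (f (RtoC y)))
      (fun y => Re (a y)) (m * eta) 0 s ltac:(lra) Hs
      (fun y Hy => proj1 (Hder y Hy))
      (fun y Hy => Rle_trans _ _ _ (re_le_Cmod (a y)) (Ha y Hy))).
    assert (B2 := mean_value_bound (fun y => Im (f (RtoC y)))
      (fun y => Im (a y)) (m * eta) 0 s ltac:(lra) Hs
      (fun y Hy => proj2 (Hder y Hy))
      (fun y Hy => Rle_trans _ _ _ (im_le_Cmod (a y)) (Ha y Hy))).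
    apply Rle_trans with (m * eta + m * eta)%R; [|lra].
    apply Rplus_le_compat; [exact B1|exact B2]. }
  assert (Hm2 : (m <= 2)%R).
  { assert (K := Hvar s0 Hs0).
    assert (L := Cmod_triangle_sub (f (RtoC s0)) 1).
    rewrite Cmod_1 in L. fold m in L.
    nra. }
  eapply Rle_trans; [apply (Hvar 1%R); lra|].
  assert (0 <= m)%R by apply Cmod_ge_0. nra.
Qed.

Definition Cprod (u : nat -> C) (n : nat) : C :=
  Iter.iter_nat Cmult (RtoC 1) u 0 n.

Lemma Cprod_0 (u : nat -> C) : Cprod u 0 = u 0%nat.
Proof. apply Iter.iter_nat_point. intros; ring. Qed.

Lemma Cprod_Sn (u : nat -> C) (n : nat) :
  Cprod u (S n) = Cprod u n * u (S n).
Proof.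
  unfold Cprod.
  rewrite (Iter.iter_nat_Chasles Cmult (RtoC 1)) with (m := n);
    [|intros; ring|intros; ring|lia|lia].
  rewrite (Iter.iter_nat_point Cmult (RtoC 1)); [reflexivity|intros; ring].
Qed.

Lemma Cprod_eq_0 (u : nat -> C) (n j : nat) :
  (j <= n)%nat -> u j = 0 -> Cprod u n = 0.
Proof.
  induction n as [|n IH]; intros Hj Hu.
  - rewrite Cprod_0. now replace 0%nat with j by lia.
  - rewrite Cprod_Sn. destruct (Nat.eq_dec j (S n)) as [<-|N].
    + rewrite Hu; ring.
    + rewrite IH by (auto; lia). ring.
Qed.

Lemma Cprod_eq_1 (u : nat -> C) (n : nat) :
  (forall j, u j = 1) -> Cprod u n = 1.
Proof.
  intros H; induction n as [|n IH].
  - rewrite Cprod_0; apply H.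
  - rewrite Cprod_Sn, IH, H; ring.
Qed.

Lemma jet2_Cprod (w : nat -> C) (z : C) (n : nat) :
  (forall j, w j <> 0) -> (forall j, w j <> z) ->
  exists b, jet2 (fun y => Cprod (fun j => 1 - y / w j) n) z
    (- Cprod (fun j => 1 - z / w j) n * Csum (fun j => / (w j - z)) n) b.
Proof.
  intros Hw Hz.
  assert (J : forall j, jet2 (fun y => 1 - y / w j) z (- / w j) 0).
  { intros j. apply jet2_ext with (fun y => 1 - / w j * y);
      [intros; unfold Cdiv; ring|].
    eapply jet2_eq; [apply jet2_minus;
      [apply jet2_const|apply jet2_scal, jet2_id]| |]; ring. }
  assert (Hd : forall j, w j - z <> 0)
    by (intros j; apply C_sub_neq_0, Hz).
  induction n as [|n [b IH]].
  - exists 0. rewrite Cprod_0, sum_O.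
    apply jet2_ext with (fun y => 1 - y / w 0%nat);
      [intros; now rewrite Cprod_0|].
    replace (- (1 - z / w 0%nat) * / (w 0%nat - z)) with (- / w 0%nat)
      by (field; auto).
    apply J.
  - rewrite Cprod_Sn, Csum_Sn.
    eexists. apply jet2_ext with (fun y =>
      Cprod (fun j => 1 - y / w j) n * (1 - y / w (S n)));
      [intros; now rewrite Cprod_Sn|].
    eapply jet2_eq; [apply (jet2_mult _ _ _ _ _ _ _ IH (J (S n)))| |reflexivity].
    assert (E : forall P S1 W u : C, W <> 0 -> W - u <> 0 ->
      - P * S1 * (1 - u / W) + P * - / W
      = - (P * (1 - u / W)) * (S1 + / (W - u)))
      by (intros; field; auto).
    apply E; auto.
Qed.

(** The partial product divided by its expected limit; its logarithmic
    derivative is the defect. *)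
Definition prod_ratio (x : C) (K : nat) (z : C) : C :=
  x * Cprod (fun j => 1 - z / branch x K j) (2 * K) * Cexp (- (z / 2))
  * / lamb x z.

Lemma jet2_prod_ratio (x : C) (K : nat) (z : C) : x <> 0 -> lamb x z <> 0 ->
  exists b, jet2 (prod_ratio x K) z (prod_ratio x K z * defect x K z) b.
Proof.
  intros Hx Hz.
  destruct (jet2_Cprod (branch x K) z (2 * K)) as [b Jp].
  { intros j; now apply lambertW_neq_0. }
  { intros j E. apply Hz. rewrite <- E. now apply lamb_branch. }
  assert (Jh : jet2 (fun w => w / 2) z (/ 2) 0).
  { apply jet2_ext with (fun w => / 2 * w); [intros; unfold Cdiv; ring|].
    eapply jet2_eq; [apply jet2_scal, jet2_id| |]; ring. }
  assert (Je := jet2_comp (fun w => Cexp (- w)) _ _ _ _ _ _ Jh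
                  (jet2_Cexp_opp (z / 2))).
  assert (J := jet2_mult _ _ _ _ _ _ _
    (jet2_mult _ _ _ _ _ _ _ (jet2_scal x _ _ _ _ Jp) Je)
    (jet2_inv _ _ _ _ (jet2_lamb x z) Hz)).
  eexists. apply (jet2_eq _ _ _ _ _ _ J); [|reflexivity].
  unfold prod_ratio, defect, lamb_sum. fold (branch_sum x K z).
  set (P := Cprod _ _). set (e := Cexp (- (z / 2))).
  set (S1 := branch_sum x K z).
  assert (E : x * Cexp (- z) = lamb x z + z) by (unfold lamb; ring).
  rewrite E. field. exact Hz.
Qed.

Lemma prod_ratio_0 (x : C) (K : nat) : x <> 0 -> prod_ratio x K 0 = 1.
Proof.
  intros Hx. unfold prod_ratio, lamb.
  rewrite Cprod_eq_1 by (intros; unfold Cdiv; ring).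
  replace (- (0 / 2)) with (RtoC 0) by (unfold Cdiv; ring).
  replace (- 0) with (RtoC 0) by ring. rewrite !Cexp_0. field.
  intros E; apply Hx. rewrite <- E. ring.
Qed.

(** For fixed [t], a point other than [0] and [t] lies on the curve of at
    most one parameter [c]. A path from [0] to [t] can thus avoid the
    finitely many zeros of [lamb x] nearby. *)
Definition parabola (t : C) (c : R) (s : C) : C :=
  s * t + Ci * RtoC c * (s * (1 - s)) * t.

Lemma zeros_bounded_finite (x : C) (R0 : R) : x <> 0 ->
  exists l, forall z, (Cmod z <= R0)%R -> lamb x z = 0 -> In z l.
Proof.
  intros Hx. assert (HP := PI_gt_3).
  destruct (INR_unbounded (Rmax 1 R0)) as [K HK].
  assert (M1 := Rmax_l 1 R0). assert (M2 := Rmax_r 1 R0).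
  destruct (Cexp_log x Hx) as [_ Hphi].
  exists (branches x K). intros z Hz Hl. apply zero_in_strip; auto.
  assert (L := im_le_Cmod z).
  assert (L' : (Rabs (Im z) <= INR K)%R) by lra.
  apply Rabs_le_between in L'. unfold box_bot, box_top.
  assert (3 * INR K <= PI * INR K)%R by (apply Rmult_le_compat_r; lra).
  assert (PI * 1 <= PI * INR K)%R by (apply Rmult_le_compat_l; lra).
  lra.
Qed.

Lemma parabola_bound (t : C) (c s : R) : (0 < c < 1)%R -> (0 <= s <= 1)%R ->
  (Cmod (parabola t c (RtoC s)) <= 2 * Cmod t)%R.
Proof.
  intros Hc Hs. unfold parabola.
  assert (Ht := Cmod_ge_0 t).
  eapply Rle_trans; [apply Cmod_triangle|].
  replace (RtoC s * (1 - RtoC s)) with (RtoC (s * (1 - s)))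
    by (rewrite RtoC_mult, RtoC_minus; ring).
  rewrite !Cmod_mult, Cmod_Ci, !Cmod_R, !Rabs_pos_eq by nra.
  assert (c * (s * (1 - s)) <= 1)%R by nra.
  nra.
Qed.

Lemma parabola_avoids_zeros (x t : C) : x <> 0 -> lamb x t <> 0 -> t <> 0 ->
  exists c, (0 < c < 1)%R /\
    forall s, (0 <= s <= 1)%R -> lamb x (parabola t c (RtoC s)) <> 0.
Proof.
  intros Hx Hl Ht.
  destruct (zeros_bounded_finite x (2 * Cmod t) Hx) as [l Hfin].
  set (bad := fun w : C =>
    (Im (w / t)%C / (Re (w / t)%C * (1 - Re (w / t)%C)))%R).
  destruct (avoid_list (map bad l) 0 1) as [c [Hc Hcl]]; [lra|].
  exists c; split; [exact Hc|intros s Hs E].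
  assert (Hin := Hfin _ (parabola_bound t c s Hc Hs) E).
  apply Hcl. apply (in_map bad) in Hin.
  assert (Ew : parabola t c (RtoC s) / t = (s, (c * (s * (1 - s)))%R)).
  { transitivity (RtoC s + Ci * RtoC c * (RtoC s * (1 - RtoC s))).
    - unfold parabola. field. exact Ht.
    - unfold Ci, RtoC, Cminus, Copp, Cplus, Cmult; simpl. f_equal; ring. }
  destruct (Req_dec s 0) as [->|N0].
  { exfalso. apply Hx. replace x with (lamb x (parabola t c 0)); [exact E|].
    unfold parabola, lamb.
    replace (0 * t + Ci * c * (0 * (1 - 0)) * t) with (RtoC 0) by ring.
    replace (- RtoC 0) with (RtoC 0) by ring. rewrite Cexp_0. ring. }
  destruct (Req_dec s 1) as [->|N1].
  { exfalso. apply Hl. rewrite <- E. f_equal. unfold parabola. ring. }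
  unfold bad in Hin. rewrite Ew in Hin. simpl in Hin.
  replace c with (c * (s * (1 - s)) / (s * (1 - s)))%R; [exact Hin|].
  field. split; lra.
Qed.

Lemma jet2_parabola (t : C) (c : R) (s : C) : exists b,
  jet2 (parabola t c) s (t + Ci * RtoC c * t * (1 - 2 * s)) b.
Proof.
  assert (J1 := jet2_id s).
  assert (J2 := jet2_minus _ _ _ _ _ _ _ (jet2_const 1 s) J1).
  assert (J := jet2_plus _ _ _ _ _ _ _ (jet2_scal t _ _ _ _ J1)
    (jet2_scal (Ci * RtoC c * t) _ _ _ _ (jet2_mult _ _ _ _ _ _ _ J1 J2))).
  eexists. eapply jet2_ext;
    [|apply (jet2_eq _ _ _ _ _ _ J); [ring|reflexivity]].
  intros w. unfold parabola. ring.
Qed.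

Lemma prod_ratio_tends_to_1 (x t : C) (eps : R) : x <> 0 -> lamb x t <> 0 ->
  t <> 0 -> (0 < eps)%R -> exists K0, forall K, (K0 <= K)%nat ->
  (Cmod (prod_ratio x K t - 1) <= eps)%R.
Proof.
  intros Hx Hl Ht He.
  assert (Htp : (0 < Cmod t)%R) by now apply Cmod_gt_0.
  destruct (parabola_avoids_zeros x t Hx Hl Ht) as [c [Hc Hav]].
  set (eta := Rmin (/ 4) (eps / 4)).
  assert (Heta : (0 < eta)%R) by (apply Rmin_pos; lra).
  assert (Heta1 : (eta <= / 4)%R) by apply Rmin_l.
  assert (Heta2 : (eta <= eps / 4)%R) by apply Rmin_r.
  destruct (defect_tends_to_0 x (2 * Cmod t) (eta / (2 * Cmod t)) Hx)
    as [K0 [_ HK]]; [apply Rdiv_lt_0_compat; lra|].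
  exists K0; intros K HKK.
  set (f := fun s => prod_ratio x K (parabola t c s)).
  set (d := fun s => defect x K (parabola t c s)
                     * (t + Ci * RtoC c * t * (1 - 2 * s))).
  assert (E1 : parabola t c 1 = t) by (unfold parabola; ring).
  assert (E0 : parabola t c 0 = 0) by (unfold parabola; ring).
  replace (prod_ratio x K t) with (f 1) by (unfold f; now rewrite E1).
  eapply Rle_trans; [apply (small_log_derivative f d eta)|lra].
  - unfold f. rewrite E0. now apply prod_ratio_0.
  - lra.
  - intros s Hs.
    destruct (jet2_parabola t c (RtoC s)) as [b Jp].
    destruct (jet2_prod_ratio x K _ Hx (Hav s Hs)) as [b' Jr].
    eexists. unfold f, d. rewrite Cmult_assoc.
    exact (jet2_comp _ _ _ _ _ _ _ Jp Jr).
  - intros s Hs. unfold d. rewrite Cmod_mult.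
    assert (D := HK K _ HKK (parabola_bound t c s Hc Hs) (Hav s Hs)).
    assert (G : (Cmod (t + Ci * RtoC c * t * (1 - 2 * RtoC s)) <= 2 * Cmod t)%R).
    { eapply Rle_trans; [apply Cmod_triangle|].
      replace (1 - 2 * RtoC s) with (RtoC (1 - 2 * s))
        by (rewrite RtoC_minus, RtoC_mult; reflexivity).
      rewrite !Cmod_mult, Cmod_Ci, !Cmod_R, (Rabs_pos_eq c) by lra.
      assert (A : (Rabs (1 - 2 * s) <= 1)%R) by (apply Rabs_le_between; lra).
      assert (A0 := Rabs_pos (1 - 2 * s)). assert (c * Cmod t <= Cmod t)%R by nra.
      nra. }
    apply Rle_trans with (eta / (2 * Cmod t) * (2 * Cmod t))%R.
    + apply Rmult_le_compat; try apply Cmod_ge_0; assumption.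
    + right. field. lra.
Qed.

Theorem lambertW_product (x t : C) : x <> 0 ->
  is_prod_Z (fun k => 1 - t / lambertW k x)
    (Cexp (- t / 2) - t / x * Cexp (t / 2)).
Proof.
  intros Hx. apply filterlim_C_of_Cmod.
  assert (Elim : Cexp (- t / 2) - t / x * Cexp (t / 2)
                 = lamb x t * Cexp (t / 2) / x).
  { unfold lamb. replace (Cexp (- t / 2)) with (Cexp (- t) * Cexp (t / 2)).
    - field. exact Hx.
    - rewrite <- Cexp_plus. f_equal. field. }
  rewrite Elim.
  assert (Eprod : forall K,
    Iter.iter_nat Cmult (RtoC 1)
      (fun j => 1 - t / lambertW (Z.of_nat j - Z.of_nat K) x) 0 (2 * K)
    = Cprod (fun j => 1 - t / branch x K j) (2 * K)) by reflexivity.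
  destruct (Ceq_dec (lamb x t) 0) as [Hl|Hl].
  { (* t is a value of some branch: one of the factors vanishes *)
    apply lamb_eq_0_iff in Hl as Hl'.
    destruct (lambertW_complete x t Hx Hl') as [k Hk].
    intros eps He. exists (Z.abs_nat k). intros K HK. rewrite Eprod, Hl.
    rewrite (Cprod_eq_0 _ _ (Z.to_nat (k + Z.of_nat K))).
    - replace (0 * Cexp (t / 2) / x - 0) with (RtoC 0) by (unfold Cdiv; ring).
      rewrite Cmod_0; lra.
    - lia.
    - unfold branch.
      replace (Z.of_nat (Z.to_nat (k + Z.of_nat K)) - Z.of_nat K)%Z with k by lia.
      rewrite <- Hk. field. rewrite Hk. now apply lambertW_neq_0. }
  destruct (Ceq_dec t 0) as [Ht|Ht].
  { intros eps He. exists 0%nat. intros K _. rewrite Eprod, Ht.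
    rewrite Cprod_eq_1 by (intros; unfold Cdiv; ring).
    replace (0 / 2) with (RtoC 0) by (unfold Cdiv; ring).
    unfold lamb. replace (- RtoC 0) with (RtoC 0) by ring. rewrite Cexp_0.
    replace ((x * 1 - 0) * 1 / x - 1) with (RtoC 0) by (field; exact Hx).
    rewrite Cmod_0; lra. }
  set (v := lamb x t * Cexp (t / 2) / x).
  intros eps He. assert (Hv := Cmod_ge_0 v).
  destruct (prod_ratio_tends_to_1 x t (eps / (1 + Cmod v)) Hx Hl Ht)
    as [K0 HK]; [apply Rdiv_lt_0_compat; lra|].
  exists K0; intros K HKK. rewrite Eprod. specialize (HK K HKK).
  assert (E : Cprod (fun j => 1 - t / branch x K j) (2 * K)
              = prod_ratio x K t * v).
  { unfold prod_ratio, v. rewrite Cexp_opp. field.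
    repeat split; auto. apply Cexp_neq_0. }
  rewrite E, Cmod_sym.
  replace (prod_ratio x K t * v - v) with ((prod_ratio x K t - 1) * v) by ring.
  rewrite Cmod_mult.
  apply Rle_trans with (eps / (1 + Cmod v) * Cmod v)%R.
  - apply Rmult_le_compat_r; assumption.
  - apply Rmult_le_reg_r with (1 + Cmod v)%R; [lra|].
    replace (eps / (1 + Cmod v) * Cmod v * (1 + Cmod v))%R
      with (eps * Cmod v)%R by (field; lra). nra.
Qed.

(** * The derivative of a branch *)

(** Near [1] the cosine of the argument is close to [1]. *)
Lemma Clog_near_1 (eps : R) : (0 < eps)%R -> exists d, (0 < d)%R /\
  forall u, (Cmod (u - 1) < d)%R -> (Cmod (Clog u) < eps)%R.
Proof.
  intros He. assert (HP := PI_gt_3).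
  set (e := Rmin 1 (eps / 4)).
  assert (He0 : (0 < e)%R) by (apply Rmin_pos; lra).
  assert (He1 : (e <= 1)%R) by apply Rmin_l.
  assert (He2 : (e <= eps / 4)%R) by apply Rmin_r.
  assert (Hc : (cos e < 1)%R).
  { rewrite <- cos_0. apply cos_decreasing_1; lra. }
  set (d := Rmin (e / 2) ((1 - cos e) / 4)).
  assert (Hd0 : (0 < d)%R) by (apply Rmin_pos; lra).
  assert (Hd1 : (d <= e / 2)%R) by apply Rmin_l.
  assert (Hd2 : (d <= (1 - cos e) / 4)%R) by apply Rmin_r.
  exists d; split; [exact Hd0|intros u Hu].
  assert (M1 := Cmod_triangle_sub u 1). assert (M2 := Cmod_triangle_sub 1 u).
  rewrite (Cmod_sym 1 u) in M2. rewrite Cmod_1 in M1, M2.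
  assert (Hu0 : u <> 0) by (apply Cmod_gt_0; lra).
  assert (Hup : (0 < Cmod u)%R) by lra.
  destruct (Cexp_log u Hu0) as [Eu Tu].
  set (th := Im (Clog u)) in *.
  assert (Hre : (Re u = Cmod u * cos th)%R).
  { rewrite <- Eu at 1. change (Re (Cexp (Clog u))) with
      (exp (ln (Cmod u)) * cos th)%R.
    now rewrite exp_ln. }
  assert (Hru : (1 - d < Re u)%R).
  { assert (K := re_le_Cmod (u - 1)).
    change (Re (u - 1)) with (Re u + - 1)%R in K.
    assert (K' := Rle_lt_trans _ _ _ K Hu). apply Rabs_lt_between in K'. lra. }
  assert (Hcos : (cos e < cos th)%R).
  { apply Rnot_le_lt; intros L. nra. }
  assert (Hth : (Rabs th < e)%R).
  { apply Rnot_le_lt; intros L.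
    assert (K : (cos (Rabs th) <= cos e)%R).
    { destruct L as [L|L]; [|rewrite L; lra].
      left; apply cos_decreasing_1; try lra.
      apply Rabs_le_between; lra. }
    assert (E : cos (Rabs th) = cos th).
    { unfold Rabs; destruct (Rcase_abs th); [apply cos_neg|reflexivity]. }
    lra. }
  assert (Hln : (Rabs (Re (Clog u)) <= e)%R).
  { change (Re (Clog u)) with (ln (Cmod u)).
    assert (L1 := ln_le_sub_1 (Cmod u) Hup).
    assert (L2 := ln_le_sub_1 (/ Cmod u) (Rinv_0_lt_compat _ Hup)).
    rewrite ln_Rinv in L2 by exact Hup.
    assert (L3 : (/ Cmod u <= 1 + e)%R).
    { apply Rmult_le_reg_l with (Cmod u); [exact Hup|].
      rewrite Rinv_r by lra. nra. }
    apply Rabs_le_between; lra. }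
  eapply Rle_lt_trans; [apply Cmod_le_abs|]. fold th. lra.
Qed.

(** The complement of [ ]-oo, 0] ], where the logarithm is continuous. *)
Definition slit (z : C) : Prop := z <> 0 /\ ~ (Im z = 0%R /\ (Re z < 0)%R).

Lemma slit_arg (z : C) : slit z -> (- PI < Im (Clog z) < PI)%R.
Proof.
  intros [Hz Hn]. destruct (Cexp_log z Hz) as [_ [H1 [H2|H2]]]; [lra|].
  elim Hn. now apply arg_eq_PI_iff.
Qed.

Lemma cont_Clog (z : C) : slit z -> cont Clog z.
Proof.
  intros Hz e He. assert (Ha := slit_arg z Hz). destruct Hz as [Hz _].
  destruct (pos_below_3 e (PI - Im (Clog z)) (PI + Im (Clog z)))
    as (e' & He' & E1 & E2 & E3); [lra..|].
  destruct (Clog_near_1 e' He') as [d [Hd H]].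
  assert (Hm : (0 < Cmod z)%R) by now apply Cmod_gt_0.
  exists (Rmin (Cmod z) (d * Cmod z))%R; split;
    [apply Rmin_pos; [lra|now apply Rmult_lt_0_compat]|intros w Hw].
  assert (Hw1 := lt_Rmin_l Hw).
  assert (Hw2 := lt_Rmin_r Hw).
  assert (Hw0 : w <> 0).
  { intros ->. rewrite Cmod_sym in Hw1.
    replace (z - 0) with z in Hw1 by ring. lra. }
  assert (Hq : (Cmod (Clog (w / z)) < e')%R).
  { apply H. replace (w / z - 1) with ((w - z) / z) by (field; exact Hz).
    rewrite Cmod_div by exact Hz. now apply Rlt_div_l. }
  assert (Hqi := Rle_lt_trans _ _ _ (im_le_Cmod _) Hq).
  apply Rabs_lt_between in Hqi.
  assert (Ew : Clog w = Clog z + Clog (w / z)).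
  { rewrite <- (Clog_exp (Clog z + Clog (w / z))).
    - f_equal. rewrite Cexp_plus, (proj1 (Cexp_log z Hz)).
      assert (Hwz : w / z <> 0).
      { intros F. apply Hw0. replace w with (w / z * z) by (field; exact Hz).
        rewrite F; ring. }
      rewrite (proj1 (Cexp_log (w / z) Hwz)). field. exact Hz.
    - change (Im (Clog z + Clog (w / z)))
        with (Im (Clog z) + Im (Clog (w / z)))%R. lra. }
  rewrite Ew. replace (Clog z + Clog (w / z) - Clog z) with (Clog (w / z)) by ring.
  lra.
Qed.

Lemma slit_open (z : C) : slit z -> exists r, (0 < r)%R /\
  forall w, (Cmod (w - z) < r)%R -> slit w.
Proof.
  intros [Hz Hn]. assert (Hm : (0 < Cmod z)%R) by now apply Cmod_gt_0.
  assert (Hr : exists r, (0 < r)%R /\ forall w, (Cmod (w - z) < r)%R ->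
                 ~ (Im w = 0%R /\ (Re w < 0)%R)).
  { destruct (Req_dec (Im z) 0) as [Hi|Hi].
    - assert (Hre : (0 < Re z)%R).
      { destruct (Rtotal_order (Re z) 0) as [L|[L|L]]; [tauto| |exact L].
        elim Hz. apply C_of_parts; assumption. }
      exists (Re z); split; [exact Hre|intros w Hw [_ L]].
      assert (K := Rle_lt_trans _ _ _ (re_le_Cmod _) Hw).
      change (Re (w - z)) with (Re w + - Re z)%R in K.
      apply Rabs_lt_between in K. lra.
    - exists (Rabs (Im z)); split; [now apply Rabs_pos_lt|intros w Hw [L _]].
      assert (K := Rle_lt_trans _ _ _ (im_le_Cmod _) Hw).
      rewrite Im_sub, L, Rminus_0_l, Rabs_Ropp in K. lra. }
  destruct Hr as [r [Hr H]].
  exists (Rmin r (Cmod z)); split; [now apply Rmin_pos|intros w Hw].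
  split; [|apply H, (lt_Rmin_l Hw)].
  intros ->. assert (K := lt_Rmin_r Hw).
  rewrite Cmod_sym in K. replace (z - 0) with z in K by ring. lra.
Qed.

Lemma slit_generic (k : Z) (z : C) : slit z -> generic k z.
Proof. intros [_ Hn] [[H1 [_ H2]] _]. apply Hn; auto. Qed.

Lemma slit_lambertW_log (k : Z) (z : C) : slit z ->
  lambertW k z + Clog (lambertW k z) = Clog z + 2 * IZR k * PI * Ci.
Proof.
  intros Hz. apply (proj1 (lambertW_spec k z (proj1 Hz)) (slit_generic k z Hz)).
Qed.

Lemma jet2_mul_Cexp (w : C) : exists b,
  jet2 (fun w => w * Cexp w) w (Cexp w * (1 + w)) b.
Proof.
  assert (Jo : jet2 (fun y => - y) w (-(1)) 0).
  { apply jet2_ext with (fun y => (-(1)) * y); [intros; ring|].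
    eapply jet2_eq; [apply jet2_scal, jet2_id| |]; ring. }
  assert (Je := jet2_comp _ _ _ _ _ _ _ Jo (jet2_Cexp_opp (- w))).
  assert (J := jet2_mult _ _ _ _ _ _ _ (jet2_id w) Je).
  cbv beta in J. replace (- - w) with w in J by ring.
  eexists. eapply jet2_ext;
    [|apply (jet2_eq _ _ _ _ _ _ J); [ring|reflexivity]].
  intros y. cbv beta. do 2 f_equal. ring.
Qed.

Lemma slit_mul_Cexp (w : C) : w <> 0 -> slit (w * Cexp w) -> slit w.
Proof.
  intros Hw [H0 Hn]. split; [exact Hw|intros [Hi Hr]]. apply Hn.
  rewrite real_mul_Cexp by exact Hi. simpl. split; [reflexivity|].
  change (Re w * exp (Re w) < 0)%R. generalize (exp_pos (Re w)). nra.
Qed.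

(** By compactness: away from [lambertW k x], one of the equations [w e^w = x]
    and [w + log w = log x + 2 k i pi] fails with a definite margin. The first
    one is there for the points [w] where the logarithm is not continuous. *)
Lemma lambertW_cont (k : Z) (x : C) : slit x -> cont (lambertW k) x.
Proof.
  intros Hx delta Hdelta. assert (Hx0 := proj1 Hx).
  set (w0 := lambertW k x). set (c0 := Clog x + 2 * IZR k * PI * Ci).
  set (m := fun w => (Cmod (w * Cexp w - x) + Cmod (w + Clog w - c0))%R).
  assert (Hloc : forall p, (delta <= Cmod (p - w0))%R -> exists r mu,
    (0 < r)%R /\ (0 < mu)%R /\
    forall w, (Cmod (w - p) < r)%R -> (mu <= m w)%R).
  { intros p Hp.
    assert (Hfar : forall (f : C -> C) c, cont f p -> f p <> c -> exists r mu,
      (0 < r)%R /\ (0 < mu)%R /\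
      forall w, (Cmod (w - p) < r)%R -> (mu <= Cmod (f w - c))%R).
    { intros f c Hf Hc. assert (Hpos := Cmod_sub_pos _ _ Hc).
      destruct (Hf (Cmod (f p - c) / 2)%R) as [r [Hr H]]; [lra|].
      exists r, (Cmod (f p - c) / 2)%R. split; [exact Hr|split; [lra|]].
      intros w Hw. specialize (H w Hw).
      assert (K := Cmod_triangle_sub (f p - c) (f p - f w)).
      replace (f p - c - (f p - f w)) with (f w - c) in K by ring.
      rewrite (Cmod_sym (f p) (f w)) in K. lra. }
    destruct (Ceq_dec (p * Cexp p) x) as [E|N].
    - assert (Hp0 : p <> 0) by (intros ->; apply Hx0; rewrite <- E; ring).
      assert (Hps : slit p) by (apply slit_mul_Cexp; [exact Hp0|now rewrite E]).
      destruct (Hfar (fun w => w + Clog w) c0) as (r & mu & Hr & Hmu & H).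
      + apply cont_plus; [apply cont_id|now apply cont_Clog].
      + intros F. assert (p = w0).
        { apply (lambertW_unique_generic k x p Hx0); auto.
          now apply slit_generic. }
        subst p. replace (w0 - w0) with (RtoC 0) in Hp by ring.
        rewrite Cmod_0 in Hp. lra.
      + exists r, mu. split; [exact Hr|split; [exact Hmu|]]. intros w Hw.
        specialize (H w Hw). unfold m.
        generalize (Cmod_ge_0 (w * Cexp w - x)). lra.
    - destruct (jet2_mul_Cexp p) as [b J].
      destruct (Hfar (fun w => w * Cexp w) x) as (r & mu & Hr & Hmu & H);
        [now apply (jet2_cont _ _ _ _ J)|exact N|].
      exists r, mu. split; [exact Hr|split; [exact Hmu|]]. intros w Hw.
      specialize (H w Hw). unfold m.
      generalize (Cmod_ge_0 (w + Clog w - c0)). lra. }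
  set (L := (Rabs (ln (Cmod x)) + 1)%R).
  set (Bi := (2 * PI * Rabs (IZR k) + 2 * PI)%R).
  set (Br := (2 * L + 6 + 4 * sqrt Bi)%R).
  set (v := fun w => if Rle_dec delta (Cmod (w - w0)) then (/ m w)%R else 0%R).
  destruct (box_bounded (- Br) Br (- Bi) Bi v) as [D [HD Hv]].
  { intros p _. destruct (Rle_dec delta (Cmod (p - w0))) as [Hp|Hp].
    - destruct (Hloc p Hp) as (r & mu & Hr & Hmu & H).
      exists r, (/ mu)%R. split; [exact Hr|intros w _ Hw]. unfold v.
      assert (0 < / mu)%R by now apply Rinv_0_lt_compat.
      destruct (Rle_dec _ _); [|lra]. apply Rinv_le_contravar; auto.
    - exists (delta - Cmod (p - w0))%R, 0%R. split; [lra|intros w _ Hw].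
      unfold v. destruct (Rle_dec delta (Cmod (w - w0))) as [F|F]; [|lra].
      assert (K := Cmod_triangle (w - p) (p - w0)).
      replace (w - p + (p - w0)) with (w - w0) in K by ring. lra. }
  assert (HDi : (0 < / D)%R) by now apply Rinv_0_lt_compat.
  destruct (cont_Clog x Hx (Rmin 1 (/ D / 2))) as [d1 [Hd1 Hlog]];
    [apply Rmin_pos; lra|].
  destruct (slit_open x Hx) as [d2 [Hd2 Hslit]].
  exists (Rmin (/ D / 2) (Rmin d1 d2)). split; [repeat apply Rmin_pos; lra|].
  intros z Hz.
  assert (Z1 := lt_Rmin_l Hz).
  assert (Z' := lt_Rmin_r Hz).
  assert (Z2 := Hlog z (lt_Rmin_l Z')).
  assert (Z3 := Hslit z (lt_Rmin_r Z')).
  assert (Z4 := lt_Rmin_l Z2).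
  assert (Z5 := lt_Rmin_r Z2).
  fold w0. set (w := lambertW k z).
  apply Rnot_le_lt; intros Hfar.
  assert (Hw : w * Cexp w = z) by now apply lambertW_eq, Z3.
  assert (Hwl := slit_lambertW_log k z Z3). fold w in Hwl.
  assert (Hm : (m w < / D)%R).
  { unfold m. rewrite Hw, Hwl.
    replace (Clog z + 2 * IZR k * PI * Ci - c0) with (Clog z - Clog x)
      by (unfold c0; ring). lra. }
  assert (Hbox : in_box (- Br) Br (- Bi) Bi w).
  { assert (HI : (Rabs (Im w) <= Bi)%R).
    { destruct (lambertW_im_bound k z (proj1 Z3)) as (K & _ & _). fold w in K.
      assert (A := slit_arg z Z3). apply Rabs_le_between in K.
      unfold Bi. apply Rabs_le_between.
      assert (K1 := Rle_abs (IZR k)). assert (K2 := Rle_abs (- IZR k)).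
      rewrite Rabs_Ropp in K2.
      assert (PI * IZR k <= PI * Rabs (IZR k))%R
        by (apply Rmult_le_compat_l; lra).
      assert (PI * - IZR k <= PI * Rabs (IZR k))%R
        by (apply Rmult_le_compat_l; lra).
      lra. }
    assert (HR : (Rabs (Re w) <= Br)%R).
    { eapply Rle_trans; [apply (mul_Cexp_re_bound z w (proj1 Z3) Hw)|].
      unfold Br. assert (S1 := sqrt_le_1_alt _ _ HI).
      assert (Hl : (Rabs (ln (Cmod z)) <= L)%R).
      { assert (K := Rle_lt_trans _ _ _ (re_le_Cmod _) Z4).
        change (Re (Clog z - Clog x)) with (ln (Cmod z) + - ln (Cmod x))%R in K.
        unfold L. assert (K' := Rabs_triang_inv (ln (Cmod z)) (ln (Cmod x))).
        unfold Rminus in K'. lra. }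
      lra. }
    apply Rabs_le_between in HI. apply Rabs_le_between in HR.
    split; lra. }
  specialize (Hv w Hbox). unfold v in Hv.
  destruct (Rle_dec delta (Cmod (w - w0))) as [_|F]; [|contradiction].
  destruct (Hloc w Hfar) as (r & mu & Hr & Hmu & H).
  specialize (H w (Cmod_self_lt w r Hr)).
  assert (K : (/ D <= / / m w)%R)
    by (apply Rinv_le_contravar; [apply Rinv_0_lt_compat; lra|exact Hv]).
  rewrite Rinv_inv in K. lra.
Qed.

Lemma is_derive_C_intro (f : C -> C) (z l : C) :
  (forall eps, (0 < eps)%R -> exists d, (0 < d)%R /\ forall w,
     (Cmod (w - z) < d)%R ->
     (Cmod (f w - f z - (w - z) * l) <= eps * Cmod (w - z))%R) ->
  @is_derive C_AbsRing C_NormedModule f z l.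
Proof.
  intros H. split.
  - apply is_linear_scal_l.
  - intros y Hy eps.
    assert (Ey : z = y)
      by (apply (is_filter_lim_locally_unique (V := AbsRing_NormedModule C_AbsRing));
          exact Hy).
    subst y. destruct (H eps (cond_pos eps)) as [d [Hd Hdd]].
    exists (mkposreal d Hd). intros w Hw. exact (Hdd w Hw).
Qed.

(** With [w = lambertW k x], the continuous factor [G] in [z - x = (lambertW
    k z - w) * G (lambertW k z)] is invertible near [w]. *)
Lemma lambertW_is_derive (k : Z) (x : C) : slit x ->
  @is_derive C_AbsRing C_NormedModule (lambertW k) x
    (/ x * (lambertW k x / (lambertW k x + 1))).
Proof.
  intros Hx. assert (Hx0 := proj1 Hx). assert (HC := lambertW_cont k x Hx).
  set (w0 := lambertW k x) in *.
  assert (Ew0 : w0 * Cexp w0 = x) by now apply lambertW_eq.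
  assert (Hw0 : w0 <> 0) by now apply lambertW_neq_0.
  assert (H1 : w0 + 1 <> 0).
  { intros E. apply (proj2 Hx).
    rewrite (lambertW_eq_m1 x k Hx0).
    - simpl. split; [reflexivity|].
      assert (P := Rinv_0_lt_compat _ (exp_pos 1)). lra.
    - fold w0. replace w0 with ((w0 + 1) - 1) by ring. rewrite E.
      unfold Cminus, RtoC, Cplus, Copp; simpl; f_equal; ring. }
  destruct (jet2_mul_Cexp w0) as (b & g & Hg & _ & r & Hr & H).
  set (A := Cexp w0 * (1 + w0)) in *.
  assert (HA : A <> 0).
  { apply Cmult_neq_0; [apply Cexp_neq_0|]. now rewrite Cplus_comm. }
  set (G := fun w => A + (w - w0) * g w).
  assert (EG : G w0 = A) by (unfold G; ring).
  assert (CG : cont G w0) by (unfold G; cont_tac).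
  assert (CI : cont (fun z => / G (lambertW k z)) x).
  { apply (cont_comp (fun w => / G w)); [exact HC|].
    apply cont_inv; [exact CG|]. fold w0. rewrite EG; exact HA. }
  assert (CGW : cont (fun z => G (lambertW k z)) x)
    by (apply cont_comp; [exact HC|exact CG]).
  destruct (cont_neq _ x 0 CGW) as [d1 [Hd1 HG0]].
  { fold w0. rewrite EG; exact HA. }
  destruct (slit_open x Hx) as [d2 [Hd2 Hslit]].
  destruct (HC r Hr) as [d3 [Hd3 HWr]].
  apply is_derive_C_intro. intros eps Heps.
  destruct (CI eps Heps) as [d4 [Hd4 HI]].
  exists (Rmin (Rmin d1 d2) (Rmin d3 d4)). split; [repeat apply Rmin_pos; lra|].
  intros z Hz.
  assert (Z1 := lt_Rmin_l Hz).
  assert (Z2 := lt_Rmin_r Hz).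
  specialize (HG0 z (lt_Rmin_l Z1)).
  specialize (Hslit z (lt_Rmin_r Z1)).
  specialize (HWr z (lt_Rmin_l Z2)).
  specialize (HI z (lt_Rmin_r Z2)).
  fold w0 in HWr, HI |- *. set (w := lambertW k z) in *.
  assert (Ew : w * Cexp w = z) by now apply lambertW_eq, Hslit.
  specialize (H w HWr). rewrite Ew, Ew0 in H. fold (G w) in H.
  assert (E : w - w0 - (z - x) * (/ x * (w0 / (w0 + 1)))
              = (z - x) * (/ G w - / G w0)).
  { assert (Ezx : z - x = (w - w0) * G w) by (rewrite H; ring).
    assert (EA : / A = / x * (w0 / (w0 + 1))).
    { unfold A. rewrite <- Ew0. field.
      repeat split; auto using Cexp_neq_0. }
    rewrite EG, <- EA, Ezx. field. auto. }
  rewrite E, Cmod_mult, Rmult_comm.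
  apply Rmult_le_compat_r; [apply Cmod_ge_0|]. lra.
Qed.

Lemma lambertW'_eq (k : Z) (x : C) : x <> 0 ->
  lambertW' k x = / x * (lambertW k x / (lambertW k x + 1)).
Proof.
  intros Hx. unfold lambertW'. destruct (neg_real_dec x) as [H|H]; [reflexivity|].
  assert (HD := lambertW_is_derive k x (conj Hx H)).
  set (l := / x * (lambertW k x / (lambertW k x + 1))) in *.
  rewrite <- (is_C_derive_unique _ _ _ HD). symmetry.
  apply is_C_derive_unique, (@iota_correct _ C_CompleteNormedModule).
  exists l; split; [exact HD|intros l' HD'].
  now rewrite <- (is_C_derive_unique _ _ _ HD), <- (is_C_derive_unique _ _ _ HD').
Qed.

(** * The identities *)

Lemma Cm1 : RtoC (-1) = -(1).
Proof. unfold RtoC, Copp; simpl; f_equal; ring. Qed.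

Lemma m1_neq_lambertW (x : C) : x <> 0 -> x <> RtoC (- / exp 1) ->
  forall k, RtoC (-1) <> lambertW k x.
Proof.
  intros Hx Hne k E. apply Hne. now apply (lambertW_eq_m1 x k).
Qed.

Lemma lambertW_plus_1_neq_0 (x : C) : x <> 0 -> x <> RtoC (- / exp 1) ->
  forall k, lambertW k x + 1 <> 0.
Proof.
  intros Hx Hne k. replace (lambertW k x + 1) with (lambertW k x - RtoC (-1))
    by (rewrite Cm1; ring).
  generalize (m1_neq_lambertW x Hx Hne k). intros H; now apply C_sub_neq_0, not_eq_sym.
Qed.

Lemma lamb_m1 (x : C) : lamb x (RtoC (-1)) = x * RtoC (exp 1) + 1.
Proof.
  unfold lamb. rewrite <- Cexp_RtoC.
  replace (- RtoC (-1)) with (RtoC 1)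
    by (unfold RtoC, Copp; simpl; f_equal; ring).
  unfold Cminus. f_equal. unfold RtoC, Copp; simpl; f_equal; ring.
Qed.

Lemma lamb_0 (x : C) : lamb x 0 = x.
Proof.
  unfold lamb. replace (- 0) with (RtoC 0) by ring. rewrite Cexp_0. ring.
Qed.

Lemma Cexp_opp_0 : Cexp (- 0) = 1.
Proof. replace (- 0) with (RtoC 0) by ring. apply Cexp_0. Qed.

Lemma lambertW_sum_inv_plus_1 (x : C) : x <> 0 -> x <> RtoC (- / exp 1) ->
  sum_to (fun k => / (lambertW k x + 1)) (/ 2).
Proof.
  intros Hx Hne.
  eapply sum_to_ext; [| |apply (lambertW_sum_inv x (RtoC (-1)) Hx)].
  - intros k. cbv beta. rewrite Cm1. f_equal. ring.
  - unfold lamb_sum. rewrite Cm1. unfold Cdiv. ring.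
  - now apply m1_neq_lambertW.
Qed.

(** By partial fractions for [t <> -1]; otherwise this is the sum of the
    squares. *)
Lemma lambertW_sum_inv_prod (x t : C) : x <> 0 -> x <> RtoC (- / exp 1) ->
  (forall k, t <> lambertW k x) ->
  sum_to (fun k => / ((lambertW k x + 1) * (lambertW k x - t))) (/ lamb x t).
Proof.
  intros Hx Hne Ht.
  assert (Hm := m1_neq_lambertW x Hx Hne).
  assert (Hl := lamb_neq_0 x t Hx Ht).
  assert (N1 := lambertW_plus_1_neq_0 x Hx Hne).
  destruct (Ceq_dec t (RtoC (-1))) as [->|N].
  - eapply sum_to_ext; [| |apply (proj1 (lambertW_sum_inv_powers x (RtoC (-1)) Hx Hm))].
    + intros k. cbv beta. rewrite Cm1. simpl. f_equal. ring.
    + unfold lamb_sum_d1.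
      replace (x * Cexp (- RtoC (-1))) with (lamb x (RtoC (-1)) + RtoC (-1))
        by (unfold lamb; ring).
      rewrite Cm1 in *. field. exact Hl.
  - assert (N' : 1 + t <> 0).
    { intros E. apply N. rewrite Cm1. replace t with ((1 + t) - 1) by ring.
      rewrite E; ring. }
    eapply sum_to_ext; [| |apply (sum_to_scal (/ (1 + t))),
      (sum_to_minus _ _ _ _ (lambertW_sum_inv x t Hx Ht) (lambertW_sum_inv_plus_1 x Hx Hne))].
    + intros k. cbv beta. specialize (Ht k). specialize (N1 k).
      assert (lambertW k x - t <> 0) by (apply C_sub_neq_0; auto).
      field. auto.
    + unfold lamb_sum. field. repeat split; auto.
Qed.

(** By partial fractions for [t <> -1]; otherwise this is the sum of the
    cubes. *)
Lemma lambertW_sum_inv_prod_2 (x t : C) : x <> 0 -> x <> RtoC (- / exp 1) ->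
  (forall k, t <> lambertW k x) ->
  sum_to (fun k => / ((lambertW k x + 1) * (lambertW k x - t) ^ 2))
    ((x * Cexp (- t) + 1) / (lamb x t) ^ 2).
Proof.
  intros Hx Hne Ht.
  assert (Hm := m1_neq_lambertW x Hx Hne).
  assert (Hl := lamb_neq_0 x t Hx Ht).
  assert (N1 := lambertW_plus_1_neq_0 x Hx Hne).
  destruct (Ceq_dec t (RtoC (-1))) as [->|N].
  - eapply sum_to_ext; [| |apply (proj2 (lambertW_sum_inv_powers x (RtoC (-1)) Hx Hm))].
    + intros k. cbv beta. rewrite Cm1. simpl. f_equal. ring.
    + unfold lamb_sum_d2. rewrite Cm1 in *. simpl.
      field. exact Hl.
  - assert (N' : 1 + t <> 0).
    { intros E. apply N. rewrite Cm1. replace t with ((1 + t) - 1) by ring.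
      rewrite E; ring. }
    eapply sum_to_ext; [| |apply (sum_to_scal (/ (1 + t))),
      (sum_to_minus _ _ _ _ (proj1 (lambertW_sum_inv_powers x t Hx Ht)) (lambertW_sum_inv_prod x t Hx Hne Ht))].
    + intros k. cbv beta. specialize (Ht k). specialize (N1 k).
      assert (lambertW k x - t <> 0) by (apply C_sub_neq_0; auto).
      simpl. field. auto.
    + unfold lamb_sum_d1. replace (x * Cexp (- t)) with (lamb x t + t)
        by (unfold lamb; ring). simpl. field. repeat split; auto.
Qed.

Theorem corollary2p4 (x t : C) (hx : x <> 0) :
  ((forall k : Z, t <> lambertW k x) ->
     is_sum_Z (fun k => 1 / (lambertW k x - t))
       (1 / 2 + (1 + t) / (x * Cexp (- t) - t))) /\
  (x <> RtoC (- / exp 1) ->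
     is_sum_Z (fun k => 1 / (lambertW k x + 1)) (1 / 2)) /\
  is_sum_Z (fun k => 1 / lambertW k x) (1 / 2 + 1 / x) /\
  is_sum_Z (fun k => 1 / lambertW k x ^ 2) ((2 * x + 1) / x ^ 2) /\
  is_sum_Z (fun k => 1 / lambertW k x ^ 3)
    ((3 * x ^ 2 + 6 * x + 2) / (2 * x ^ 3)) /\
  is_prod_Z (fun k => 1 - t / lambertW k x)
    (Cexp (- t / 2) - t / x * Cexp (t / 2)) /\
  (x <> RtoC (- / exp 1) -> (forall k : Z, t <> lambertW k x) ->
     is_sum_Z (fun k => 1 / ((lambertW k x + 1) * (lambertW k x - t)))
       (1 / (x * Cexp (- t) - t))) /\
  ((forall k : Z, t <> lambertW k x) ->
     is_sum_Z (fun k => 1 / (lambertW k x - t) ^ 2)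
       ((x * Cexp (- t) * (2 + t) + 1) / (x * Cexp (- t) - t) ^ 2)) /\
  (x <> RtoC (- / exp 1) ->
     is_sum_Z (fun k => 1 / (lambertW k x + 1) ^ 2)
       (1 / (x * RtoC (exp 1) + 1))) /\
  (x <> RtoC (- / exp 1) -> (forall k : Z, t <> lambertW k x) ->
     is_sum_Z (fun k => 1 / ((lambertW k x + 1) * (lambertW k x - t) ^ 2))
       ((x * Cexp (- t) + 1) / (x * Cexp (- t) - t) ^ 2)) /\
  (x <> RtoC (- / exp 1) ->
     is_sum_Z (fun k => 1 / (lambertW k x + 1) ^ 3)
       (1 / (x * RtoC (exp 1) + 1))) /\
  (x <> RtoC (- / exp 1) -> (forall k : Z, t <> lambertW k x) ->
     is_sum_Z (fun k => lambertW' k x / (lambertW k x - t))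
       (1 / x * (1 / 2 + t / (x * Cexp (- t) - t)))) /\
  (x <> RtoC (- / exp 1) ->
     is_sum_Z (fun k => lambertW' k x / lambertW k x) (1 / (2 * x))).
Proof.
  assert (H0 : forall k, RtoC 0 <> lambertW k x)
    by (intros k E; now apply (lambertW_neq_0 k x hx)).
  assert (E1 : forall z : C, / z = 1 / z)
    by (intros z; unfold Cdiv; ring).
  assert (Em : forall k, lambertW k x - RtoC (-1) = lambertW k x + 1)
    by (intros k; rewrite Cm1; ring).
  assert (Hxe : x <> RtoC (- / exp 1) -> x * RtoC (exp 1) + 1 <> 0).
  { intros Hne. rewrite <- lamb_m1.
    now apply lamb_neq_0, m1_neq_lambertW. }
  assert (N1 := lambertW_plus_1_neq_0 x hx).
  repeat split.
  - intros Ht. apply sum_to_is_sum_Z.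
    apply (sum_to_ext _ _ _ _ (fun k => E1 _)) with (2 := lambertW_sum_inv x t hx Ht).
    unfold lamb_sum, lamb. now rewrite E1.
  - intros Hne. apply sum_to_is_sum_Z.
    apply (sum_to_ext _ _ _ _ (fun k => E1 _))
      with (2 := lambertW_sum_inv_plus_1 x hx Hne). apply E1.
  - apply sum_to_is_sum_Z.
    apply sum_to_ext with (3 := lambertW_sum_inv x 0 hx H0).
    + intros k. rewrite E1. f_equal. ring.
    + unfold lamb_sum. rewrite lamb_0, E1. f_equal. f_equal. ring.
  - apply sum_to_is_sum_Z.
    apply sum_to_ext with (3 := proj1 (lambertW_sum_inv_powers x 0 hx H0)).
    + intros k. rewrite E1. do 2 f_equal. ring.
    + unfold lamb_sum_d1. rewrite lamb_0, Cexp_opp_0. simpl. field. exact hx.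
  - apply sum_to_is_sum_Z.
    apply sum_to_ext with (3 := proj2 (lambertW_sum_inv_powers x 0 hx H0)).
    + intros k. rewrite E1. do 2 f_equal. ring.
    + unfold lamb_sum_d2. rewrite lamb_0, Cexp_opp_0. simpl. field. exact hx.
  - now apply lambertW_product.
  - intros Hne Ht. apply sum_to_is_sum_Z.
    apply (sum_to_ext _ _ _ _ (fun k => E1 _))
      with (2 := lambertW_sum_inv_prod x t hx Hne Ht). apply E1.
  - intros Ht. apply sum_to_is_sum_Z.
    apply (sum_to_ext _ _ _ _ (fun k => E1 _)) with (2 := proj1 (lambertW_sum_inv_powers x t hx Ht)).
    unfold lamb_sum_d1. fold (lamb x t). assert (Hl := lamb_neq_0 x t hx Ht).
    simpl. field. exact Hl.
  - intros Hne. apply sum_to_is_sum_Z.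
    apply sum_to_ext with
      (3 := lambertW_sum_inv_prod x _ hx Hne (m1_neq_lambertW x hx Hne)).
    + intros k. cbv beta. rewrite E1, Em. f_equal. simpl. ring.
    + rewrite lamb_m1. apply E1.
  - intros Hne Ht. apply sum_to_is_sum_Z.
    now apply (sum_to_ext _ _ _ _ (fun k => E1 _))
      with (2 := lambertW_sum_inv_prod_2 x t hx Hne Ht).
  - intros Hne. apply sum_to_is_sum_Z.
    apply sum_to_ext with
      (3 := lambertW_sum_inv_prod_2 x _ hx Hne (m1_neq_lambertW x hx Hne)).
    + intros k. rewrite E1, Em. reflexivity.
    + rewrite lamb_m1.
      replace (x * Cexp (- RtoC (-1))) with (x * RtoC (exp 1)).
      * simpl. field. now apply Hxe.
      * rewrite <- Cexp_RtoC. do 2 f_equal. rewrite Cm1; ring.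
  - intros Hne Ht. apply sum_to_is_sum_Z.
    apply sum_to_ext with (3 := sum_to_scal (/ x) _ _
      (sum_to_minus _ _ _ _ (lambertW_sum_inv x t hx Ht) (lambertW_sum_inv_prod x t hx Hne Ht))).
    + intros k. rewrite lambertW'_eq by exact hx.
      specialize (N1 Hne k).
      assert (lambertW k x - t <> 0)
        by (apply C_sub_neq_0; intros E; now apply (Ht k)).
      field. auto.
    + unfold lamb_sum. fold (lamb x t). assert (Hl := lamb_neq_0 x t hx Ht).
      field. auto.
  - intros Hne. apply sum_to_is_sum_Z.
    apply sum_to_ext with
      (3 := sum_to_scal (/ x) _ _ (lambertW_sum_inv_plus_1 x hx Hne)).
    + intros k. rewrite lambertW'_eq by exact hx.
      specialize (N1 Hne k). specialize (H0 k).
      field. auto.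
    + field. exact hx.
Qed.
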